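(* Let $g\ge2$ and $n\ge 1$, let $\mathcal{S}_{g,n}$ be a genus $g$ Riemann surface (with Schottky uniformization) with $n$ punctures $y_1,\ldots,y_n\in\mathcal{S}_g$ and parameter space $\mathfrak{C}_{g,n}=\mathfrak{C}_g\times(\mathcal{S}_g)^n$, and let $\Psi_2(x,y)$ be a GEM form of weight $N=2$. Then $$\nabla_{\mathfrak{C}_{g,n}}(x):=\sum_{\ell=0}^{2}\sum_{a=1}^{g}\Theta_a(x,\ell)\,\partial_{a,\ell}+\sum_{k=1}^n\Psi_2(x,y_k)\,dy_k\,\partial_{y_k}$$ is a holomorphic vector field on $\mathfrak{C}_{g,n}$ for $x\in\mathcal{S}_{g,n}$.
   Context: Schottky space of parameters: $\mathfrak{C}_g\subset\mathbb{C}^{3g}$ is the set of $(w_1,w_{-1},\rho_1,\ldots,w_g,w_{-g},\rho_g)$ (with $\rho_a\neq0$, $\rho_{-a}=\rho_a$) such that $|w_a-w_b|>|\rho_a|^{1/2}+|\rho_b|^{1/2}$ for all $a\ne b$ in $\{\pm1,\ldots,\pm g\}$. A point determines the Schottky group $\Gamma\subset SL_2(\mathbb{C})$ freely generated by $\gamma_az=w_{-a}+\rho_a/(z-w_a)$, $a=1,\ldots,g$, with limit set $\Lambda(\Gamma)$, $\Omega_0(\Gamma)=\widehat{\mathbb{C}}\setminus\Lambda(\Gamma)$, and the genus $g$ compact surface $\mathcal{S}_g=\Omega_0(\Gamma)/\Gamma$; the exterior $\mathcal{D}$ of the discs $|z-w_a|\le|\rho_a|^{1/2}$ is a fundamental region.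 On $\mathfrak{C}_g$ put $\partial_{a,0}=\partial_{w_a}$, $\partial_{a,1}=\rho_a\partial_{\rho_a}$, $\partial_{a,2}=\rho_a\partial_{w_{-a}}$ for $a=1,\ldots,g$. $\mathcal{H}^{(g)}_2$ is the space of holomorphic quadratic differentials $\Phi=\phi(z)dz^2$ on $\Omega_0(\Gamma)$ with $\Phi(\gamma z)=\Phi(z)$ for $\gamma\in\Gamma$. $\mathcal{H}^{(0)}_{-1}$ is the space of $P=p(z)dz^{-1}$ with $p$ a polynomial of degree $\le2$. For distinct $A_1,A_2,A_3\in\Lambda(\Gamma)$ let $$\Psi_2^{\mathrm{Bers}}(x,y)=\sum_{\gamma\in\Gamma}\frac{1}{\gamma x-y}\prod_{j=1}^{3}\frac{y-A_j}{\gamma x-A_j}\,d(\gamma x)^2dy^{-1}.$$ A GEM form of weight 2 is $\Psi_2(x,y)=\Psi_2^{\mathrm{Bers}}(x,y)-\sum_{r}\Phi_r^\vee(x)P_r(y)$, where $\{\Phi^\vee_r\}$ is a basis of $\mathcal{H}^{(g)}_2$ and $P_r\in\mathcal{H}^{(0)}_{-1}$. It is a quadratic differential in $x$, quasiperiodic of weight $-1$ in $y$, and meromorphic in both with only simple poles at $y=\gamma x$, $\gamma\in\Gamma$. The differentials $\Theta_a(x,\ell)\in\mathcal{H}^{(g)}_2$ ($a=1,\ldots,g$, $\ell=0,1,2$) are defined by $$\Psi_2(x,y)-\Psi_2(x,\gamma_ay)=\sum_{\ell=0}^2\Theta_a(x,\ell)(y-w_a)^\ell\,dy^{-1}.$$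 Conventions: punctures are represented by points $y_k\in\Omega_0(\Gamma)$, and being a vector field on $\mathfrak{C}_{g,n}$ means that the expression $\nabla_{\mathfrak{C}_{g,n}}(x)$ is invariant under the coordinate change $(w_{\pm a},\rho_a,y_k)\mapsto(w_{\pm a},\rho_a,\gamma y_k)$ for $\gamma\in\Gamma$ (where $\gamma y_k$ depends on the parameters $w_{\pm a},\rho_a$ as well as on $y_k$). Its coefficients are quadratic differentials in $x$, and holomorphic refers to their being holomorphic for $x\in\mathcal{S}_{g,n}=\mathcal{S}_g\setminus\{y_1,\ldots,y_n\}$. *)

(* Defs.v *)
From mathcomp Require Import all_boot all_order all_algebra complex.
From mathcomp Require Import all_classical all_reals all_analysis.
From mathcomp Require Import ring.
From mathcomp.analysis.showcase Require summability.
Set Implicit Arguments.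
Unset Strict Implicit.
Unset Printing Implicit Defensive.
Import Order.TTheory GRing.Theory Num.Theory.
Import numFieldNormedType.Exports.
Local Open Scope classical_set_scope.
Local Open Scope ring_scope.

(* R[i] packed as a numClosedFieldType: the normed-module structure of
   numFieldNormedType is not inferred on the bare expression R[i]. *)
Definition Cplx (R : realType) : numClosedFieldType := R[i].

(* The Riemann sphere; None is the point at infinity. *)
Definition Chat (R : realType) := one_point_compactification (Cplx R).

(* A parameter point is p = ((w_1, .., w_g), (w_-1, .., w_-g), (rho_1, .., rho_g)). *)
Definition params (R : realType) (g : nat) : Type :=
  ('rV[Cplx R]_g * 'rV[Cplx R]_g * 'rV[Cplx R]_g)%type.

(* Points of params x C^n.  The chart y of S_g around a point is the coordinate
   of a finite representative in Omega_0; every orbit has one. *)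
Definition config (R : realType) (g n : nat) : Type :=
  (params R g * 'rV[Cplx R]_n)%type.


Section Schottky.
Variables (R : realType) (g : nat).
Local Notation C := (Cplx R).

Definition rho (p : params R g) (a : 'I_g) : C := p.2 0 a.

(* (a, true) stands for the index a and (a, false) for -a. *)
Definition w (p : params R g) (a : 'I_g * bool) : C :=
  if a.2 then p.1.1 0 a.1 else p.1.2 0 a.1.

Definition schottky_space : set (params R g) := [set p |
  (forall a, rho p a != 0) /\
  (forall a b : 'I_g * bool, a != b ->
     sqrtC `|rho p a.1| + sqrtC `|rho p b.1| < `|w p a - w p b|)].

(* The matrix [w_-a, rho_a - w_a w_-a; 1, -w_a] of gamma_a has determinant
   -rho_a, hence the normalisation. *)
Definition gamma_mx (p : params R g) (a : 'I_g) : 'M[C]_2 :=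
  let wp := w p (a, true) in let wm := w p (a, false) in
  (sqrtC (- rho p a))^-1 *:
  \matrix_(i < 2, j < 2)
    if i == 0 then (if j == 0 then wm else rho p a - wp * wm)
    else (if j == 0 then 1 else - wp).

(* An element of the free group, as a word in the gamma_a (letter (a, true)) and
   their inverses (letter (a, false)), to be evaluated at each parameter point. *)
Definition word := seq ('I_g * bool).

(* The inverse letter is the inverse matrix and not the matrix of
   z |-> w_a + rho_a / (z - w_-a), which differs from it by a sign and would
   put -1 in the group. *)
Definition word_mx (p : params R g) (s : word) : 'M[C]_2 :=
  \prod_(a <- s) (if a.2 then gamma_mx p a.1 else (gamma_mx p a.1)^-1).

Definition Gamma (p : params R g) : set 'M[C]_2 := range (word_mx p).

Definition moeb_num (M : 'M[C]_2) (z : C) : C := M 0 0 * z + M 0 1.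
Definition moeb_den (M : 'M[C]_2) (z : C) : C := M 1 0 * z + M 1 1.

(* Finite chart; meaningful when moeb_den M z != 0. *)
Definition moeb (M : 'M[C]_2) (z : C) : C := moeb_num M z / moeb_den M z.

(* Derivative of moeb M at z when \det M = 1. *)
Definition dmoeb (M : 'M[C]_2) (z : C) : C := (moeb_den M z) ^- 2.

Lemma moeb_gammaE (p : params R g) (a : 'I_g) (z : C) :
  rho p a != 0 -> z != w p (a, true) ->
  moeb (gamma_mx p a) z = w p (a, false) + rho p a / (z - w p (a, true)).
Proof.
move=> r0 zw; rewrite /moeb /moeb_num /moeb_den !mxE /=.
have s0 : sqrtC (- rho p a) != 0 by rewrite sqrtC_eq0 oppr_eq0.
have d0 : z - w p (a, true) != 0 by rewrite subr_eq0.
by field; rewrite ?d0 ?s0.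
Qed.

Lemma det_gamma_mx (p : params R g) (a : 'I_g) :
  rho p a != 0 -> \det (gamma_mx p a) = 1.
Proof.
move=> r0; rewrite (expand_det_row _ 0) !big_ord_recl big_ord0 /cofactor !det_mx11 !mxE /=.
have s0 : sqrtC (- rho p a) != 0 by rewrite sqrtC_eq0 oppr_eq0.
have s2 : sqrtC (- rho p a) ^+ 2 = - rho p a by rewrite sqrtCK.
apply: (mulfI (expf_neq0 2 s0)); rewrite mulr1 {2}s2.
by field.
Qed.

Definition moebius (M : 'M[C]_2) (z : Chat R) : Chat R :=
  if z is Some z' then
    if moeb_den M z' == 0 then None else Some (moeb M z')
  else
    if M 1 0 == 0 then None else Some (M 0 0 / M 1 0).

Definition orbit (p : params R g) (z : Chat R) : set (Chat R) :=
  [set moebius M z | M in Gamma p].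

(* zeta is a limit point when some orbit accumulates at it. *)
Definition limit_set (p : params R g) : set (Chat R) := [set zeta |
  exists z : Chat R, forall U : set (Chat R), nbhs zeta U ->
    infinite_set [set M | Gamma p M /\ U (moebius M z)]].

Definition Omega0 (p : params R g) : set (Chat R) := ~` limit_set p.

(* phi stands for phi(z) dz^2 on the open set U of the sphere.  In the chart
   u = 1/z at infinity it reads phi(1/u) u^-4 du^2. *)
Definition holomorphic_qd (U : set (Chat R)) (phi : C -> C) : Prop :=
  (forall z : C, U (Some z) -> derivable phi z 1) /\
  (U None -> exists2 psi : C -> C,
     derivable psi 0 1 & \forall u \near (0 : C)^', phi u^-1 = u ^+ 4 * psi u).

Definition invariant_qd (p : params R g) (U : set (Chat R)) (phi : C -> C) :
    Prop :=
  forall (M : 'M[C]_2) (z : C), Gamma p M -> U (Some z) -> moeb_den M z != 0 ->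
    phi (moeb M z) * dmoeb M z ^+ 2 = phi z.

(* For Gamma-invariant U: holomorphic quadratic differentials on U / Gamma. *)
Definition quadratic_differential (p : params R g) (U : set (Chat R))
    (phi : C -> C) : Prop :=
  holomorphic_qd U phi /\ invariant_qd p U phi.

Definition H2 (p : params R g) : set (C -> C) :=
  [set phi | quadratic_differential p (Omega0 p) phi].

(* Differentials are compared on Omega_0 only, as phi is total. *)
Definition H2_basis (p : params R g) (d : nat) (Phi : 'I_d -> C -> C) : Prop :=
  (forall r, H2 p (Phi r)) /\
  (forall phi, H2 p phi -> exists! c : 'rV[C]_d,
     forall z : C, Omega0 p (Some z) -> phi z = \sum_(r < d) c 0 r * Phi r z).

(* The general term of the Poincare series with the powers of moeb_den M x
   cancelled, which also gives the right value when M x is infinite; the lemma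
   below recovers the usual expression. *)
Definition bers_term (A : 'I_3 -> C) (M : 'M[C]_2) (x y : C) : C :=
  (\prod_(j < 3) (y - A j)) /
  ((moeb_num M x - y * moeb_den M x) *
   \prod_(j < 3) (moeb_num M x - A j * moeb_den M x)).

Lemma bers_termE (A : 'I_3 -> C) (M : 'M[C]_2) (x y : C) :
  moeb_den M x != 0 -> moeb M x != y -> (forall j, moeb M x != A j) ->
  bers_term A M x y =
  (moeb M x - y)^-1 * \prod_(j < 3) ((y - A j) / (moeb M x - A j)) *
  dmoeb M x ^+ 2.
Proof.
rewrite /bers_term /dmoeb => d0 xy xA; rewrite !big_ord_recl !big_ord0.
have e t : moeb_num M x - t * moeb_den M x = (moeb M x - t) * moeb_den M x.
  by rewrite mulrBl /moeb divfK.
rewrite !e.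
have m0 t : moeb M x != t -> moeb M x - t != 0 by rewrite subr_eq0.
have := (m0 _ xy, m0 _ (xA ord0), m0 _ (xA (lift ord0 ord0)),
         m0 _ (xA (lift ord0 (lift ord0 ord0)))) => -[[[? ?] ?] ?].
by field; repeat (apply/andP; split=> //).
Qed.

(* Unordered sum over Gamma: limit along the finite subsets. *)
Definition Psi_Bers (p : params R g) (A : 'I_3 -> C) (x y : C) : C :=
  summability.sum (fun M : Gamma p => bers_term A (val M) x y).

Definition off_poles (p : params R g) (x y : C) : Prop :=
  [/\ Omega0 p (Some x), Omega0 p (Some y) & ~ orbit p (Some x) (Some y)].

(* Psi x y is the coefficient of dx^2 dy^-1.  The points A_j are taken finite
   because infinity is never a limit point of Gamma p. *)
Definition GEM_form (p : params R g) (Psi : C -> C -> C) : Prop :=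
  exists (A : 'I_3 -> C) (d : nat) (Phi : 'I_d -> C -> C)
         (P : 'I_d -> {poly C}),
  [/\ injective A,
      forall j, limit_set p (Some (A j)),
      H2_basis p Phi,
      forall r, (size (P r) <= 3)%N &
      forall x y, off_poles p x y ->
        Psi x y = Psi_Bers p A x y - \sum_(r < d) Phi r x * (P r).[y]].

(* Psi(x, gamma_a y) carries (d gamma_a y)^-1 = (dmoeb gamma_a y)^-1 dy^-1. *)
Definition Theta_of (p : params R g) (Psi : C -> C -> C)
    (Theta : 'I_g -> 'I_3 -> C -> C) : Prop :=
  forall (a : 'I_g) (x y : C), off_poles p x y ->
    moeb_den (gamma_mx p a) y != 0 ->
    Psi x y - Psi x (moeb (gamma_mx p a) y) / dmoeb (gamma_mx p a) y =
    \sum_(l < 3) Theta a l x * (y - w p (a, true)) ^+ l.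

End Schottky.

Section VectorField.
Variables (R : realType) (g n : nat).
Local Notation C := (Cplx R).
Local Notation config := (config R g n).

Definition Cgn : set config := [set q : config |
  schottky_space q.1 /\ forall k : 'I_n, Omega0 q.1 (Some (q.2 0 k))].

(* The preimage of S_{g,n} in Omega_0. *)
Definition punctured (q : config) : set (Chat R) :=
  Omega0 q.1 `\` \bigcup_(k in [set: 'I_n]) orbit q.1 (Some (q.2 0 k)).

Definition d_w (a : 'I_g) (F : config -> C) : config -> C :=
  'D_(((delta_mx 0 a, 0), 0), 0) F.
Definition d_wneg (a : 'I_g) (F : config -> C) : config -> C :=
  'D_(((0, delta_mx 0 a), 0), 0) F.
Definition d_rho (a : 'I_g) (F : config -> C) : config -> C :=
  'D_(((0, 0), delta_mx 0 a), 0) F.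
Definition d_y (k : 'I_n) (F : config -> C) : config -> C :=
  'D_(((0, 0), 0), delta_mx 0 k) F.

Definition d_al (a : 'I_g) (l : 'I_3) (F : config -> C) (q : config) : C :=
  match val l with
  | 0%N => d_w a F q
  | 1%N => rho q.1 a * d_rho a F q
  | _ => rho q.1 a * d_wneg a F q
  end.

Definition nabla (Psi : params R g -> C -> C -> C)
    (Theta : params R g -> 'I_g -> 'I_3 -> C -> C)
    (x : C) (F : config -> C) (q : config) : C :=
  \sum_(l < 3) \sum_(a < g) Theta q.1 a l x * d_al a l F q +
  \sum_(k < n) Psi q.1 x (q.2 0 k) * d_y k F q.

Definition deck (s : 'I_n -> word g) (q : config) : config :=
  (q.1, \row_(k < n) moeb (word_mx q.1 (s k)) (q.2 0 k)).

(* The first order operator D has the same expression in the coordinates q and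
   deck s q, at each q where both are finite. *)
Definition deck_invariant (D : (config -> C) -> config -> C) (q : config) : Prop :=
  forall s : 'I_n -> word g,
    (forall k, moeb_den (word_mx q.1 (s k)) (q.2 0 k) != 0) ->
  forall F : config -> C, differentiable F (deck s q) ->
    D (F \o deck s) q = D F (deck s q).

Definition holomorphic_vector_field (Psi : params R g -> C -> C -> C)
    (Theta : params R g -> 'I_g -> 'I_3 -> C -> C) : Prop :=
  forall q : config, Cgn q ->
  [/\ forall x : C, punctured q (Some x) ->
        deck_invariant (nabla Psi Theta x) q,
      forall a l, quadratic_differential q.1 (punctured q) (Theta q.1 a l) &
      forall k, quadratic_differential q.1 (punctured q)
                  (fun x => Psi q.1 x (q.2 0 k))].

End VectorField.

(* Main.v *)
Require Import Defs.
From mathcomp Require Import all_boot all_order all_algebra complex finmap.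
From mathcomp Require Import all_classical all_reals all_analysis.
From mathcomp Require Import ring lra.
From mathcomp.analysis.showcase Require summability.
Set Implicit Arguments.
Unset Strict Implicit.
Unset Printing Implicit Defensive.
Import Order.TTheory GRing.Theory Num.Theory.
Import numFieldNormedType.Exports.
Local Open Scope classical_set_scope.
Local Open Scope ring_scope.

(** Write [M x = (a x + b) / (c x + d)] for [M] in the Schottky group.

    _Invariance under the deck group._  Both sides of the invariance are
    directional derivatives of [F] at the image point, so by the chain rule one
    has to compare, for each puncture [y] and each word [gamma], the [y]-component
    of the image of the vector field, i.e. to show
      [\sum Theta_a(x, l) d_(a,l)(gamma y) + Psi(x, y) (gamma y)' = Psi(x, gamma y)].
    For a generator [gamma_b] the derivatives [d_(b,l)(gamma_b y)] are
    [rho_b (y - w_b)^l / (y - w_b)^2] and the identity is the definition of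
    [Theta_b].  The identity passes to inverses and products (Leibniz rule for
    matrices, [hwronskM]), hence to all words ([moved_by_word]).  The points that
    a suffix of the word sends to infinity are reached by continuity of [Psi] in
    [y].

    _Holomorphy in x._  [Theta] is a combination of values of [Psi] at finitely
    many [y] ([Theta_formula]), so everything rests on the holomorphy of the Bers
    series.  Up to a factor independent of [M], its general term is the inverse
    of a product of four affine functions of [x].  As soon as their roots keep
    a positive distance from [x], uniformly in [M], absolute convergence at the
    single point [x] gives the derivative at [x] ([derivable_sum_prod_inv]).  The
    point at infinity and the dependence on [y] are instances of the same
    statement.  Invariance in [x] is a reindexing of the sum.

    _Convergence._  By ping-pong a nontrivial element maps the complement of some
    disc of radius [r] into that disc ([Gamma_maps]).  This alone implies the
    rest: the images of that complement are disjoint and contain discs of radius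
    [1 / (2 r |c|^2)] around [M oo], so comparing areas bounds [\sum |c|^-4] over
    the [M] with [M oo] in a given disc by the square of its radius
    ([sum_packing]).  Hence [|c|] tends to infinity, every orbit of an ordinary
    point follows that of infinity, and the finite limit points are the
    accumulation points of the latter ([limit_set_Some]); this gives the
    separation of the roots.  The terms of the series are [|c|^-4] divided by the distances of
    [M oo] to the four points [A_1, A_2, A_3, y].  Only one of these distances can
    be small, and near a limit point [A_j] the packing bound in dyadic shells
    makes the sum converge ([sum_shells]). *)

(** * The modulus of a complex number, and derivatives of functions of one variable *)

Section Modulus.
Variable R : realType.
Local Notation C := (Cplx R).
Implicit Types x y z : C.

(** The norm of [Cplx R] takes its values in [Cplx R], which is only partially
    ordered; the estimates below are made with this real-valued copy of it. *)
Definition nm z : R := Normc.normc z.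

Lemma nmE z : `|z| = (nm z)%:C%C. Proof. by []. Qed.

Lemma nm0 : nm 0 = 0. Proof. exact: Normc.normc0. Qed.

Lemma nm1 : nm 1 = 1. Proof. exact: Normc.normc1. Qed.

Lemma nmM x y : nm (x * y) = nm x * nm y. Proof. exact: Normc.normcM. Qed.

Lemma nmV x : nm x^-1 = (nm x)^-1. Proof. exact: Normc.normcV. Qed.

Lemma nmN x : nm (- x) = nm x.
Proof. by apply: (@complexI R); rewrite -!nmE normrN. Qed.

Lemma nmD x y : nm (x + y) <= nm x + nm y.
Proof. by rewrite -lecR rmorphD /= -!nmE ler_normD. Qed.

Lemma nm_ge0 z : 0 <= nm z.
Proof. by rewrite -ler0c -nmE. Qed.

Lemma nm_eq0 z : (nm z == 0) = (z == 0).
Proof. by apply/eqP/eqP => [/Normc.eq0_normc//|->]; rewrite nm0. Qed.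

Lemma nm_gt0 z : (0 < nm z) = (z != 0).
Proof. by rewrite lt_def nm_ge0 andbT nm_eq0. Qed.

Lemma nmB x y : nm (x - y) <= nm x + nm y.
Proof. by rewrite -(nmN y) nmD. Qed.

Lemma nm_distC x y : nm (x - y) = nm (y - x).
Proof. by rewrite -nmN opprB. Qed.

Lemma nm_triB x y z : nm (x - z) <= nm (x - y) + nm (y - z).
Proof. by rewrite -[x - z](subrKA y) nmD. Qed.

Lemma nm_revB x y : nm x - nm y <= nm (x - y).
Proof. by rewrite lerBlDr -{1}(subrK y x) nmD. Qed.

Lemma nmX z n : nm (z ^+ n) = nm z ^+ n.
Proof. by elim: n => [|n IH]; rewrite ?nm1// !exprS nmM IH. Qed.

Lemma nm_real (a : R) : nm a%:C%C = `|a|.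
Proof. by rewrite /nm /= expr0n /= addr0 sqrtr_sqr. Qed.

Lemma nm_prod (I : Type) (r : seq I) (P : pred I) (F : I -> C) :
  nm (\prod_(i <- r | P i) F i) = \prod_(i <- r | P i) nm (F i).
Proof. exact: (big_morph nm nmM nm1). Qed.

Lemma nm_sum (I : Type) (r : seq I) (P : pred I) (F : I -> C) :
  nm (\sum_(i <- r | P i) F i) <= \sum_(i <- r | P i) nm (F i).
Proof.
elim/big_rec2 : _ => [|i a b _ h]; first by rewrite nm0.
by rewrite (le_trans (nmD _ _))// lerD2l.
Qed.

Lemma ReB x y : complex.Re (x - y) = complex.Re x - complex.Re y.
Proof. by case: x y => [? ?] [? ?]. Qed.

Lemma ImB x y : complex.Im (x - y) = complex.Im x - complex.Im y.
Proof. by case: x y => [? ?] [? ?]. Qed.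

Lemma Re_nm z : `|complex.Re z| <= nm z.
Proof.
case: z => a b; rewrite /nm /= -sqrtr_sqr ler_wsqrtr// lerDl; exact: sqr_ge0.
Qed.

Lemma Im_nm z : `|complex.Im z| <= nm z.
Proof.
case: z => a b; rewrite /nm /= -sqrtr_sqr ler_wsqrtr// lerDr; exact: sqr_ge0.
Qed.

Lemma nm_ReIm z : nm z <= `|complex.Re z| + `|complex.Im z|.
Proof.
rewrite [z in leLHS]complexE (le_trans (nmD _ _))// nm_real lerD2l nmM nm_real.
by rewrite /nm /= expr0n add0r expr1n sqrtr1 mul1r.
Qed.

Lemma posC (e : C) : 0 < e -> exists2 r : R, 0 < r & e = r%:C%C.
Proof.
move=> e0; exists (nm e); first by rewrite nm_gt0 gt_eqF.
by rewrite -nmE gtr0_norm.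
Qed.

Lemma nm_le (a : R) z : (`|z| <= a%:C%C) = (nm z <= a).
Proof. by rewrite nmE lecR. Qed.

Lemma nm_lt (a : R) z : (`|z| < a%:C%C) = (nm z < a).
Proof. by rewrite nmE ltcR. Qed.

Lemma nbhs_nm z (A : set C) :
  nbhs z A <-> exists2 e : R, 0 < e & forall t, nm (t - z) < e -> A t.
Proof.
split=> [/nbhs_ballP[/= e e0 h]|[e e0 h]].
  have [r r0 er] := posC e0.
  by exists r => // t tz; apply: h; rewrite -ball_normE /= er nm_lt nm_distC.
apply/nbhs_ballP; exists e%:C%C => /=; first by rewrite (ltcR 0).
by move=> t; rewrite -ball_normE /= nm_lt nm_distC => /h.
Qed.

Lemma dnbhs_nm z (A : set C) :
  nbhs z^' A <->
  exists2 e : R, 0 < e & forall t, t != z -> nm (t - z) < e -> A t.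
Proof.
apply: (iff_trans (nbhs_nm z (fun t => t != z -> A t))).
by split=> -[e e0 h]; exists e => // t a b; apply: h.
Qed.

(** A quadratic bound on the first order remainder is the form in which the
    derivative of an infinite sum is obtained below. *)
Lemma derivable_quad (F : C -> C) z (L : C) (B d : R) : 0 < d ->
  (forall h, nm h < d -> nm (F (z + h) - F z - h * L) <= B * nm h ^+ 2) ->
  derivable F z 1.
Proof.
move=> d0 hF; apply/cvg_ex; exists L; apply/cvgrPdist_le => _ /posC[e e0 ->].
apply/dnbhs_nm.
have B0 : 0 < `|B| + 1 by rewrite ltr_pwDr.
exists (Num.min d (e / (`|B| + 1))) => [|h h0]; first by rewrite lt_min d0 divr_gt0.
rewrite subr0 lt_min => /andP[hd he].
rewrite nm_le /= /shift /= nm_distC /GRing.scale /= mulr1.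
have -> : h^-1 * (F (h + z) - F z) - L = h^-1 * (F (z + h) - F z - h * L).
  by rewrite [h + z]addrC; field.
rewrite nmM nmV ler_pdivrMl ?nm_gt0// (le_trans (hF _ hd))//.
rewrite [leRHS]mulrC expr2 mulrA ler_wpM2r ?nm_ge0//.
rewrite (@le_trans _ _ ((`|B| + 1) * nm h))//.
  by rewrite ler_wpM2r ?nm_ge0// (le_trans (ler_norm B))// lerDl.
by rewrite -ler_pdivlMl// mulrC ltW.
Qed.

Lemma derivable_shift (F : C -> C) (z : C) :
  derivable F 0 1 -> derivable (fun t => F (t - z)) z 1.
Proof.
rewrite /derivable => h.
have -> : (fun k : C => k^-1 *: (((fun t => F (t - z)) \o shift z) (k *: 1) - F (z - z)))
        = (fun k : C => k^-1 *: ((F \o shift 0) (k *: 1) - F 0)); last exact: h.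
by apply/funext => k; rewrite /= addrK subrr addr0.
Qed.

Lemma derivable_mulc (c : C) (F : C -> C) z :
  derivable F z 1 -> derivable (fun t => c * F t) z 1.
Proof. by move=> dF; exact: (@derivableZ _ _ _ F c z 1 dF). Qed.

Lemma derivable_mul (F H : C -> C) z : derivable F z 1 -> derivable H z 1 ->
  derivable (fun t => F t * H t) z 1.
Proof. by move=> dF dH; exact: (@derivableM _ _ F H z 1 dF dH). Qed.

Lemma derivable_poly (P : {poly C}) z : derivable (fun t => P.[t]) z 1.
Proof.
elim/poly_ind: P => [|P c IH].
  have -> : (fun t : C => (0 : {poly C}).[t]) = cst 0 by apply/funext => t; rewrite horner0.
  exact: derivable_cst.
have -> : (fun t : C => (P * 'X + c%:P).[t]) = (fun t => P.[t] * t) + cst c.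
  by apply/funext => t; rewrite hornerMXaddC.
apply: derivableD; last exact: derivable_cst.
by apply: (@derivable_mul _ id z IH); exact: derivable_id.
Qed.

Lemma derivable_bigsum (I : Type) (s : seq I) (F : I -> C -> C) z :
  (forall i, derivable (F i) z 1) -> derivable (fun t => \sum_(i <- s) F i t) z 1.
Proof.
move=> dF; elim: s => [|i s IH].
  have -> : (fun t => \sum_(i <- [::]) F i t) = cst 0 by apply/funext => t; rewrite big_nil.
  exact: derivable_cst.
have -> : (fun t => \sum_(j <- i :: s) F j t) = F i + (fun t => \sum_(j <- s) F j t).
  by apply/funext => t; rewrite big_cons.
by apply: derivableD; [exact: dF|exact: IH].
Qed.

Lemma derivable_affine (a b : C) z : derivable (fun t => a * t + b) z 1.
Proof.
have -> : (fun t : C => a * t + b) = (fun t => (a *: 'X + b%:P).[t]).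
  by apply/funext => t; rewrite hornerD hornerZ hornerX hornerC.
exact: derivable_poly.
Qed.

Lemma derivable_continuous (F : C -> C) z : derivable F z 1 -> {for z, continuous F}.
Proof. by move=> dF; apply: differentiable_continuous; apply/derivable1_diffP. Qed.

Lemma derivable_compo (F H : C -> C) z : derivable H z 1 -> derivable F (H z) 1 ->
  derivable (fun t => F (H t)) z 1.
Proof.
move=> /derivable1_diffP dH /derivable1_diffP dF; apply/derivable1_diffP.
exact: (differentiable_comp dH dF).
Qed.

(** Extends an identity to the points where an intermediate function has a
    pole. *)
Lemma continuous_dnbhs_eq (f h : C -> C) z :
  {for z, continuous f} -> {for z, continuous h} ->
  (\forall t \near z^', f t = h t) -> f z = h z.
Proof.
move=> /cvgrPdist_lt cf /cvgrPdist_lt ch /dnbhs_nm[d d0 fh].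
apply/eqP; rewrite -subr_eq0 -nm_eq0 eq_le nm_ge0 andbT leNgt; apply/negP.
set e := nm _ => e0.
have e20 : 0 < (e / 2)%:C%C :> C by rewrite (ltcR 0) divr_gt0.
have /nbhs_nm[d1 d10 h1] := cf _ e20; have /nbhs_nm[d2 d20 h2] := ch _ e20.
pose m := Num.min d (Num.min d1 d2).
have m0 : 0 < m by rewrite !lt_min d0 d10 d20.
have nmt : nm (z + (m / 2)%:C%C - z) = m / 2.
  by rewrite addrAC subrr add0r nm_real gtr0_norm// divr_gt0.
have mm : m / 2 < m by lra.
have [md md1 md2] : [/\ m / 2 < d, m / 2 < d1 & m / 2 < d2].
  by have : m / 2 < Num.min d (Num.min d1 d2) := mm; rewrite !lt_min => /and3P[].
have tz : z + (m / 2)%:C%C != z.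
  by rewrite -subr_eq0 -nm_eq0 nmt gt_eqF// divr_gt0.
have := h1 _ (eq_ind_r (fun u => u < d1) md1 nmt).
have := h2 _ (eq_ind_r (fun u => u < d2) md2 nmt).
rewrite !nm_lt (fh _ tz) ?nmt// => a b.
have := nm_triB (f z) (h (z + (m / 2)%:C%C)) (h z); rewrite -/e.
by rewrite (nm_distC _ (h z)); lra.
Qed.

End Modulus.

(** * Unordered sums *)

Section UnorderedSums.
Variables (R : realType) (I : choiceType).
Local Notation C := (Cplx R).

Definition has_sum (f : I -> C) (l : C) : Prop :=
  forall e : R, 0 < e -> exists J0 : {fset I}, forall J : {fset I},
    (J0 `<=` J)%fset -> nm (\sum_(i <- J) f i - l) < e.

Definition abs_summable (f : I -> C) : Prop :=
  exists B : R, forall J : {fset I}, \sum_(i <- J) nm (f i) <= B.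

Lemma has_sumE f l : has_sum f l -> summability.sum f = l.
Proof.
move=> fl; apply: (@cvg_lim _ (@norm_hausdorff _ _)).
  exact: fmap_proper_filter (summability.totally_filter).
apply/(@cvgrPdist_lt _ _ _ _ (@filter_filter _ _ summability.totally_filter)).
move=> _ /posC[e e0 ->]; have [J0 hJ0] := fl _ e0.
exists J0 => // J /= J0J; rewrite nm_lt nm_distC.
have -> : summability.partial_sum f J = \sum_(i <- J) f i by rewrite big_seq_fsetE.
exact: hJ0.
Qed.

Lemma has_sumD f g l m : has_sum f l -> has_sum g m ->
  has_sum (fun i => f i + g i) (l + m).
Proof.
move=> fl gm e e0; have e20 : 0 < e / 2 by rewrite divr_gt0.
have [[J0 h0] [J1 h1]] := (fl _ e20, gm _ e20).
exists (J0 `|` J1)%fset => J; rewrite fsubUset => /andP[/h0 a /h1 b].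
rewrite big_split /= opprD addrACA (le_lt_trans (nmD _ _))//; lra.
Qed.

Lemma has_sumZ f l c : has_sum f l -> has_sum (fun i => c * f i) (c * l).
Proof.
move=> fl e e0; have c0 : 0 < nm c + 1 by rewrite ltr_wpDl ?nm_ge0.
have [J0 h0] := fl _ (divr_gt0 e0 c0); exists J0 => J /h0.
rewrite -mulr_sumr -mulrBr nmM ltr_pdivlMr// => /(le_lt_trans _); apply.
by rewrite mulrC ler_wpM2l ?nm_ge0// lerDl.
Qed.

Lemma has_sum_le f l B : (forall J : {fset I}, nm (\sum_(i <- J) f i) <= B) ->
  has_sum f l -> nm l <= B.
Proof.
move=> fB fl; rewrite leNgt; apply/negP => Bl.
have [J0 /(_ J0 (fsubset_refl _))] := fl (nm l - B) ltac:(by rewrite subr_gt0).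
by have := fB J0; have := nm_revB l (\sum_(i <- J0) f i); rewrite nm_distC; lra.
Qed.

Lemma eq_unordered_sum (f g : I -> C) : f =1 g -> summability.sum f = summability.sum g.
Proof. by move=> /funext ->. Qed.

Lemma has_sum_eq f g l : f =1 g -> has_sum f l -> has_sum g l.
Proof. by move=> /funext ->. Qed.

Lemma sum_fset_le (a : I -> R) (J0 J : {fset I}) : (forall i, 0 <= a i) ->
  (J0 `<=` J)%fset -> \sum_(i <- J0) a i <= \sum_(i <- J) a i.
Proof.
move=> a0 J0J; rewrite (big_fsetID _ (mem J0) J) /=.
have -> : [fset x in J | x \in J0]%fset = J0.
  apply/fsetP => x; rewrite !inE /=; case: (boolP (x \in J0)) => h; rewrite ?andbF//.
  by rewrite (fsubsetP J0J).
by rewrite lerDl sumr_ge0.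
Qed.

Lemma has_sum_nneg (a : I -> R) (B : R) : (forall i, 0 <= a i) ->
  (forall J : {fset I}, \sum_(i <- J) a i <= B) ->
  exists l : R, has_sum (fun i => (a i)%:C%C) l%:C%C.
Proof.
move=> a0 aB; pose S : set R := [set \sum_(i <- J) a i | J in [set: {fset I}]].
have supS : has_sup S.
  split; first by exists (\sum_(i <- fset0) a i), fset0.
  by exists B => _ [J _ <-].
exists (sup S) => e e0; have [_ [J0 _ <-] hJ0] := sup_adherent e0 supS.
exists J0 => J J0J; rewrite -rmorph_sum -rmorphB nm_real.
have h1 : \sum_(i <- J) a i <= sup S by apply: ub_le_sup; [case: supS|exists J].
have h2 := sum_fset_le a0 J0J.
by rewrite ltr_norml; apply/andP; split; lra.
Qed.

Lemma has_sum_real (a : I -> R) (B : R) :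
  (forall J : {fset I}, \sum_(i <- J) `|a i| <= B) ->
  exists l : R, has_sum (fun i => (a i)%:C%C) l%:C%C.
Proof.
move=> aB.
have [l1 h1] := has_sum_nneg (fun i => normr_ge0 (a i)) aB.
have [||l2 h2] := @has_sum_nneg (fun i => `|a i| + a i) (B + B).
- by move=> i; rewrite -lerBlDr sub0r -normrN ler_norm.
- move=> J; rewrite big_split /= lerD// (le_trans _ (aB J))//.
  by apply: ler_sum => i _; exact: ler_norm.
have e (x y : R) : (x - y)%:C%C = x%:C%C + -1 * y%:C%C :> C.
  by rewrite mulN1r rmorphB.
exists (l2 - l1); rewrite e.
apply: has_sum_eq (has_sumD h2 (has_sumZ (-1) h1)) => i.
by rewrite -e addrAC subrr add0r.
Qed.

(** Real and imaginary parts are differences of nonnegative families, whose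
    sums are suprema of their partial sums. *)
Lemma abs_summable_has_sum f : abs_summable f -> has_sum f (summability.sum f).
Proof.
suff: abs_summable f -> exists l, has_sum f l.
  by move=> h /h[l fl]; rewrite (has_sumE fl).
case=> B fB.
have [l hl] : exists l : R, has_sum (fun i => (complex.Re (f i))%:C%C) l%:C%C.
  apply: (@has_sum_real _ B) => J; apply: le_trans (fB J).
  by apply: ler_sum => i _; exact: Re_nm.
have [m hm] : exists l : R, has_sum (fun i => (complex.Im (f i))%:C%C) l%:C%C.
  apply: (@has_sum_real _ B) => J; apply: le_trans (fB J).
  by apply: ler_sum => i _; exact: Im_nm.
exists (l%:C%C + 'i%C * m%:C%C); have := has_sumD hl (has_sumZ ('i%C : C) hm).
by apply: has_sum_eq => i; rewrite -complexE.
Qed.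

Lemma abs_summable_le f g (c : R) : 0 <= c -> (forall i, nm (g i) <= c * nm (f i)) ->
  abs_summable f -> abs_summable g.
Proof.
move=> c0 gf [B fB]; exists (c * B) => J.
rewrite (@le_trans _ _ (\sum_(i <- J) c * nm (f i)))//; first exact: ler_sum.
by rewrite -mulr_sumr ler_wpM2l.
Qed.

(** The estimates of the terms below hold outside a finite set only. *)
Lemma abs_summable_cofinite f (F : {fset I}) (B : R) :
  (forall J : {fset I}, (forall i, i \in J -> i \notin F) ->
     \sum_(i <- J) nm (f i) <= B) -> abs_summable f.
Proof.
move=> fB; exists (\sum_(i <- F) nm (f i) + B) => J.
rewrite (big_fsetID _ (mem F) J) /= lerD//.
  by apply: sum_fset_le => [i|]; [exact: nm_ge0|apply/fsubsetP => i; rewrite !inE /= => /andP[]].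
by apply: fB => i; rewrite !inE /= => /andP[].
Qed.

Lemma has_sum_reindex f l (s s' : I -> I) : cancel s s' -> cancel s' s ->
  has_sum f l -> has_sum (f \o s) l.
Proof.
move=> ss' s's fl e /fl[J0 hJ0]; exists [fset s' i | i in J0]%fset => J hJ.
have -> : \sum_(i <- J) (f \o s) i = \sum_(i <- [fset s i | i in J]%fset) f i.
  by rewrite big_imfset //= => i j _ _ /(can_inj ss').
apply: hJ0; apply/fsubsetP => i iJ0; apply/imfsetP; exists (s' i) => //=.
by apply: (fsubsetP hJ); apply/imfsetP; exists i.
Qed.

End UnorderedSums.

(** * Series of inverses of products of affine functions *)

Section SeriesOfProducts.
Variable R : realType.
Local Notation C := (Cplx R).

(** First order expansion of a product of [n] factors [(1 + h b_j)^-1], with a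
    remainder that is uniform for [b_j] in a disc. *)
Lemma prod_inv_expand (K : R) (n : nat) : 0 < K -> exists2 AB : R * R,
  0 <= AB.1 /\ 0 <= AB.2 & forall b : 'I_n -> C, (forall j, nm (b j) <= K) ->
  exists2 e : C, nm e <= AB.1 & forall h, nm h <= 1 -> nm h * K <= 2^-1 ->
    nm (\prod_(j < n) (1 + h * b j)^-1 - 1 - h * e) <= AB.2 * nm h ^+ 2.
Proof.
move=> K0; elim: n => [|n [[A B]/= [A0 B0] IH]].
  exists (0, 0) => // b _; exists 0 => [|h _ _]; first by rewrite nm0.
  by rewrite big_ord0 subrr mulr0 subrr nm0 mul0r.
pose B1 := 2 * K ^+ 2.
have B10 : 0 <= B1 by rewrite mulr_ge0// sqr_ge0.
exists (K + A, K * A + B1 * (1 + A) + B * (1 + K) + B1 * B).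
  by rewrite /= addr_ge0 ?(ltW K0)// !addr_ge0 ?mulr_ge0 ?addr_ge0 ?(ltW K0).
move=> b bK /=; have [|e eA he] := IH (fun j => b (lift ord0 j)); first by [].
exists (e - b ord0).
  by rewrite (le_trans (nmB _ _))// addrC lerD.
move=> h h1 hK; rewrite big_ord_recl.
set u := (1 + _)^-1; set v := \prod_(j < n) _.
have {he} := he h h1 hK; rewrite -/v => hv.
have hb : nm (h * b ord0) <= 2^-1.
  by rewrite nmM (le_trans _ hK)// ler_wpM2l ?nm_ge0.
have den : 2^-1 <= nm (1 + h * b ord0).
  have := nm_revB 1 (- (h * b ord0)); rewrite opprK nmN nm1; lra.
have den0 : 1 + h * b ord0 != 0.
  by rewrite -nm_gt0 (lt_le_trans _ den)// invr_gt0.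
have hu : nm (u - 1 + h * b ord0) <= B1 * nm h ^+ 2.
  have -> : u - 1 + h * b ord0 = (h * b ord0) ^+ 2 * u.
    by rewrite /u; field.
  rewrite nmM nmX nmM exprMn nmV ler_pdivrMr; last by rewrite nm_gt0.
  have -> : B1 * nm h ^+ 2 = 2 * (nm h ^+ 2 * K ^+ 2) by rewrite /B1; ring.
  rewrite (@le_trans _ _ (nm h ^+ 2 * K ^+ 2))//.
    by rewrite ler_wpM2l ?sqr_ge0// lerXn2r ?nnegrE ?nm_ge0// ltW.
  have : 0 <= nm h ^+ 2 * K ^+ 2 by rewrite mulr_ge0 ?sqr_ge0.
  move: (nm h ^+ 2 * K ^+ 2) (nm (1 + h * b ord0)) den => p q; nra.
set ru := u - 1 + h * b ord0 in hu; set rv := v - 1 - h * e in hv.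
have -> : u * v - 1 - h * (e - b ord0) =
  - (h ^+ 2 * b ord0 * e) + (ru * (1 + h * e) + (rv * (1 - h * b ord0) + ru * rv)).
  by rewrite /ru /rv; ring.
move: ru rv hu hv => ru rv hu hv.
have hsq : nm h ^+ 2 <= 1 by rewrite expr_le1 ?nm_ge0.
have h2 := sqr_ge0 (nm h).
rewrite -!addrA mulrDl (le_trans (nmD _ _))// lerD//.
  rewrite nmN 2!nmM nmX [leRHS]mulrC -mulrA ler_wpM2l// ler_pM ?nm_ge0//.
rewrite mulrDl (le_trans (nmD _ _))// lerD//.
  rewrite nmM mulrAC ler_pM ?nm_ge0// (le_trans (nmD _ _))// nm1 lerD2l nmM.
  by rewrite (le_trans _ eA)// ler_piMl ?nm_ge0.
rewrite mulrDl (le_trans (nmD _ _))// lerD//.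
  rewrite nmM mulrAC ler_pM ?nm_ge0// (le_trans (nmB _ _))// nm1 lerD2l nmM.
  by rewrite (le_trans _ (bK ord0))// ler_piMl ?nm_ge0.
by rewrite nmM -mulrA ler_pM ?nm_ge0// (le_trans hu)// ler_piMr.
Qed.

Variables (I : choiceType) (n : nat).

(** The terms vary by a uniformly bounded factor as long as [h] is small
    compared with the bound on [beta / alpha]; so convergence at [h = 0] alone
    makes the sum differentiable there. *)
Lemma derivable_sum_prod_inv (alpha beta : 'I_n -> I -> C) (K : R) :
  (forall j i, alpha j i != 0) ->
  (forall j i, nm (beta j i) <= K * nm (alpha j i)) ->
  abs_summable (fun i => (\prod_(j < n) alpha j i)^-1) ->
  let g h i := (\prod_(j < n) (alpha j i + h * beta j i))^-1 in
  derivable (fun h => summability.sum (g h)) 0 1.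
Proof.
move=> alpha0 betaK sa g.
pose K' := `|K| + 1; have K'0 : 0 < K' by rewrite ltr_wpDl.
have [[A B]/= [A0 B0] hAB] := prod_inv_expand n K'0.
pose f i := (\prod_(j < n) alpha j i)^-1.
pose b i j := beta j i / alpha j i.
have bK i j : nm (b i j) <= K'.
  rewrite /b nmM nmV ler_pdivrMr ?nm_gt0// (le_trans (betaK _ _))//.
  by rewrite ler_wpM2r ?nm_ge0// (le_trans (ler_norm K))// lerDl.
have gE h i : g h i = f i * \prod_(j < n) (1 + h * b i j)^-1.
  rewrite /g /f -!prodfV -big_split /=; apply: eq_bigr => j _.
  by rewrite -invfM mulrDr mulr1 mulrCA /b [beta j i / _]mulrC mulVKf.
have /choice[e he] i : exists e : C, nm e <= A /\ (forall h, nm h <= 1 ->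
    nm h * K' <= 2^-1 ->
    nm (\prod_(j < n) (1 + h * b i j)^-1 - 1 - h * e) <= B * nm h ^+ 2).
  by have [e ? ?] := hAB _ (bK i); exists e.
pose d := Num.min 1 ((2 * K')^-1).
have d0 : 0 < d by rewrite lt_min ltr01 invr_gt0 mulr_gt0.
have hd h : nm h < d -> nm h <= 1 /\ nm h * K' <= 2^-1.
  rewrite lt_min => /andP[/ltW-> /ltW]; rewrite invfM => hh; split => //.
  by rewrite -ler_pdivlMr.
have gsum h : nm h < d -> abs_summable (g h).
  move=> /hd[h1 hK].
  apply: (@abs_summable_le _ _ f (g h) (B + 1 + A)) => //; first by rewrite !addr_ge0.
  move=> i; rewrite gE nmM mulrC ler_wpM2r ?nm_ge0//.
  have [eA /(_ h h1 hK)] := he i; set p := \prod_(j < n) _ => hp.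
  have -> : p = (p - 1 - h * e i) + 1 + h * e i by ring.
  rewrite (le_trans (nmD _ _))// lerD//; last first.
    by rewrite nmM (le_trans _ eA)// ler_piMl ?nm_ge0.
  rewrite (le_trans (nmD _ _))// nm1 lerD2r (le_trans hp)// ler_piMr//.
  by rewrite expr_le1 ?nm_ge0.
have sumfe : abs_summable (fun i => f i * e i).
  apply: (@abs_summable_le _ _ f _ A) => // i.
  by rewrite nmM mulrC ler_wpM2r ?nm_ge0//; apply: (he i).1.
have [Bf hBf] := sa.
refine (@derivable_quad R (fun h => summability.sum (g h)) 0
  (summability.sum (fun i => f i * e i)) (Bf * B) d d0 _) => h hh; rewrite add0r.
have [h1 hK] := hd _ hh.
have s1 := abs_summable_has_sum (gsum _ hh).
have s0 := abs_summable_has_sum (gsum 0 ltac:(by rewrite nm0)).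
have se := abs_summable_has_sum sumfe.
have := has_sumD (has_sumD s1 (has_sumZ (-1) s0)) (has_sumZ (- h) se).
rewrite mulN1r mulNr; apply: has_sum_le => J.
rewrite (le_trans (nm_sum _ _ _))//.
rewrite (@le_trans _ _ (\sum_(i <- J) nm (f i) * (B * nm h ^+ 2)))//; last first.
  by rewrite -mulr_suml -mulrA ler_wpM2r// mulr_ge0// sqr_ge0.
apply: ler_sum => i _; rewrite !gE.
have -> : \prod_(j < n) (1 + 0 * b i j)^-1 = 1.
  by apply: big1 => j _; rewrite mul0r addr0 invr1.
set p := \prod_(j < n) _.
have -> : f i * p + -1 * (f i * 1) + - h * (f i * e i) = f i * (p - 1 - h * e i).
  by ring.
by rewrite nmM ler_wpM2l ?nm_ge0//; apply: (he i).2.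
Qed.

End SeriesOfProducts.

(** * Packing of squares in the plane *)

Section Packing.
Variable R : realType.
Local Notation C := (Cplx R).
Local Notation leb := (@lebesgue_measure R).

(** Additivity and monotonicity of the area. *)
Lemma packing_squares (I : choiceType) (J : {fset I}) (u v h : I -> R)
    (U V r : R) :
  (forall i, i \in J -> 0 < h i) ->
  (forall i, i \in J -> `|u i - U| + h i <= r /\ `|v i - V| + h i <= r) ->
  (forall i j s t, i \in J -> j \in J -> `|s - u i| < h i -> `|t - v i| < h i ->
     `|s - u j| < h j -> `|t - v j| < h j -> i = j) ->
  \sum_(i <- J) h i ^+ 2 <= r ^+ 2.
Proof.
move=> h0 hr disj.
have [->|[i0 i0J]] := fset_0Vmem J; first by rewrite big_seq_fset0 sqr_ge0.
have r0 : 0 < r.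
  by have [+ _] := hr _ i0J; have := h0 _ i0J; have := normr_ge0 (u i0 - U); lra.
pose Q (a b c : R) : set (R * R) := `]a - c, a + c[ `*` `]b - c, b + c[.
have mQ a b c : measurable (Q a b c) by apply: measurableX; exact: measurable_itv.
have itvE (a c : R) : 0 < c -> leb `]a - c, a + c[ = (2 * c)%:E.
  move=> c0; rewrite lebesgue_measure_itv /= lte_fin ifT; last by lra.
  by rewrite -EFinB; congr (_%:E); lra.
have muQ a b c : 0 < c -> (leb \x leb)%E (Q a b c) = (4 * c ^+ 2)%:E.
  move=> c0; have -> : 4 * c ^+ 2 = (2 * c) * (2 * c) by ring.
  rewrite product_measure1E; try exact: measurable_itv.
  by rewrite EFinM; congr mule; exact: itvE.
pose F i := Q (u i) (v i) (h i).
have tF : trivIset [set` J] F.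
  move=> i j /= iJ jJ [[s t] [[/= + +] [/= + +]]]; rewrite !in_itv /= => a b c d.
  by apply: (disj i j s t) => //; rewrite ltr_norml; apply/andP; split;
    move: a b c d => /andP[? ?] /andP[? ?] /andP[? ?] /andP[? ?]; lra.
have FQ : \bigcup_(i in [set` J]) F i `<=` Q U V r.
  move=> [s t] [i /= iJ] [/= + +]; rewrite !in_itv /= => a b.
  have [] := hr _ iJ; rewrite -!lerBrDr !ler_norml => c d.
  by split; rewrite /= in_itv /=; apply/andP; split;
    move: a b c d => /andP[? ?] /andP[? ?] /andP[? ?] /andP[? ?]; lra.
have mF : measurable (\bigcup_(i in [set` J]) F i).
  by apply: fin_bigcup_measurable => [|i _]; [exact: finite_fset|exact: mQ].
have : ((leb \x leb) (\bigcup_(i in [set` J]) F i) <= (leb \x leb) (Q U V r))%E.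
  by apply: le_measure; rewrite ?inE //; exact: mQ.
have -> : (leb \x leb)%E (\bigcup_(i in [set` J]) F i) =
    (\sum_(i \in [set` J]) (leb \x leb) (F i))%E.
  apply: measure_fin_bigcup; [exact: finite_fset|exact: tF|move=> i _; exact: mQ].
rewrite muQ//.
rewrite -fsbig_seq ?fset_uniq// big_seq.
under eq_bigr => i iJ do rewrite muQ ?h0//.
by rewrite -big_seq sumEFin lee_fin -mulr_sumr ler_pM2l.
Qed.

End Packing.

(** * Two by two matrices in homogeneous coordinates *)

Section Matrices.
Variable R : realType.
Local Notation C := (Cplx R).
Implicit Types M N : 'M[C]_2.

(** Action on homogeneous coordinates, where the point at infinity is on the
    same footing as the others. *)
Definition hnum M (z1 z2 : C) : C := M 0 0 * z1 + M 0 1 * z2.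
Definition hden M (z1 z2 : C) : C := M 1 0 * z1 + M 1 1 * z2.

Lemma moeb_numE M z : moeb_num M z = hnum M z 1.
Proof. by rewrite /hnum mulr1. Qed.

Lemma moeb_denE M z : moeb_den M z = hden M z 1.
Proof. by rewrite /hden mulr1. Qed.

Lemma ord2P (i : 'I_2) : i = 0 \/ i = 1.
Proof. by case: i => [[|[|//]] i2]; [left|right]; apply/val_inj. Qed.

Lemma mulmx2E M N i j : (M * N) i j = M i 0 * N 0 j + M i 1 * N 1 j.
Proof.
rewrite !mxE !big_ord_recl big_ord0 addr0; congr (_ * _ + _ * _); congr fun_of_matrix.
all: by apply/val_inj.
Qed.

Lemma det_mx2 M : \det M = M 0 0 * M 1 1 - M 0 1 * M 1 0.
Proof.
rewrite (expand_det_row _ 0) !big_ord_recl big_ord0 /cofactor !det_mx11 !mxE /=.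
have e1 : lift ord0 (ord0 : 'I_1) = 1 :> 'I_2 by apply/val_inj.
have e2 : lift (1 : 'I_2) (ord0 : 'I_1) = 0 :> 'I_2 by apply/val_inj.
by rewrite !e1 !e2 addr0 addn0 expr0 expr1 mul1r mulN1r mulrN.
Qed.

Lemma hnumM M N z1 z2 : hnum (M * N) z1 z2 = hnum M (hnum N z1 z2) (hden N z1 z2).
Proof. by rewrite /hnum /hden !mulmx2E; ring. Qed.

Lemma hdenM M N z1 z2 : hden (M * N) z1 z2 = hden M (hnum N z1 z2) (hden N z1 z2).
Proof. by rewrite /hnum /hden !mulmx2E; ring. Qed.

Lemma hnum1 z1 z2 : hnum 1 z1 z2 = z1.
Proof. by rewrite /hnum !mxE /=; ring. Qed.

Lemma hden1 z1 z2 : hden 1 z1 z2 = z2.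
Proof. by rewrite /hden !mxE /=; ring. Qed.

Lemma hnumZ M t z1 z2 : hnum M (t * z1) (t * z2) = t * hnum M z1 z2.
Proof. by rewrite /hnum; ring. Qed.

Lemma hdenZ M t z1 z2 : hden M (t * z1) (t * z2) = t * hden M z1 z2.
Proof. by rewrite /hden; ring. Qed.

Definition adj2 M : 'M[C]_2 := \matrix_(i < 2, j < 2)
  if i == 0 then (if j == 0 then M 1 1 else - M 0 1)
  else (if j == 0 then - M 1 0 else M 0 0).

Lemma adj2E M : [/\ adj2 M 0 0 = M 1 1, adj2 M 0 1 = - M 0 1,
  adj2 M 1 0 = - M 1 0 & adj2 M 1 1 = M 0 0].
Proof. by rewrite !mxE. Qed.

Lemma mx2P M N : M 0 0 = N 0 0 -> M 0 1 = N 0 1 -> M 1 0 = N 1 0 ->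
  M 1 1 = N 1 1 -> M = N.
Proof.
by move=> ? ? ? ?; apply/matrixP => i j; case: (ord2P i) (ord2P j) => -> [] ->.
Qed.

Lemma mul_adj2 M : M * adj2 M = (\det M)%:M.
Proof.
have [a b c d] := adj2E M.
by apply: mx2P; rewrite mulmx2E ?(a, b, c, d) det_mx2 !mxE /= ?mulr1n ?mulr0n; ring.
Qed.

Lemma unit_mx2 M : \det M != 0 -> M \is a GRing.unit.
Proof. by rewrite -unitfE -[M \is a GRing.unit]/(M \in unitmx) unitmxE. Qed.

Lemma inv_adj2 M : \det M != 0 -> M^-1 = (\det M)^-1 *: adj2 M.
Proof.
move=> d0; apply: (mulrI (unit_mx2 d0)); rewrite mulrV ?unit_mx2// -scalerAr mul_adj2.
by rewrite scale_scalar_mx mulVf.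
Qed.

Lemma unit_det1 M : \det M = 1 -> M \is a GRing.unit.
Proof. by move=> d1; rewrite unit_mx2// d1 oner_eq0. Qed.

Lemma inv_det1 M : \det M = 1 -> [/\ M^-1 0 0 = M 1 1, M^-1 0 1 = - M 0 1,
  M^-1 1 0 = - M 1 0 & M^-1 1 1 = M 0 0].
Proof.
move=> d1; rewrite inv_adj2 ?d1 ?oner_eq0// invr1 scale1r; exact: adj2E.
Qed.

End Matrices.

(** * Ping-pong for Schottky groups *)

Section PingPong.
Variables (R : realType) (g : nat).
Local Notation C := (Cplx R).
Variable p : params R g.
Hypothesis hp : schottky_space p.

Let rho0 a : rho p a != 0. Proof. exact: hp.1. Qed.

Definition inv_letter (l : 'I_g * bool) := (l.1, ~~ l.2).

Lemma inv_letterK : involutive inv_letter.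
Proof. by case=> a b; rewrite /inv_letter /= negbK. Qed.

Definition letter_mx (l : 'I_g * bool) : 'M[C]_2 :=
  if l.2 then gamma_mx p l.1 else (gamma_mx p l.1)^-1.

Lemma word_mx_cons l s : word_mx p (l :: s) = letter_mx l * word_mx p s.
Proof. by rewrite /word_mx big_cons. Qed.

Lemma word_mx_nil : word_mx p [::] = 1.
Proof. by rewrite /word_mx big_nil. Qed.

Lemma det_letter l : \det (letter_mx l) = 1.
Proof.
rewrite /letter_mx; case: ifP => _; rewrite -?[(_)^-1]/(invmx _) ?det_inv.
all: by rewrite det_gamma_mx// invr1.
Qed.

Lemma det_word s : \det (word_mx p s) = 1.
Proof.
elim: s => [|l s IH]; first by rewrite word_mx_nil det1.
by rewrite word_mx_cons det_mulmx IH det_letter mulr1.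
Qed.

Lemma letter_inv l : letter_mx (inv_letter l) = (letter_mx l)^-1.
Proof.
by case: l => a [|]; rewrite /letter_mx //= invrK.
Qed.

Lemma letter_mulV l : letter_mx (inv_letter l) * letter_mx l = 1.
Proof. by rewrite letter_inv mulVr// unit_det1 ?det_letter. Qed.

Definition radius (l : 'I_g * bool) : R := Num.sqrt (nm (rho p l.1)).

Lemma sqrtC_real (x : R) : 0 <= x -> sqrtC (x%:C%C : C) = (Num.sqrt x)%:C%C.
Proof.
move=> x0; rewrite -[in LHS](sqr_sqrtr x0) rmorphXn /= sqrCK//.
by rewrite ler0c sqrtr_ge0.
Qed.

Lemma discs_disjoint l m : l != m ->
  radius l + radius m < nm (w p l - w p m).
Proof.
move=> /(hp.2 l m); rewrite !nmE !sqrtC_real ?nm_ge0// -rmorphD.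
by rewrite ltcR.
Qed.

Lemma radius_gt0 l : 0 < radius l.
Proof. by rewrite sqrtr_gt0 nm_gt0. Qed.

Lemma radius_sqr l : radius l ^+ 2 = nm (rho p l.1).
Proof. by rewrite sqr_sqrtr// nm_ge0. Qed.

Definition in_disc l (z1 z2 : C) := nm (z1 - w p l * z2) <= radius l * nm z2.
Definition off_disc l (z1 z2 : C) := radius l * nm z2 <= nm (z1 - w p l * z2).

Lemma letter_mxE l : exists2 t : C, t != 0 & forall z1 z2,
  hnum (letter_mx l) z1 z2 - w p (inv_letter l) * hden (letter_mx l) z1 z2
    = t * rho p l.1 * z2 /\
  hden (letter_mx l) z1 z2 = t * (z1 - w p l * z2).
Proof.
have s0 a : sqrtC (- rho p a) != 0 by rewrite sqrtC_eq0 oppr_eq0.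
have s2 a : sqrtC (- rho p a) ^+ 2 = - rho p a by rewrite sqrtCK.
case: l => a [|]; rewrite /letter_mx /=.
  exists (sqrtC (- rho p a))^-1; first by rewrite invr_eq0.
  by move=> z1 z2; rewrite /hnum /hden !mxE /inv_letter /=; split; ring.
exists (- (sqrtC (- rho p a))^-1); first by rewrite oppr_eq0 invr_eq0.
move=> z1 z2; have [e1 e2 e3 e4] := inv_det1 (det_gamma_mx (rho0 a)).
by rewrite /hnum /hden e1 e2 e3 e4 !mxE /inv_letter /=; split; ring.
Qed.

Lemma letter_maps l z1 z2 : off_disc l z1 z2 ->
  in_disc (inv_letter l) (hnum (letter_mx l) z1 z2) (hden (letter_mx l) z1 z2).
Proof.
have [t t0 /(_ z1 z2)[e1 e2]] := letter_mxE l; rewrite /off_disc /in_disc => h.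
rewrite e1 e2 !nmM mulrCA -mulrA ler_wpM2l ?nm_ge0//.
have -> : radius (inv_letter l) = radius l by [].
by rewrite -radius_sqr expr2 -mulrA ler_wpM2l// ltW// radius_gt0.
Qed.

Lemma in_off_disc l m z1 z2 : l != m -> in_disc l z1 z2 -> off_disc m z1 z2.
Proof.
rewrite /in_disc /off_disc => /discs_disjoint lm h.
have e : (w p l - w p m) * z2 = (z1 - w p m * z2) - (z1 - w p l * z2) by ring.
have : nm (w p l - w p m) * nm z2 <= nm (z1 - w p m * z2) + nm (z1 - w p l * z2).
  by rewrite -nmM e nmB.
have : (radius l + radius m) * nm z2 <= nm (w p l - w p m) * nm z2.
  by rewrite ler_wpM2r ?nm_ge0// ltW.
by rewrite mulrDl; lra.
Qed.

Fixpoint reduced (s : word g) : bool :=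
  if s is l :: s' then
    (if s' is m :: _ then m != inv_letter l else true) && reduced s'
  else true.

Lemma reduced_ex s : exists2 t, reduced t & word_mx p s = word_mx p t.
Proof.
elim: s => [|l s [t rt st]]; first by exists [::].
case: t rt st => [|m t] rt st.
  by exists [:: l] => //; rewrite !word_mx_cons st.
have [ml|ml] := eqVneq m (inv_letter l).
  exists t; first by case/andP: rt.
  rewrite word_mx_cons st word_mx_cons ml mulrA -[l in letter_mx l]inv_letterK.
  by rewrite letter_mulV mul1r.
by exists (l :: m :: t); [rewrite /= ml; exact: rt|rewrite word_mx_cons st -word_mx_cons].
Qed.

(** Ping-pong: in a reduced word, the disc reached by a suffix is not the one
    whose exterior the next letter contracts, so it lies in that exterior. *)
Lemma reduced_maps l s z1 z2 : reduced (l :: s) ->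
  (forall m, off_disc m z1 z2) ->
  in_disc (inv_letter l) (hnum (word_mx p (l :: s)) z1 z2)
                         (hden (word_mx p (l :: s)) z1 z2).
Proof.
move=> + off; elim: s l => [|m s IH] l.
  by move=> _; rewrite word_mx_cons word_mx_nil mulr1; exact: letter_maps.
move=> /andP[ml /IH]; rewrite (word_mx_cons l) hnumM hdenM => h.
apply: letter_maps; apply: in_off_disc h.
by rewrite -(inj_eq (can_inj inv_letterK)) inv_letterK.
Qed.

(** Take a disc that contains all the Schottky discs.  A nontrivial element is a
    nonempty reduced word, so ping-pong sends the exterior into a Schottky disc. *)
Lemma Gamma_maps : exists2 r : R, 0 < r & forall M, Gamma p M -> M != 1 ->
  forall z1 z2, r * nm z2 <= nm z1 -> nm (hnum M z1 z2) <= r * nm (hden M z1 z2).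
Proof.
pose r := 1 + \sum_(l : 'I_g * bool) (nm (w p l) + radius l).
have rl l : nm (w p l) + radius l <= r.
  rewrite /r (bigD1 l)//= ler_wpDl// lerDl sumr_ge0// => i _.
  by rewrite addr_ge0 ?nm_ge0 ?(ltW (radius_gt0 _)).
exists r.
  rewrite ltr_pwDl// sumr_ge0// => i _.
  by rewrite addr_ge0 ?nm_ge0 ?(ltW (radius_gt0 _)).
move=> _ [s _ <-]; have [[|l t] rt ->] := reduced_ex s; first by rewrite word_mx_nil eqxx.
move=> _ z1 z2 hz.
have := @reduced_maps l t z1 z2 rt; move=> /(_ _)/wrap[].
  move=> m; rewrite /off_disc.
  have := nm_revB z1 (w p m * z2); rewrite nmM.
  have := ler_wpM2r (nm_ge0 z2) (rl m); rewrite mulrDl; lra.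
set u := hnum _ _ _; set v := hden _ _ _; rewrite /in_disc.
set m := inv_letter l => h.
have := nm_revB u (w p m * v); rewrite nmM.
have := ler_wpM2r (nm_ge0 v) (rl m); rewrite mulrDl; lra.
Qed.

Lemma Gamma1 : Gamma p 1.
Proof. by exists [::] => //; rewrite word_mx_nil. Qed.

Lemma GammaM M N : Gamma p M -> Gamma p N -> Gamma p (M * N).
Proof. by move=> [s _ <-] [t _ <-]; exists (s ++ t) => //; rewrite /word_mx big_cat. Qed.

Lemma GammaV M : Gamma p M -> Gamma p M^-1.
Proof.
move=> [s _ <-]; elim: s => [|l s [t _ tE]].
  by rewrite word_mx_nil invr1; exact: Gamma1.
rewrite word_mx_cons invrM ?unit_det1 ?det_letter ?det_word// -letter_inv.
apply: GammaM; first by exists t.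
by exists [:: inv_letter l] => //; rewrite word_mx_cons word_mx_nil mulr1.
Qed.

Lemma Gamma_det M : Gamma p M -> \det M = 1.
Proof. by move=> [s _ <-]; exact: det_word. Qed.

End PingPong.

(** * Groups acting freely near infinity *)

Section FiniteSets.
Variables (R : realType) (T : choiceType).

Lemma finite_bound (F : set T) (f : T -> R) : finite_set F ->
  exists2 K : R, 0 < K & forall x, F x -> f x <= K.
Proof.
move=> /finite_fsetP[X ->]; exists (1 + \sum_(x <- X) `|f x|).
  by rewrite ltr_pwDl// sumr_ge0.
move=> x /= xX; rewrite (big_fsetD1 x)//= ler_wpDl// (le_trans (ler_norm _))//.
by rewrite lerDl sumr_ge0.
Qed.

Lemma infinite_neq (A : set T) y : infinite_set A -> exists2 x, A x & x != y.
Proof.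
move=> iA; apply: contrapT => h; apply: iA; apply: (sub_finite_set _ (finite_set1 y)).
by move=> x Ax; apply: contrapT => /eqP xy; apply: h; exists x.
Qed.

End FiniteSets.

(** All that is used of a Schottky group: it is a group of matrices of
    determinant 1, and the complement of a disc is mapped into that disc by each
    nontrivial element.  Infinity is then an ordinary point with trivial
    stabiliser, and its orbit controls that of any other point. *)
Record free_at_infinity (R : realType) (G : set 'M[Cplx R]_2) (r : R) : Prop := {
  fai_gt0 : 0 < r;
  fai_1 : G 1;
  fai_M : forall M N, G M -> G N -> G (M * N);
  fai_V : forall M, G M -> G M^-1;
  fai_det : forall M, G M -> \det M = 1;
  fai_maps : forall M, G M -> M != 1 -> forall z1 z2,
    r * nm z2 <= nm z1 -> nm (hnum M z1 z2) <= r * nm (hden M z1 z2)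
}.

Section FreeAtInfinity.
Variables (R : realType).
Local Notation C := (Cplx R).
Variables (G : set 'M[C]_2) (r : R).
Hypothesis hG : free_at_infinity G r.

Let r0 : 0 < r := fai_gt0 hG.
Let G1 : G 1 := fai_1 hG.
Let GM : forall M N, G M -> G N -> G (M * N) := fai_M hG.
Let GV : forall M, G M -> G M^-1 := fai_V hG.
Let Gdet : forall M, G M -> \det M = 1 := fai_det hG.
Let Gr : forall M, G M -> M != 1 -> forall z1 z2,
  r * nm z2 <= nm z1 -> nm (hnum M z1 z2) <= r * nm (hden M z1 z2) := fai_maps hG.

Lemma GmulVg M : G M -> M^-1 * M = 1.
Proof. by move=> /Gdet/unit_det1; exact: mulVr. Qed.

Lemma GmulgV M : G M -> M * M^-1 = 1.
Proof. by move=> /Gdet/unit_det1; exact: mulrV. Qed.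

Lemma Gdet2 M : G M -> M 0 0 * M 1 1 - M 0 1 * M 1 0 = 1.
Proof. by move=> /Gdet; rewrite det_mx2. Qed.

Lemma entry00_le M : G M -> M != 1 -> nm (M 0 0) <= r * nm (M 1 0).
Proof.
move=> GM1 M1; have := Gr GM1 M1 (z1 := 1) (z2 := 0).
by rewrite /hnum /hden !mulr0 !addr0 !mulr1 nm0 nm1 mulr0; apply; exact: ler01.
Qed.

Lemma entry10_neq0 M : G M -> M != 1 -> M 1 0 != 0.
Proof.
move=> GM1 M1; apply/eqP => c0; have := entry00_le GM1 M1.
rewrite c0 nm0 mulr0 => a0; have /eqP := Gdet2 GM1.
have /eqP -> : M 0 0 == 0 by rewrite -nm_eq0 eq_le a0 nm_ge0.
by rewrite c0 mul0r mulr0 subrr eq_sym oner_eq0.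
Qed.

Lemma inv_neq1 M : G M -> M != 1 -> M^-1 != 1.
Proof.
by move=> GM1; apply: contra => /eqP h; rewrite -[M]invrK h invr1.
Qed.

Lemma entry11_le M : G M -> M != 1 -> nm (M 1 1) <= r * nm (M 1 0).
Proof.
move=> GM1 M1; have := entry00_le (GV GM1) (inv_neq1 GM1 M1).
by have [-> _ -> _] := inv_det1 (Gdet GM1); rewrite nmN.
Qed.

(** The accumulation points of the orbit of infinity; for a Schottky group they
    are the limit points, by [limit_set_Some]. *)
Definition lim_pt (z : C) : Prop := forall e : R, 0 < e ->
  infinite_set [set M | [/\ G M, M 1 0 != 0 & nm (M 0 0 / M 1 0 - z) < e]].

(** [M N] sends infinity into the disc of radius [r] for every [N] but one, and
    the points [N oo] accumulate at [z]. *)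
Lemma lim_pt_bound z M : lim_pt z -> G M ->
  nm (moeb_num M z) <= r * nm (moeb_den M z).
Proof.
move=> lz GM1; rewrite leNgt; apply/negP => h.
pose k := nm (M 0 0) + r * nm (M 1 0) + 1.
have k0 : 0 < k by rewrite ltr_wpDl// addr_ge0 ?nm_ge0// mulr_ge0 ?nm_ge0// ltW.
pose e := (nm (moeb_num M z) - r * nm (moeb_den M z)) / k.
have e0 : 0 < e by rewrite divr_gt0// subr_gt0.
have [N /= [GN c0 Nz] NM] := infinite_neq M^-1 (lz _ e0).
have MN1 : M * N != 1.
  apply: contra NM => /eqP h1.
  by rewrite -[N]mul1r -(GmulVg GM1) -mulrA h1 mulr1.
have := entry00_le (GM GM1 GN) MN1; rewrite !mulmx2E.
set t := N 0 0 / N 1 0 in Nz.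
have -> : N 0 0 = N 1 0 * t by rewrite /t mulrCA divff// mulr1.
have -> : M 0 0 * (N 1 0 * t) + M 0 1 * N 1 0 =
  N 1 0 * (moeb_num M z + M 0 0 * (t - z)) by rewrite /moeb_num; ring.
have -> : M 1 0 * (N 1 0 * t) + M 1 1 * N 1 0 =
  N 1 0 * (moeb_den M z + M 1 0 * (t - z)) by rewrite /moeb_den; ring.
rewrite !nmM mulrCA ler_pM2l ?nm_gt0// => hh.
have h1 := nm_revB (moeb_num M z) (- (M 0 0 * (t - z))).
rewrite opprK nmN nmM in h1.
have h2 := nmD (moeb_den M z) (M 1 0 * (t - z)); rewrite nmM in h2.
have h3 : r * nm (moeb_den M z + M 1 0 * (t - z)) <=
    r * nm (moeb_den M z) + r * nm (M 1 0) * nm (t - z).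
  by rewrite -mulrA -mulrDr ler_wpM2l// ltW.
have h4 : (nm (M 0 0) + r * nm (M 1 0)) * nm (t - z) <= k * nm (t - z).
  by rewrite ler_wpM2r ?nm_ge0// lerDl.
have h5 : k * nm (t - z) < nm (moeb_num M z) - r * nm (moeb_den M z).
  by rewrite mulrC -ltr_pdivlMr.
rewrite mulrDl in h4; lra.
Qed.

Lemma lim_pt_norm z : lim_pt z -> nm z <= r.
Proof.
move=> /(lim_pt_bound)/(_ G1); rewrite moeb_numE moeb_denE hnum1 hden1.
by rewrite nm1 mulr1.
Qed.

Lemma lim_pt_den z M : lim_pt z -> G M -> moeb_den M z != 0.
Proof.
move=> lz GM1; apply/eqP => d0; have := lim_pt_bound lz GM1.
rewrite d0 nm0 mulr0 => n0.
have /eqP n00 : moeb_num M z == 0 by rewrite -nm_eq0 eq_le n0 nm_ge0.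
have : M 0 0 * moeb_den M z - M 1 0 * moeb_num M z = 1.
  by rewrite -(Gdet2 GM1) /moeb_den /moeb_num; ring.
by rewrite d0 n00 !mulr0 subrr => /eqP; rewrite eq_sym oner_eq0.
Qed.

Lemma lim_pt_closed z :
  (forall e : R, 0 < e -> exists2 k, lim_pt k & nm (k - z) < e) -> lim_pt z.
Proof.
move=> h e e0; have [k lk kz] := h _ e0.
have := lk (e - nm (k - z)); rewrite subr_gt0 => /(_ kz).
apply: sub_infinite_set => M /= [GM1 c0 Mk]; split=> //.
rewrite (le_lt_trans (nm_triB _ k _))//; lra.
Qed.

Lemma moebB M z t : G M -> moeb_den M z != 0 -> moeb_den M t != 0 ->
  moeb M t - moeb M z = (t - z) / (moeb_den M t * moeb_den M z).
Proof.
move=> GM1 dz dt; rewrite /moeb -mulNr addf_div//; congr (_ / _).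
rewrite -[t - z]mul1r -(Gdet2 GM1) /moeb_num /moeb_den; ring.
Qed.

Lemma infinite_mul M (A B : set 'M[C]_2) : G M ->
  (forall N, A N -> B (M * N)) -> infinite_set A -> infinite_set B.
Proof.
move=> GM1 AB iA fB; apply: iA; apply: (@sub_finite_set _ _ ((fun N => M * N) @^-1` B)).
  by move=> N /AB.
apply: finite_preimage fB => N N' _ _.
by apply: mulrI; apply: unit_det1; exact: Gdet.
Qed.

Lemma lim_pt_moeb z M : lim_pt z -> G M -> lim_pt (moeb M z).
Proof.
move=> lz GM1 e e0; have dz := lim_pt_den lz GM1.
set D := nm (moeb_den M z).
have D0 : 0 < D by rewrite nm_gt0.
pose e' := Num.min (D / (2 * (nm (M 1 0) + 1))) (e * D ^+ 2 / 2).
have c0 : 0 < nm (M 1 0) + 1 by rewrite ltr_wpDl ?nm_ge0.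
have e'0 : 0 < e' by rewrite lt_min !divr_gt0 ?mulr_gt0// exprn_gt0.
apply: (infinite_mul (M := M) GM1 _ (lz _ e'0)) => N /= [GN cN].
set t := N 0 0 / N 1 0; rewrite lt_min => /andP[t1 t2].
have Nt : N 0 0 = N 1 0 * t by rewrite /t mulrCA divff// mulr1.
have den_t : D / 2 <= nm (moeb_den M t).
  have := nm_revB (moeb_den M z) (moeb_den M z - moeb_den M t).
  rewrite opprB addrCA subrr addr0 -/D.
  have -> : moeb_den M z - moeb_den M t = M 1 0 * (z - t).
    by rewrite /moeb_den; ring.
  rewrite nmM nm_distC.
  have : nm (M 1 0) * nm (t - z) <= (nm (M 1 0) + 1) * nm (t - z).
    by rewrite ler_wpM2r ?nm_ge0// lerDl.
  move: t1; rewrite invfM mulrA ltr_pdivlMr// [_ * (_ + 1)]mulrC.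
  by move: (nm (moeb_den M t)) => q; lra.
have dt : moeb_den M t != 0 by rewrite -nm_gt0 (lt_le_trans _ den_t)// divr_gt0.
have E0 : (M * N) 0 0 = N 1 0 * moeb_num M t.
  by rewrite mulmx2E Nt /moeb_num; ring.
have E1 : (M * N) 1 0 = N 1 0 * moeb_den M t.
  by rewrite mulmx2E Nt /moeb_den; ring.
split; first exact: GM GM1 GN.
  by rewrite E1 mulf_neq0.
rewrite E0 E1 -mulf_div divff// mul1r -/(moeb M t) moebB//.
rewrite nmM nmV nmM -/D ltr_pdivrMr; last by rewrite mulr_gt0// nm_gt0.
rewrite (lt_le_trans t2)// expr2 -!mulrA ler_wpM2l ?(ltW e0)//.
by rewrite [leRHS]mulrC ler_wpM2l ?(ltW D0).
Qed.

(** Since [|M z - M oo| = |c|^-2 / |z - M^-1 oo|] and [|M^-1 oo| <= r], the image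
    by [M] of the exterior of the disc of radius [r] contains this disc around
    [M oo]. *)
Lemma disc_exterior M z : G M -> M != 1 ->
  nm (z - M 0 0 / M 1 0) < (2 * r * nm (M 1 0) ^+ 2)^-1 ->
  r * nm (hden M^-1 z 1) < nm (hnum M^-1 z 1).
Proof.
move=> GM1 M1; have c0 := entry10_neq0 GM1 M1.
have [e1 e2 e3 e4] := inv_det1 (Gdet GM1).
set u := hnum _ _ _; set v := hden _ _ _ => h.
have uv : M 1 0 * u + M 1 1 * v = 1.
  by rewrite -(Gdet2 GM1) /u /v /hnum /hden e1 e2 e3 e4; ring.
have vE : nm v = nm (M 1 0) * nm (z - M 0 0 / M 1 0).
  rewrite -nmM -nmN; congr nm; rewrite /v /hden e3 e4; field.
  by rewrite c0.
have cp : 0 < nm (M 1 0) by rewrite nm_gt0.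
have hv : 2 * (r * nm v * nm (M 1 0)) < 1.
  move: h; rewrite -[ltRHS]mul1r ltr_pdivlMr ?mulr_gt0 ?exprn_gt0//.
  by rewrite vE; move: (nm (z - _)) (nm (M 1 0)) => a b; congr (_ < _); ring.
have hd : nm (M 1 1 * v) <= r * nm v * nm (M 1 0).
  by rewrite nmM mulrAC ler_wpM2r ?nm_ge0// entry11_le.
have := nm_revB 1 (M 1 1 * v); rewrite -{2}uv addrK nm1 => hu.
rewrite -(ltr_pM2r cp) [ltRHS]mulrC -nmM; lra.
Qed.

Lemma hom_invK M z1 z2 : G M ->
  hnum M (hnum M^-1 z1 z2) (hden M^-1 z1 z2) = z1 /\
  hden M (hnum M^-1 z1 z2) (hden M^-1 z1 z2) = z2.
Proof. by move=> GM1; rewrite -hnumM -hdenM GmulgV// hnum1 hden1. Qed.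

Lemma discs_disj M N z : G M -> G N -> M != 1 -> N != 1 ->
  nm (z - M 0 0 / M 1 0) < (2 * r * nm (M 1 0) ^+ 2)^-1 ->
  nm (z - N 0 0 / N 1 0) < (2 * r * nm (N 1 0) ^+ 2)^-1 -> M = N.
Proof.
move=> GM1 GN1 M1 N1 /(disc_exterior GM1 M1) hM /(disc_exterior GN1 N1) hN.
apply/eqP; apply: contraTT isT => MN; exfalso.
have NM1 : N^-1 * M != 1.
  apply: contra MN => /eqP h; apply/eqP.
  by rewrite -[M]mul1r -(GmulgV GN1) -mulrA h mulr1.
have := Gr (GM (GV GN1) GM1) NM1 (ltW hM).
rewrite hnumM hdenM; have [-> ->] := hom_invK z 1 GM1.
by rewrite leNgt hN.
Qed.

Lemma disc_bound M z : G M -> M != 1 ->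
  nm (z - M 0 0 / M 1 0) < (2 * r * nm (M 1 0) ^+ 2)^-1 -> nm z <= r.
Proof.
move=> GM1 M1 /(disc_exterior GM1 M1) hM.
have := Gr GM1 M1 (ltW hM); have [-> ->] := hom_invK z 1 GM1.
by rewrite nm1 mulr1.
Qed.

(** The discs of [disc_exterior] are disjoint for distinct [M]; the squares
    inscribed in them fit in a square of half-side [k] around [z]. *)
Lemma sum_packing (J : {fset 'M[C]_2}) (z : C) (k : R) :
  (forall M, M \in J -> [/\ G M, M != 1 &
     nm (M 0 0 / M 1 0 - z) + (4 * r * nm (M 1 0) ^+ 2)^-1 <= k]) ->
  \sum_(M <- J) nm (M 1 0) ^- 4 <= 16 * r ^+ 2 * k ^+ 2.
Proof.
move=> hJ.
pose h (M : 'M[C]_2) := (4 * r * nm (M 1 0) ^+ 2)^-1.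
have h0 M : M \in J -> 0 < h M.
  move=> /hJ[GM1 M1 _]; have c0 : 0 < nm (M 1 0) by rewrite nm_gt0 entry10_neq0.
  by rewrite invr_gt0 !mulr_gt0.
have hE M : M \in J -> (2 * r * nm (M 1 0) ^+ 2)^-1 = h M + h M.
  move=> /hJ[GM1 M1 _]; rewrite /h; field.
  by rewrite nm_eq0 entry10_neq0// gt_eqF.
pose u (M : 'M[C]_2) := complex.Re (M 0 0 / M 1 0).
pose v (M : 'M[C]_2) := complex.Im (M 0 0 / M 1 0).
have key : \sum_(M <- J) h M ^+ 2 <= k ^+ 2.
  apply: (@packing_squares R _ J u v h (complex.Re z) (complex.Im z) k) => //.
    move=> M /hJ[_ _ hM].
    by rewrite /u /v -ReB -ImB; split; apply: le_trans hM; rewrite lerD2r ?Re_nm ?Im_nm.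
  move=> M N s t MJ NJ s1 t1 s2 t2.
  have [[GM1 M1 _] [GN1 N1 _]] := (hJ _ MJ, hJ _ NJ).
  have aux L : L \in J -> `|s - u L| < h L -> `|t - v L| < h L ->
      nm (Complex s t - L 0 0 / L 1 0) < (2 * r * nm (L 1 0) ^+ 2)^-1.
    move=> LJ sL tL; rewrite hE// (le_lt_trans (nm_ReIm _))//.
    by move: sL tL; rewrite /u /v; case: (L 0 0 / L 1 0) => a b /=; lra.
  exact: (discs_disj GM1 GN1 M1 N1 (aux _ MJ s1 t1) (aux _ NJ s2 t2)).
have r20 : 0 < 16 * r ^+ 2 by rewrite mulr_gt0// exprn_gt0.
rewrite -ler_pdivrMl// mulr_sumr (le_trans _ key)// !big_seq ler_sum// => M MJ.
rewrite le_eqVlt; apply/orP; left; apply/eqP; rewrite /h.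
have [GM1 M1 _] := hJ _ MJ; field.
by rewrite nm_eq0 entry10_neq0// gt_eqF.
Qed.

Lemma sum_entry10 (J : {fset 'M[C]_2}) :
  (forall M, M \in J -> G M /\ M != 1) ->
  \sum_(M <- J) nm (M 1 0) ^- 4 <= 16 * r ^+ 2 * (2 * r) ^+ 2.
Proof.
move=> hJ; apply: (@sum_packing J 0) => M /hJ[GM1 M1]; split=> //.
have c0 : 0 < nm (M 1 0) by rewrite nm_gt0 entry10_neq0.
rewrite subr0; set h := (4 * r * _)^-1; set m := M 0 0 / M 1 0.
have h0 : 0 < h by rewrite invr_gt0 !mulr_gt0// exprn_gt0.
have hE : (2 * r * nm (M 1 0) ^+ 2)^-1 = h + h.
  by rewrite /h; field; rewrite !gt_eqF.
(* both m + h and m - h lie in the disc around m, so h <= r *)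
have b1 : nm (m + h%:C%C) <= r.
  apply: (disc_bound GM1 M1).
  by rewrite -/m addrAC subrr add0r nm_real gtr0_norm// hE; lra.
have b2 : nm (m - h%:C%C) <= r.
  apply: (disc_bound GM1 M1).
  by rewrite -/m addrAC subrr add0r nmN nm_real gtr0_norm// hE; lra.
have b3 : nm m <= r.
  by apply: (disc_bound GM1 M1); rewrite subrr nm0 hE; lra.
have := nmB (m + h%:C%C) (m - h%:C%C).
have -> : m + h%:C%C - (m - h%:C%C) = (h + h)%:C%C :> C.
  by rewrite rmorphD /=; ring.
by rewrite nm_real ger0_norm; lra.
Qed.

(** By [sum_entry10], only finitely many of the terms [|c|^-4] exceed a given
    positive number. *)
Lemma finite_entry10 (T : R) :
  finite_set [set M | [/\ G M, M != 1 & nm (M 1 0) <= T]].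
Proof.
apply: contrapT => inf.
have [M0 /= [GM0 M01 cT] _] := infinite_neq 1 inf.
have T0 : 0 < T by rewrite (lt_le_trans _ cT)// nm_gt0 entry10_neq0.
set B := 16 * r ^+ 2 * (2 * r) ^+ 2.
have [J hJ nJ] := infinite_set_fset (Num.bound (B * T ^+ 4)) inf.
have := @sum_entry10 J (fun M MJ => let: And3 a b _ := hJ M MJ in conj a b).
rewrite leNgt => /negP; apply.
apply: (@lt_le_trans _ _ (\sum_(M <- J) T ^- 4)).
  rewrite big_const_seq count_predT iter_addr_0 -[ltRHS]mulr_natl ltr_pdivlMr ?exprn_gt0//.
  rewrite (@lt_le_trans _ _ (Num.bound (B * T ^+ 4))%:R)// ?ler_nat//.
  have B0 : 0 <= B by rewrite /B !mulr_ge0 ?(ltW r0).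
  by rewrite archi_boundP// mulr_ge0// exprn_ge0// ltW.
rewrite !big_seq ler_sum// => M /hJ /= [GM1 M1 hc].
rewrite lef_pV2 ?posrE ?exprn_gt0//; last by rewrite nm_gt0 entry10_neq0.
by rewrite lerXn2r ?nnegrE ?nm_ge0// ltW.
Qed.

End FreeAtInfinity.

(** * Distance of ordinary points to limit points and orbits *)

Section Separation.
Variables (R : realType).
Local Notation C := (Cplx R).
Variables (G : set 'M[C]_2) (r : R).
Hypothesis hG : free_at_infinity G r.
Local Notation lim_pt := (lim_pt G).

Lemma entry10_neq1 (M : 'M[C]_2) : M 1 0 != 0 -> M != 1.
Proof. by apply: contra => /eqP ->; rewrite !mxE. Qed.

(** The pole [M^-1 oo] of [M] also belongs to the orbit of infinity. *)
Lemma far_from_pole t : ~ lim_pt t -> exists2 e : R, 0 < e &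
  finite_set [set M | G M /\ nm (moeb_den M t) < e * nm (M 1 0)].
Proof.
move=> lt; have [e e0 fe] : exists2 e : R, 0 < e & finite_set
    [set M | [/\ G M, M 1 0 != 0 & nm (M 0 0 / M 1 0 - t) < e]].
  by apply: contrapT => h; apply: lt => e e0 fe; apply: h; exists e.
exists e => //; apply: sub_finite_set (finite_preimage (f := @GRing.inv _) _ fe).
  move=> M /= [GM h]; have [e1 _ e3 _] := inv_det1 (fai_det hG GM).
  have c0 : M 1 0 != 0.
    apply/eqP => c0; move: h; rewrite c0 nm0 mulr0.
    by rewrite ltNge nm_ge0.
  split; [exact: fai_V hG _ GM|by rewrite e3 oppr_eq0|rewrite e1 e3].
  have -> : M 1 1 / - M 1 0 - t = - (moeb_den M t / M 1 0).
    by rewrite /moeb_den; field.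
  by rewrite nmN nmM nmV ltr_pdivrMr// nm_gt0.
by move=> M N _ _; exact: invr_inj.
Qed.

Lemma moeb_infty M t : G M -> M 1 0 != 0 -> moeb_den M t != 0 ->
  moeb M t - M 0 0 / M 1 0 = - (M 1 0 * moeb_den M t)^-1.
Proof.
move=> GM c0 d0; rewrite /moeb -mulNr addf_div// -[RHS]mulN1r -(Gdet2 hG GM).
by rewrite [M 1 0 * _]mulrC; congr (_ / _); rewrite /moeb_num /moeb_den; ring.
Qed.

(** The orbit of an ordinary point follows that of infinity, as [M t - M oo] is
    [- 1 / (c (c t + d))], where [|c|] tends to infinity and [c t + d] is at
    least of the order of [c]. *)
Lemma orbit_near_infty t (e : R) : ~ lim_pt t -> 0 < e ->
  finite_set [set M | G M /\ ~ [/\ M 1 0 != 0, moeb_den M t != 0 &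
                                nm (moeb M t - M 0 0 / M 1 0) < e]].
Proof.
move=> lt e0; have [d d0 fd] := far_from_pole lt.
pose T := 1 + (d * e)^-1.
have T1 : 1 <= T by rewrite lerDl invr_ge0 mulr_ge0 ?ltW.
have fin : finite_set ([set M | G M /\ nm (moeb_den M t) < d * nm (M 1 0)] `|`
    ([set M | [/\ G M, M != 1 & nm (M 1 0) <= T]] `|` [set 1])).
  by rewrite !finite_setU; split=> //; split; [exact: (finite_entry10 hG)|exact: finite_set1].
apply: sub_finite_set fin => M /= [GM h].
have [M1|M1] := eqVneq M 1; first by right; right.
have c0 := entry10_neq0 hG GM M1; have cp : 0 < nm (M 1 0) by rewrite nm_gt0.
have [hd|hd] := ltP (nm (moeb_den M t)) (d * nm (M 1 0)); first by left.
have [hT|hT] := leP (nm (M 1 0)) T; first by right; left.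
exfalso; apply: h.
have dp : 0 < nm (moeb_den M t) by rewrite (lt_le_trans _ hd)// mulr_gt0.
have d0' : moeb_den M t != 0 by rewrite -nm_gt0.
split=> //; rewrite moeb_infty// nmN nmV nmM invf_plt ?posrE ?mulr_gt0//.
have c1 : 1 <= nm (M 1 0) by rewrite (le_trans T1)// ltW.
have dc : e^-1 < d * nm (M 1 0).
  have : (d * e)^-1 < nm (M 1 0) by move: hT; rewrite /T; lra.
  by rewrite invfM ltr_pdivrMl.
by rewrite (lt_le_trans dc)// (le_trans hd)// ler_peMl// ltW.
Qed.

Lemma lim_pt_sep x : ~ lim_pt x ->
  exists2 d : R, 0 < d & forall k, lim_pt k -> d <= nm (x - k).
Proof.
move=> lx; apply: contrapT => h; apply: lx; apply: (lim_pt_closed (G := G)) => e e0.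
apply: contrapT => h'; apply: h; exists e => // k lk; rewrite leNgt; apply/negP => xk.
by apply: h'; exists k => //; rewrite nm_distC.
Qed.

(** The general term of the Bers series is the inverse of a product of linear
    forms [num_M x - t den_M x] in [x], with leading coefficient [a - t c] and
    root [M^-1 t].  The lemmas below bound the ratio of the two coefficients of
    such a form uniformly in [M], in a coordinate vanishing at [x] or, at
    infinity, in [1 / x]; equivalently, the roots keep away from the point. *)
Lemma pullbackE M t x : G M -> M 0 0 - t * M 1 0 != 0 ->
  moeb_num M x - t * moeb_den M x = (M 0 0 - t * M 1 0) * (x - moeb M^-1 t) /\
  moeb_den M^-1 t = M 0 0 - t * M 1 0.
Proof.
move=> GM b0; have [e1 e2 e3 e4] := inv_det1 (fai_det hG GM).
have dE : moeb_den M^-1 t = M 0 0 - t * M 1 0 by rewrite /moeb_den e3 e4; ring.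
split=> //; rewrite mulrBr /moeb dE [(_ - _) * (_ / _)]mulrC divfK//.
by rewrite /moeb_num /moeb_den e1 e2; ring.
Qed.

Section LimitPoint.
Variable A : C.
Hypothesis lA : lim_pt A.

Lemma lin_lim_neq0 M : G M -> M 0 0 - A * M 1 0 != 0.
Proof.
move=> GM; have [e1 e2 e3 e4] := inv_det1 (fai_det hG GM).
have := lim_pt_den hG lA (fai_V hG GM); rewrite /moeb_den e3 e4.
by congr (_ != 0); ring.
Qed.

Lemma lin_lim_infty M : G M -> nm (M 0 1 - A * M 1 1) <= r * nm (M 0 0 - A * M 1 0).
Proof.
move=> GM; have [e1 e2 e3 e4] := inv_det1 (fai_det hG GM).
have := lim_pt_bound hG lA (fai_V hG GM).
rewrite /moeb_num /moeb_den e1 e2 e3 e4 -nmN.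
by congr (nm _ <= _ * nm _); ring.
Qed.

Lemma lin_lim_finite x : ~ lim_pt x -> exists2 K : R, 0 < K & forall M, G M ->
  moeb_num M x - A * moeb_den M x != 0 /\
  nm (M 0 0 - A * M 1 0) <= K * nm (moeb_num M x - A * moeb_den M x).
Proof.
move=> /lim_pt_sep[d d0 hd]; exists d^-1 => [|M GM]; first by rewrite invr_gt0.
have b0 := lin_lim_neq0 GM; have [-> _] := pullbackE x GM b0.
have dx := hd _ (lim_pt_moeb hG lA (fai_V hG GM)).
split; first by rewrite mulf_neq0// -nm_gt0 (lt_le_trans d0).
by rewrite nmM mulrCA ler_peMr ?nm_ge0// ler_pdivlMl// mulr1.
Qed.

End LimitPoint.

Section OrdinaryPoint.
Variable y : C.
Hypothesis ly : ~ lim_pt y.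

Lemma pullback_near_infty (e : R) : 0 < e ->
  finite_set [set M | G M /\ ~ [/\ M 1 0 != 0, M 0 0 - y * M 1 0 != 0 &
    nm (moeb M^-1 y - M^-1 0 0 / M^-1 1 0) < e]].
Proof.
move=> e0; have := orbit_near_infty ly e0.
move=> /(@finite_preimage _ _ _ (@GRing.inv _) (fun M N _ _ => @invr_inj _ M N)).
apply: sub_finite_set => M /= [GM h]; split; first exact: fai_V hG _ GM.
have [e1 e2 e3 e4] := inv_det1 (fai_det hG GM).
apply: contra_not h => -[c0 d0 h]; split => //.
  by move: c0; rewrite e3 oppr_eq0.
by move: d0; rewrite /moeb_den e3 e4; congr (_ != 0); ring.
Qed.

Lemma lin_ord_infty : (forall M, G M -> M 0 0 - y * M 1 0 != 0) ->
  exists2 K : R, 0 < K & forall M, G M ->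
    nm (M 0 1 - y * M 1 1) <= K * nm (M 0 0 - y * M 1 0).
Proof.
move=> y0; have [K K0 hK] := finite_bound
  (fun M : 'M[C]_2 => nm (M 0 1 - y * M 1 1) / nm (M 0 0 - y * M 1 0))
  (pullback_near_infty ltr01).
exists (K + (r + 1)) => [|M GM]; first by rewrite !addr_gt0// (fai_gt0 hG).
have bp : 0 < nm (M 0 0 - y * M 1 0) by rewrite nm_gt0 y0.
rewrite -ler_pdivrMr//.
have [h|h] := pselect [/\ M 1 0 != 0, M 0 0 - y * M 1 0 != 0 &
    nm (moeb M^-1 y - M^-1 0 0 / M^-1 1 0) < 1]; last first.
  rewrite (le_trans (hK M _))// lerDl addr_ge0// ltW// (fai_gt0 hG) //.
case: h => c0 b0 h; rewrite ler_wpDl// ?(ltW K0)//.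
have [e1 e2 e3 e4] := inv_det1 (fai_det hG GM).
have [_ dE] := pullbackE 0 GM b0.
have -> : nm (M 0 1 - y * M 1 1) / nm (M 0 0 - y * M 1 0) = nm (moeb M^-1 y).
  rewrite /moeb dE nmM nmV -(nmN (moeb_num _ _)); congr (nm _ / _).
  by rewrite /moeb_num e1 e2; ring.
have b1 : nm (M^-1 0 0 / M^-1 1 0) <= r.
  rewrite nmM nmV ler_pdivrMr ?nm_gt0 ?e3 ?oppr_eq0// -e3.
  by apply: (entry00_le hG); [exact: fai_V hG _ GM|exact: inv_neq1 GM (entry10_neq1 c0)].
have := nmD (moeb M^-1 y - M^-1 0 0 / M^-1 1 0) (M^-1 0 0 / M^-1 1 0).
by rewrite subrK; lra.
Qed.

Lemma lin_ord_finite x : ~ lim_pt x ->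
  (forall M, G M -> moeb_num M x - y * moeb_den M x != 0) ->
  exists2 K : R, 0 < K & forall M, G M ->
    nm (M 0 0 - y * M 1 0) <= K * nm (moeb_num M x - y * moeb_den M x).
Proof.
move=> lx xy; have [d d0 fd] := far_from_pole lx.
have d20 : 0 < d / 2 by rewrite divr_gt0.
have fin := pullback_near_infty d20.
have [K K0 hK] : exists2 K : R, 0 < K & forall M,
    ([set M | G M /\ nm (moeb_den M x) < d * nm (M 1 0)] `|`
     [set M | G M /\ ~ [/\ M 1 0 != 0, M 0 0 - y * M 1 0 != 0 &
      nm (moeb M^-1 y - M^-1 0 0 / M^-1 1 0) < d / 2]]) M ->
    nm (M 0 0 - y * M 1 0) / nm (moeb_num M x - y * moeb_den M x) <= K.
  by apply: finite_bound; rewrite finite_setU.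
exists (K + 2 / d) => [|M GM]; first by rewrite addr_gt0// divr_gt0.
have ap : 0 < nm (moeb_num M x - y * moeb_den M x) by rewrite nm_gt0 xy.
rewrite -ler_pdivrMr//.
have [h1|h1] := pselect (nm (moeb_den M x) < d * nm (M 1 0)).
  by rewrite (le_trans (hK M _))//; [left|rewrite lerDl ltW// divr_gt0].
have [h|h] := pselect [/\ M 1 0 != 0, M 0 0 - y * M 1 0 != 0 &
    nm (moeb M^-1 y - M^-1 0 0 / M^-1 1 0) < d / 2]; last first.
  by rewrite (le_trans (hK M _))//; [right|rewrite lerDl ltW// divr_gt0].
move/negP: h1; rewrite -leNgt => h1; case: h => c0 b0 h.
rewrite ler_wpDl ?(ltW K0)//.
have [aE _] := pullbackE x GM b0.
have [e1 e2 e3 e4] := inv_det1 (fai_det hG GM).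
have far : d <= nm (x - M^-1 0 0 / M^-1 1 0).
  have -> : x - M^-1 0 0 / M^-1 1 0 = moeb_den M x / M 1 0.
    by rewrite e1 e3 /moeb_den; field.
  by rewrite nmM nmV ler_pdivlMr// nm_gt0.
have := nm_triB x (moeb M^-1 y) (M^-1 0 0 / M^-1 1 0) => tri.
have half : d / 2 <= nm (x - moeb M^-1 y) by lra.
have xp : 0 < nm (x - moeb M^-1 y) by rewrite (lt_le_trans d20).
rewrite aE nmM invfM mulrA divff ?mul1r; last by rewrite gt_eqF// nm_gt0.
by rewrite -[2 / d]invf_div lef_pV2 ?posrE.
Qed.

End OrdinaryPoint.

(** As [lin_ord_finite], for the linear forms in [y]: exchanging [x] and [y]
    amounts to replacing [M] by its inverse. *)
Lemma lin_ord_finite_y x y : ~ lim_pt x -> ~ lim_pt y ->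
  (forall M, G M -> moeb_num M x - y * moeb_den M x != 0) ->
  exists2 K : R, 0 < K & forall M, G M ->
    nm (moeb_den M x) <= K * nm (moeb_num M x - y * moeb_den M x).
Proof.
move=> lx ly xy.
have e M : G M -> moeb_num M^-1 y - x * moeb_den M^-1 y =
    - (moeb_num M x - y * moeb_den M x) /\ M^-1 0 0 - x * M^-1 1 0 = moeb_den M x.
  move=> GM; have [e1 e2 e3 e4] := inv_det1 (fai_det hG GM).
  by rewrite /moeb_num /moeb_den e1 e2 e3 e4; split; ring.
have [|K K0 hK] := lin_ord_finite lx ly.
  move=> M GM; rewrite -[M]invrK (e _ (fai_V hG GM)).1 oppr_eq0.
  exact: xy (fai_V hG GM).
exists K => // M GM; have := hK _ (fai_V hG GM).
by have [-> ->] := e _ GM; rewrite nmN.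
Qed.

End Separation.

(** * Absolute convergence of the Bers series *)

Section PoincareSeries.
Variables (R : realType).
Local Notation C := (Cplx R).
Variables (G : set 'M[C]_2) (r : R).
Hypothesis hG : free_at_infinity G r.
Local Notation lim_pt := (lim_pt G).

Let r0 : 0 < r := fai_gt0 hG.

(** Both [M^-1 A] and [M^-1 oo] lie in the disc of radius [r]. *)
Lemma lim_pt_dist A M : lim_pt A -> G M -> M 1 0 != 0 ->
  (2 * r * nm (M 1 0) ^+ 2)^-1 <= nm (M 0 0 / M 1 0 - A).
Proof.
move=> lA GM c0; have cp : 0 < nm (M 1 0) by rewrite nm_gt0.
have e : M 0 0 / M 1 0 - A = (M 0 0 - A * M 1 0) / M 1 0 by field.
have h1 := lin_lim_infty hG lA GM.
have h2 := entry11_le hG GM (entry10_neq1 c0).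
have : 1 <= nm (M 1 0) * nm (M 0 1 - A * M 1 1) + nm (M 1 1) * nm (M 0 0 - A * M 1 0).
  rewrite -nm1 -(Gdet2 hG GM) -!nmM.
  have -> : M 0 0 * M 1 1 - M 0 1 * M 1 0 =
    M 1 1 * (M 0 0 - A * M 1 0) - M 1 0 * (M 0 1 - A * M 1 1) by ring.
  by rewrite [leRHS]addrC nmB.
have := ler_wpM2l (ltW cp) h1.
have := ler_wpM2r (nm_ge0 (M 0 0 - A * M 1 0)) h2.
rewrite e nmM nmV => h3 h4 h5.
have k0 : 0 < 2 * r * nm (M 1 0) ^+ 2 by rewrite !mulr_gt0.
rewrite -[leLHS]mul1r ler_pdivrMr//.
have -> : nm (M 0 0 - A * M 1 0) / nm (M 1 0) * (2 * r * nm (M 1 0) ^+ 2) =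
   2 * (r * nm (M 1 0) * nm (M 0 0 - A * M 1 0)).
  by field; rewrite gt_eqF.
by rewrite mulrCA mulrA in h4; lra.
Qed.

(** In each dyadic shell around [A] the packing bound on [\sum |c|^-4] is
    quadratic in the radius, so that division by the distance to [A] leaves a
    geometric series. *)
Lemma sum_shells A (n : nat) (k : R) (J : {fset 'M[C]_2}) : lim_pt A -> 0 < k ->
  (forall M, M \in J -> [/\ G M, M 1 0 != 0, k / 2 ^+ n < nm (M 0 0 / M 1 0 - A) &
     nm (M 0 0 / M 1 0 - A) <= k]) ->
  \sum_(M <- J) nm (M 1 0) ^- 4 / nm (M 0 0 / M 1 0 - A) <= 16 * (16 * r ^+ 2) * k.
Proof.
have q0 : 0 <= 16 * r ^+ 2 by rewrite mulr_ge0// sqr_ge0.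
have packing := @sum_packing _ _ _ hG.
move: (16 * r ^+ 2) q0 packing => q q0 packing.
move=> lA; elim: n k J => [|n IH] k J k0 hJ.
  have -> : J = fset0.
    apply/fsetP => M; rewrite in_fset0; apply/negP => /hJ[_ _].
    by rewrite expr0 divr1 => /lt_le_trans h /h; rewrite ltxx.
  by rewrite big_seq_fset0 mulr_ge0 ?(ltW k0)// mulr_ge0.
pose P (M : 'M[C]_2) := k / 2 < nm (M 0 0 / M 1 0 - A).
rewrite (big_fsetID _ P J) /=.
have -> : 16 * q * k = 8 * q * k + 16 * q * (k / 2) by field.
apply: lerD; last first.
  apply: IH => [|M]; first by rewrite divr_gt0.
  rewrite !inE /= /P -leNgt => /andP[/hJ[GM c0 h1 h2] h3]; split=> //.
  by rewrite -mulrA -invfM -exprS.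
apply: (@le_trans _ _ (\sum_(M <- [fset x in J | P x]%fset) nm (M 1 0) ^- 4 * (2 / k))).
  rewrite !big_seq ler_sum// => M; rewrite !inE /= => /andP[/hJ[GM c0 h1 h2] PM].
  rewrite ler_wpM2l ?invr_ge0 ?exprn_ge0 ?nm_ge0//.
  rewrite -[2 / k]invf_div lef_pV2 ?posrE ?divr_gt0// ?(ltW PM)//.
  by rewrite (lt_trans _ PM)// divr_gt0.
rewrite -mulr_suml -ler_pdivlMr ?divr_gt0//.
have -> : 8 * q * k / (2 / k) = q * (2 * k) ^+ 2.
  by field; rewrite gt_eqF.
apply: (packing _ A) => M; rewrite !inE /= => /andP[/hJ[GM c0 h1 h2] _].
have := lim_pt_dist lA GM c0; split=> //; first exact: entry10_neq1.
have -> : (4 * r * nm (M 1 0) ^+ 2)^-1 = (2 * r * nm (M 1 0) ^+ 2)^-1 / 2.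
  by field; rewrite nm_eq0 c0 gt_eqF.
lra.
Qed.

Lemma sum_lim_pt A : lim_pt A -> exists B : R, forall J : {fset 'M[C]_2},
  (forall M, M \in J -> G M /\ M 1 0 != 0) ->
  \sum_(M <- J) nm (M 1 0) ^- 4 / nm (M 0 0 / M 1 0 - A) <= B.
Proof.
move=> lA; exists (16 * (16 * r ^+ 2) * (2 * r)) => J hJ.
have D0 M : M \in J -> 0 < nm (M 0 0 / M 1 0 - A).
  move=> /hJ[GM c0]; apply: lt_le_trans (lim_pt_dist lA GM c0).
  by rewrite invr_gt0 !mulr_gt0// nm_gt0.
have [K K0 hK] := finite_bound (fun M : 'M[C]_2 => (nm (M 0 0 / M 1 0 - A))^-1)
  (finite_fset J).
apply: (@sum_shells A (Num.bound (2 * r * K))) => //; first by rewrite mulr_gt0.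
move=> M MJ; have [GM c0] := hJ _ MJ; split=> //.
  rewrite ltr_pdivrMr ?exprn_gt0// -ltr_pdivrMl ?D0// mulrC.
  rewrite (@le_lt_trans _ _ (2 * r * K))//.
    by rewrite ler_wpM2l ?hK// mulr_ge0 ?ltW.
  rewrite (@lt_le_trans _ _ (Num.bound (2 * r * K))%:R)//.
    by rewrite archi_boundP// !mulr_ge0 ?ltW.
  by rewrite -natrX ler_nat ltnW// ltn_expl.
rewrite (le_trans (nmB _ _))//.
have h1 := lim_pt_norm hG lA.
have h2 : nm (M 0 0 / M 1 0) <= r.
  rewrite nmM nmV ler_pdivrMr ?nm_gt0//.
  by apply: (entry00_le hG) => //; exact: entry10_neq1.
lra.
Qed.

(** At most one of the three points is close to [m], which leaves a single
    singular factor. *)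
Lemma prod3_inv (A : 'I_3 -> C) : injective A -> exists2 K : R, 0 <= K &
  forall m : C, (forall j, m != A j) ->
  \prod_(j < 3) (nm (m - A j))^-1 <= K * \sum_(j < 3) (nm (m - A j))^-1.
Proof.
move=> injA.
have [K K0 hK] := finite_bound
  (fun ij : 'I_3 * 'I_3 => (nm (A ij.1 - A ij.2))^-1) (@finite_finset _ [set: 'I_3 * 'I_3]).
pose s := (2 * K)^-1; have s0 : 0 < s by rewrite invr_gt0 mulr_gt0.
have sep i j : i != j -> s + s <= nm (A i - A j).
  move=> ij; have Ap : 0 < nm (A i - A j) by rewrite nm_gt0 subr_eq0 (inj_eq injA).
  have -> : s + s = K^-1 by rewrite /s; field; rewrite gt_eqF.
  by rewrite -[leRHS]invrK lef_pV2 ?posrE ?invr_gt0// (hK (i, j)).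
exists (s^-1 * s^-1) => [|m mA]; first by rewrite mulr_ge0// invr_ge0 ltW.
have D0 j : 0 < (nm (m - A j))^-1 by rewrite invr_gt0 nm_gt0 subr_eq0.
(* at most one of the three points lies within s of m *)
have near i j : i != j -> (nm (m - A i))^-1 <= s^-1 \/ (nm (m - A j))^-1 <= s^-1.
  move=> ij; have [h|h] := leP s (nm (m - A i)).
    by left; rewrite lef_pV2 ?posrE// -invr_gt0.
  right; rewrite lef_pV2 ?posrE//; last by rewrite -invr_gt0.
  have := nm_triB (A i) m (A j); have := sep _ _ ij.
  by rewrite (nm_distC (A i) m); lra.
have s10 : 0 < s^-1 by rewrite invr_gt0.
rewrite !big_ord_recl !big_ord0 mulr1 addr0.
have := near ord0 (lift ord0 ord0) isT.
have := near ord0 (lift ord0 (lift ord0 ord0)) isT.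
have := near (lift ord0 ord0) (lift ord0 (lift ord0 ord0)) isT.
have := D0 ord0; have := D0 (lift ord0 ord0).
have := D0 (lift ord0 (lift ord0 ord0)).
move: (nm _)^-1 (nm _)^-1 (nm _)^-1 (s^-1) s10 => a b c t t0 c0 b0 a0.
have tri x y z : 0 < x -> 0 < y -> 0 < z -> x <= t -> y <= t ->
    x * (y * z) <= t * t * (z + (x + y)).
  move=> x0 y0 z0 xt yt; rewrite mulrA (@le_trans _ _ (t * t * z))//.
    by rewrite ler_pM2r// ler_pM// ltW.
  by rewrite ler_pM2l ?mulr_gt0// lerDl addr_ge0 ?ltW.
have [ab|ab] := leP a t.
  have [bc|bc] := leP b t; first by move=> _ _ _; have := tri _ _ _ a0 b0 c0 ab bc; lra.
  move=> bc' _ _; have ct : c <= t by case: bc' => //; lra.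
  have := tri _ _ _ a0 c0 b0 ab ct; lra.
move=> _ ac' ab'; have bt : b <= t by case: ab' => //; lra.
have ct : c <= t by case: ac' => //; lra.
have := tri _ _ _ b0 c0 a0 bt ct; lra.
Qed.

(** The term is [|c|^-4] divided by the distances of [M oo] to [y] and to the
    [A j].  The distance to [y] is bounded below for almost all [M], and
    [prod3_inv] reduces to the sums of [sum_lim_pt]. *)
Lemma summable_infty (A : 'I_3 -> C) y : injective A -> (forall j, lim_pt (A j)) ->
  ~ lim_pt y -> exists (F : set 'M[C]_2) (B : R), [/\ finite_set F,
    forall M, G M -> ~ F M -> M 0 0 - y * M 1 0 != 0 &
    forall J : {fset 'M[C]_2}, (forall M, M \in J -> G M /\ ~ F M) ->
      \sum_(M <- J) (nm (M 0 0 - y * M 1 0))^-1 *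
        \prod_(j < 3) (nm (M 0 0 - A j * M 1 0))^-1 <= B].
Proof.
move=> injA lA ly.
have [d d0 fd] : exists2 e : R, 0 < e & finite_set
    [set M | [/\ G M, M 1 0 != 0 & nm (M 0 0 / M 1 0 - y) < e]].
  by apply: contrapT => h; apply: ly => e e0 fe; apply: h; exists e.
have [K K0 hK] := prod3_inv injA.
have /choice[B hB] j := sum_lim_pt (lA j).
have dd : 0 < d^-1 by rewrite invr_gt0.
exists ([set M | [/\ G M, M 1 0 != 0 & nm (M 0 0 / M 1 0 - y) < d]] `|` [set 1]),
  (d^-1 * K * \sum_(j < 3) B j).
have good M : G M -> ~ ([set M | [/\ G M, M 1 0 != 0 & nm (M 0 0 / M 1 0 - y) < d]]
    `|` [set 1]) M -> M 1 0 != 0 /\ d <= nm (M 0 0 / M 1 0 - y).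
  move=> GM /not_orP[h1 /eqP M1]; have c0 := entry10_neq0 hG GM M1.
  by split=> //; rewrite leNgt; apply/negP => h; apply: h1.
have eM t (M : 'M[C]_2) : M 1 0 != 0 -> nm (M 0 0 - t * M 1 0) = nm (M 1 0) * nm (M 0 0 / M 1 0 - t).
  by move=> c0; rewrite -nmM; congr nm; field.
split; first by rewrite finite_setU; split=> //; exact: finite_set1.
  move=> M GM /(good _ GM)[c0 h].
  by rewrite -nm_gt0 eM// mulr_gt0//; [rewrite nm_gt0|exact: lt_le_trans h].
move=> J hJ.
apply: (@le_trans _ _ (\sum_(M <- J) d^-1 * K *
   \sum_(j < 3) nm (M 1 0) ^- 4 / nm (M 0 0 / M 1 0 - A j))).
  rewrite !big_seq ler_sum// => M /hJ[GM /(good _ GM)[c0 h]].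
  have cp : 0 < nm (M 1 0) by rewrite nm_gt0.
  have mA j : M 0 0 / M 1 0 != A j.
    rewrite -subr_eq0 -nm_gt0; apply: lt_le_trans (lim_pt_dist (lA j) GM c0).
    by rewrite invr_gt0 !mulr_gt0.
  rewrite eM// invfM.
  under eq_bigr => j _ do rewrite eM// invfM.
  rewrite big_split /= prodr_const card_ord -mulr_sumr.
  have := hK _ mA; set p := \prod_(j < 3) _; set s := \sum_(j < 3) _ => hp.
  have p0 : 0 <= p by apply: prodr_ge0 => j _; rewrite invr_ge0 nm_ge0.
  have -> : (nm (M 1 0))^-1 / nm (M 0 0 / M 1 0 - y) * ((nm (M 1 0))^-1 ^+ 3 * p) =
     nm (M 1 0) ^- 4 * ((nm (M 0 0 / M 1 0 - y))^-1 * p).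
    by rewrite exprVn; field; rewrite !gt_eqF// (lt_le_trans d0).
  have -> : d^-1 * K * (nm (M 1 0) ^- 4 * s) = nm (M 1 0) ^- 4 * (d^-1 * (K * s)) by ring.
  rewrite ler_wpM2l ?invr_ge0 ?exprn_ge0 ?nm_ge0// ler_pM ?invr_ge0 ?nm_ge0//.
  by rewrite lef_pV2 ?posrE// (lt_le_trans d0).
rewrite -mulr_sumr ler_wpM2l//; first by rewrite mulr_ge0// ltW.
rewrite exchange_big /= ler_sum// => j _; apply: hB => M /hJ[GM /(good _ GM)[]//].
Qed.

(** The roots of the linear forms keep away from [x], so the terms at [x] are
    bounded by multiples of those at infinity. *)
Lemma summable_finite (A : 'I_3 -> C) x y : injective A -> (forall j, lim_pt (A j)) ->
  ~ lim_pt x -> ~ lim_pt y ->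
  (forall M, G M -> moeb_num M x - y * moeb_den M x != 0) ->
  exists (F : set 'M[C]_2) (B : R), finite_set F /\
    forall J : {fset 'M[C]_2}, (forall M, M \in J -> G M /\ ~ F M) ->
      \sum_(M <- J) (nm (moeb_num M x - y * moeb_den M x))^-1 *
        \prod_(j < 3) (nm (moeb_num M x - A j * moeb_den M x))^-1 <= B.
Proof.
move=> injA lA lx ly xy.
have [F [B [fF y0 hB]]] := summable_infty injA lA ly.
have [K K0 hK] := lin_ord_finite hG ly lx xy.
have /choice[L hL] j : exists L : R, 0 < L /\ forall M, G M ->
    moeb_num M x - A j * moeb_den M x != 0 /\
    nm (M 0 0 - A j * M 1 0) <= L * nm (moeb_num M x - A j * moeb_den M x).
  by have [L L0 h] := lin_lim_finite hG (lA j) lx; exists L.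
have L0 : 0 <= \prod_(j < 3) L j by apply: prodr_ge0 => j _; rewrite ltW// (hL j).1.
exists F, (K * \prod_(j < 3) L j * B); split=> // J hJ.
apply: le_trans (ler_wpM2l _ (hB J hJ)); last by rewrite mulr_ge0// ltW.
set P := \prod_(j < 3) L j.
rewrite mulr_sumr !big_seq ler_sum// => M /hJ[GM FM].
have inv_le (a b k : R) : 0 < a -> 0 < b -> a <= k * b -> b^-1 <= k * a^-1.
  by move=> a0 b0 h; rewrite ler_pdivlMr// mulrC -ler_pdivlMr ?invr_gt0// invrK.
rewrite mulrACA /P -big_split /=.
apply: ler_pM; rewrite ?invr_ge0 ?nm_ge0 ?prodr_ge0//.
- by move=> j _; rewrite invr_ge0 nm_ge0.
- by rewrite inv_le ?nm_gt0 ?y0 ?xy ?hK.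
apply: ler_prod => j _; rewrite invr_ge0 nm_ge0 /=.
have [_ /(_ _ GM)[h1 h2]] := hL j.
by rewrite inv_le ?nm_gt0// (lin_lim_neq0 hG).
Qed.

Lemma abs_summable_group (f : 'M[C]_2 -> C) (F : set 'M[C]_2) (B : R) : finite_set F ->
  (forall J : {fset 'M[C]_2}, (forall M, M \in J -> G M /\ ~ F M) ->
     \sum_(M <- J) nm (f M) <= B) ->
  abs_summable (fun M : G => f (val M)).
Proof.
move=> fF hB.
have fF' : finite_set [set M : G | F (val M)].
  by apply: finite_preimage fF => M N _ _; exact: val_inj.
apply: (@abs_summable_cofinite _ _ _ (fset_set [set M : G | F (val M)]) B) => J hJ.
have -> : \sum_(M <- J) nm (f (val M)) = \sum_(M <- [fset val M | M in J]%fset) nm (f M).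
  by rewrite big_imfset //= => M N _ _; exact: val_inj.
apply: hB => _ /imfsetP[M /= MJ ->]; split; first exact: set_valP.
by move=> FM; have := hJ _ MJ; rewrite in_fset_set// notin_setE; apply.
Qed.

End PoincareSeries.

(** * Limit set and orbits of a Schottky group *)

Section SchottkyGroup.
Variables (R : realType) (g : nat).
Local Notation C := (Cplx R).
Variable p : params R g.
Hypothesis hp : schottky_space p.

Lemma Gamma_free : exists r : R, free_at_infinity (Gamma p) r.
Proof.
have [r r0 hr] := Gamma_maps hp; exists r; split=> //.
- exact: Gamma1.
- by move=> M N; exact: GammaM.
- by move=> M; exact: GammaV.
- by move=> M; exact: Gamma_det.
Qed.

Local Notation G := (Gamma p).
Local Notation lim_pt := (lim_pt G).

(** An orbit of an ordinary point accumulates where that of infinity does; an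
    orbit of limit points stays in the closed set that they form. *)
Lemma limit_set_Some z : limit_set p (Some z) <-> lim_pt z.
Proof.
have [r hG] := Gamma_free; split; last first.
  move=> lz; exists None => U /nbhs_nm[e e0 hU].
  apply: (sub_infinite_set _ (lz _ e0)) => M /= [GM c0 Mz]; split=> //.
  by rewrite (negPf c0); exact: hU.
have nbU (e : R) : 0 < e ->
    nbhs (Some z : Chat R) [set u | exists2 t, u = Some t & nm (t - z) < e].
  by move=> e0; apply/nbhs_nm; exists e => // t tz; exists t.
case=> -[t|] ht; last first.
  move=> e e0; apply: (sub_infinite_set _ (ht _ (nbU _ e0))) => M /= [GM [t]].
  by case: ifPn => // c0 [<-] h.
have [lt|lt] := pselect (lim_pt t).
  apply: (lim_pt_closed (G := G)) => e e0.
  have [M /= [GM [u + +]] _] := infinite_neq 1 (ht _ (nbU _ e0)).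
  case: ifPn => // d0 [<-] h; exists (moeb M t) => //; exact: lim_pt_moeb hG _ _ lt GM.
move=> e e0; have e20 : 0 < e / 2 by rewrite divr_gt0.
have := infinite_setD (ht _ (nbU _ e20)) (orbit_near_infty hG lt e20).
apply: sub_infinite_set => M /= [[GM [u]]]; case: ifPn => // d0 [<-] h1 h2.
have [c0 _ h3] : [/\ M 1 0 != 0, moeb_den M t != 0 & nm (moeb M t - M 0 0 / M 1 0) < e / 2].
  by apply: contrapT => h; apply: h2; split=> // -[? _ ?]; apply: h.
split=> //; have := nm_triB (M 0 0 / M 1 0) (moeb M t) z.
by rewrite (nm_distC _ (moeb M t)); lra.
Qed.

Lemma Omega0_Some z : Omega0 p (Some z) <-> ~ lim_pt z.
Proof. by rewrite /Omega0 /setC /=; split=> h /limit_set_Some. Qed.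

Lemma lin_neq0_sym x y : (forall M, G M -> moeb_num M x - y * moeb_den M x != 0) ->
  forall M, G M -> moeb_num M y - x * moeb_den M y != 0.
Proof.
have [r hG] := Gamma_free; move=> h M GM; have := h _ (GammaV hp GM).
have [e1 e2 e3 e4] := inv_det1 (Gamma_det hp GM).
rewrite /moeb_num /moeb_den e1 e2 e3 e4 -oppr_eq0.
by congr (_ != 0); ring.
Qed.

Lemma num_den_neq0 M x : G M -> moeb_den M x = 0 -> moeb_num M x != 0.
Proof.
move=> /(Gamma_det hp); rewrite det_mx2 => dM d0; apply/eqP => n0.
have : M 0 0 * moeb_den M x - M 1 0 * moeb_num M x = 1.
  by rewrite -dM /moeb_den /moeb_num; ring.
by rewrite d0 n0 !mulr0 subrr => /eqP; rewrite eq_sym oner_eq0.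
Qed.

Lemma orbit_SomeSome x y : ~ Defs.orbit p (Some x) (Some y) <->
  forall M, G M -> moeb_num M x - y * moeb_den M x != 0.
Proof.
split=> [h M GM|h [M GM] /=].
  apply/eqP => e; apply: h; exists M => //=.
  have d0 : moeb_den M x != 0.
    apply/eqP => d0; have := num_den_neq0 GM d0.
    by move/eqP: e; rewrite d0 mulr0 subr0 => ->.
  rewrite (negPf d0) /moeb; congr Some; apply: (mulIf d0); rewrite divfK//.
  by apply/eqP; rewrite -subr_eq0 e.
case: ifPn => // d0 [] e; have /eqP := h _ GM; apply.
by rewrite -e /moeb divfK// subrr.
Qed.

Lemma orbit_SomeNone y : ~ Defs.orbit p (Some y) None <->
  forall M, G M -> M 0 0 - y * M 1 0 != 0.
Proof.
have aux M : G M -> M 0 0 - y * M 1 0 = moeb_den M^-1 y.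
  move=> GM; have [e1 e2 e3 e4] := inv_det1 (Gamma_det hp GM).
  by rewrite /moeb_den e3 e4; ring.
split=> [h M GM|h [M GM] /=].
  rewrite aux//; apply/eqP => e; apply: h; exists M^-1; first exact: GammaV.
  by rewrite /= e eqxx.
case: ifPn => // /eqP e _; have := h _ (GammaV hp GM).
by rewrite aux ?invrK ?e ?eqxx//; exact: GammaV.
Qed.

Lemma off_polesE x y : off_poles p x y <->
  [/\ ~ lim_pt x, ~ lim_pt y & forall M, G M -> moeb_num M x - y * moeb_den M x != 0].
Proof. by split=> -[/Omega0_Some ? /Omega0_Some ? /orbit_SomeSome]. Qed.

Lemma moebVK M x : G M -> moeb_den M x != 0 -> moeb M^-1 (moeb M x) = x.
Proof.
move=> GM d0; have [e1 e2 e3 e4] := inv_det1 (Gamma_det hp GM).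
have := Gamma_det hp GM; rewrite det_mx2 => dM.
have n1 : M 1 1 * moeb_num M x - M 0 1 * moeb_den M x = x.
  by rewrite -[RHS]mul1r -dM /moeb_num /moeb_den; ring.
have n2 : M 0 0 * moeb_den M x - M 1 0 * moeb_num M x = 1.
  by rewrite -dM /moeb_num /moeb_den; ring.
rewrite {1}/moeb /moeb_num /moeb_den e1 e2 e3 e4 -[RHS]n1 -[RHS]divr1 -[in RHS]n2.
rewrite /moeb; move: (moeb_num M x) (moeb_den M x) d0 n2 => n d d0 n2.
by field; rewrite n2 d0 oner_eq0.
Qed.

Lemma off_poles_moeb_l x y M : off_poles p x y -> G M -> moeb_den M x != 0 ->
  off_poles p (moeb M x) y.
Proof.
move=> /off_polesE[lx ly xy] GM d0; apply/off_polesE; split=> //.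
  have [r hG] := Gamma_free.
  move=> /(lim_pt_moeb hG)/(_ (GammaV hp GM)); apply: contra_not lx.
  by rewrite moebVK.
move=> N GN; have := xy _ (GammaM GN GM).
rewrite !moeb_numE !moeb_denE hnumM hdenM -moeb_numE -moeb_denE.
have -> : moeb_num M x = moeb_den M x * moeb M x by rewrite /moeb mulrCA divff// mulr1.
rewrite -{2 4}[moeb_den M x]mulr1 hnumZ hdenZ mulrCA -mulrBr mulf_eq0 negb_or.
by case/andP.
Qed.

Lemma off_poles_sym x y : off_poles p x y -> off_poles p y x.
Proof. by move=> /off_polesE[? ? /lin_neq0_sym ?]; apply/off_polesE. Qed.

Lemma off_poles_moeb_r x y M : off_poles p x y -> G M -> moeb_den M y != 0 ->
  off_poles p x (moeb M y).
Proof.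
by move=> /off_poles_sym h GM d0; apply: off_poles_sym; exact: off_poles_moeb_l.
Qed.

(** Pointwise form of [holomorphic_qd]. *)
Definition hol_at (phi : C -> C) (z : Chat R) : Prop :=
  if z is Some z' then derivable phi z' 1 else
  exists2 psi : C -> C, derivable psi 0 1 &
    \forall u \near (0 : C)^', phi u^-1 = u ^+ 4 * psi u.

(** The neighbourhoods of a point of the sphere, traced on its finite part. *)
Definition near_at (z : Chat R) (P : C -> Prop) : Prop :=
  if z is Some z' then \forall t \near z', P t
  else \forall u \near (0 : C)^', P u^-1.

Lemma holomorphic_qdP U phi : holomorphic_qd U phi <-> forall z, U z -> hol_at phi z.
Proof.
split=> [[h1 h2] [z|]|h]; [exact: h1|exact: h2|split].
  by move=> z; exact: (h (Some z)).
exact: (h None).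
Qed.


End SchottkyGroup.

(** * Holomorphy and invariance of the Bers kernel *)

Section LocalHolomorphy.
Variables (R : realType).
Local Notation C := (Cplx R).

Lemma near_atI (z : Chat R) P Q : near_at z P -> near_at z Q ->
  near_at z (fun t => P t /\ Q t).
Proof. by case: z => [z|] /= hP hQ; [apply: filterI hP hQ|apply: filterS2 hP hQ]. Qed.

Lemma near_atS (z : Chat R) (P Q : C -> Prop) : (forall t, P t -> Q t) ->
  near_at z P -> near_at z Q.
Proof. by case: z => [z|] PQ /=; apply: filterS => u; exact: PQ. Qed.

Lemma hol_at_near (z : Chat R) (f h : C -> C) : near_at z (fun t => f t = h t) ->
  hol_at f z -> hol_at h z.
Proof.
case: z => [z|] /= fh; first exact: near_eq_derivable.
by move=> [psi dpsi hpsi]; exists psi => //; apply: filterS2 fh hpsi => u <-.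
Qed.

Lemma hol_at0 (z : Chat R) : hol_at (fun=> 0) z.
Proof.
case: z => [z|] /=; first exact: derivable_cst.
by exists (fun=> 0); [exact: derivable_cst|near=> u; rewrite mulr0].
Unshelve. all: by end_near. Qed.

Lemma hol_atD (z : Chat R) f h : hol_at f z -> hol_at h z ->
  hol_at (fun t => f t + h t) z.
Proof.
case: z => [z|] /=; first exact: derivableD.
move=> [a da ha] [b db hb]; exists (fun u => a u + b u); first exact: derivableD.
by apply: filterS2 ha hb => u -> ->; rewrite mulrDr.
Qed.

Lemma hol_atZ (z : Chat R) c f : hol_at f z -> hol_at (fun t => c * f t) z.
Proof.
case: z => [z|] /=; first exact: derivableZ.
move=> [a da ha]; exists (fun u => c * a u); first exact: derivableZ.
by apply: filterS ha => u ->; rewrite mulrCA.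
Qed.

Lemma hol_at_lin (I : Type) (s : seq I) (z : Chat R) (c : I -> C) (f : I -> C -> C) :
  (forall i, hol_at (f i) z) -> hol_at (fun t => \sum_(i <- s) c i * f i t) z.
Proof.
move=> hf; elim: s => [|i s IH].
  by apply: hol_at_near (hol_at0 z); case: z {hf} => [z|] /=; near=> u; rewrite big_nil.
apply: hol_at_near (hol_atD (hol_atZ (c i) (hf i)) IH).
by case: z {hf IH} => [z|] /=; near=> u; rewrite big_cons.
Unshelve. all: by end_near. Qed.

End LocalHolomorphy.

Section BersSeries.
Variables (R : realType) (g : nat).
Local Notation C := (Cplx R).
Variable p : params R g.
Hypothesis hp : schottky_space p.
Local Notation G := (Gamma p).
Local Notation lim_pt := (lim_pt G).

Lemma off_poles_near (z : Chat R) y : Omega0 p z -> Omega0 p (Some y) ->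
  ~ Defs.orbit p (Some y) z -> near_at z (fun x => off_poles p x y).
Proof.
have [r hG] := Gamma_free hp.
case: z => [z|] + /(Omega0_Some hp) ly; last first.
  move=> _ /(orbit_SomeNone hp) yo; have [K K0 hK] := lin_ord_infty hG ly yo.
  apply/dnbhs_nm; exists (Num.min r^-1 K^-1).
    by rewrite lt_min !invr_gt0 K0 (fai_gt0 hG).
  move=> u u0; rewrite subr0 lt_min => /andP[ur uK]; apply/(off_polesE hp); split=> //.
    move=> /(lim_pt_norm hG); rewrite nmV leNgt.
    by rewrite invf_pgt ?posrE ?nm_gt0 ?(fai_gt0 hG)// ur.
  move=> M GM.
  have -> : moeb_num M u^-1 - y * moeb_den M u^-1 =
      u^-1 * ((M 0 0 - y * M 1 0) + u * (M 0 1 - y * M 1 1)).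
    by rewrite /moeb_num /moeb_den; field.
  rewrite mulf_neq0 ?invr_eq0// -nm_gt0.
  have := nm_revB (M 0 0 - y * M 1 0) (- (u * (M 0 1 - y * M 1 1))).
  rewrite opprK nmN nmM; apply: lt_le_trans; rewrite subr_gt0.
  rewrite (le_lt_trans (ler_wpM2l (nm_ge0 _) (hK _ GM)))// mulrA.
  by rewrite gtr_pMl ?nm_gt0 ?yo// mulrC -ltr_pdivlMl// mulr1.
move=> /(Omega0_Some hp) lz /(orbit_SomeSome hp) /(lin_neq0_sym hp) yz.
have [K K0 hK] := lin_ord_finite hG ly lz yz; have [d d0 hd] := lim_pt_sep lz.
apply/nbhs_nm; exists (Num.min d K^-1); first by rewrite lt_min invr_gt0 K0 d0.
move=> t; rewrite lt_min => /andP[td tK]; apply/(off_polesE hp); split=> //.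
  by move=> /hd; rewrite leNgt nm_distC td.
move=> M GM.
have -> : moeb_num M t - y * moeb_den M t =
    (moeb_num M z - y * moeb_den M z) + (t - z) * (M 0 0 - y * M 1 0).
  by rewrite /moeb_num /moeb_den; ring.
rewrite -nm_gt0.
have := nm_revB (moeb_num M z - y * moeb_den M z) (- ((t - z) * (M 0 0 - y * M 1 0))).
rewrite opprK nmN (nmM (t - z)); apply: lt_le_trans; rewrite subr_gt0.
rewrite (le_lt_trans (ler_wpM2l (nm_ge0 _) (hK _ GM)))// mulrA.
by rewrite gtr_pMl ?nm_gt0 ?yz// mulrC -ltr_pdivlMl// mulr1.
Qed.

Variable A : 'I_3 -> C.
Hypothesis injA : injective A.
Hypothesis lA : forall j, limit_set p (Some (A j)).

Let lA' j : lim_pt (A j). Proof. exact/limit_set_Some. Qed.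

(** The four points at which the general term of the series, as a function of
    [M x], has its poles. *)
Definition pole y (j : 'I_4) : C := if unlift ord0 j is Some i then A i else y.

Lemma prod_pole y (F : C -> C) :
  \prod_(j < 4) F (pole y j) = F y * \prod_(j < 3) F (A j).
Proof.
rewrite big_ord_recl /pole unlift_none; congr (_ * _).
by apply: eq_bigr => i _; rewrite liftK.
Qed.

(** The part of the general term that depends on [M].  As a function of [x] or of
    [y], and also of [1 / x] after division by its fourth power, it is the
    inverse of a product of four affine functions, to which
    [derivable_sum_prod_inv] applies. *)
Definition kernel (M : 'M[C]_2) (x y : C) : C :=
  (\prod_(j < 4) (moeb_num M x - pole y j * moeb_den M x))^-1.

Lemma bers_term_kernel M x y : bers_term A M x y = \prod_(j < 3) (y - A j) * kernel M x y.
Proof.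
by rewrite /bers_term /kernel (prod_pole y (fun t => moeb_num M x - t * moeb_den M x)).
Qed.

Lemma nm_prod_pole y (F : C -> C) :
  nm (\prod_(j < 4) F (pole y j))^-1 = (nm (F y))^-1 * \prod_(j < 3) (nm (F (A j)))^-1.
Proof.
by rewrite prod_pole nmV nmM nm_prod invfM prodfV.
Qed.

Lemma kernel_summable x y : off_poles p x y ->
  abs_summable (fun M : G => kernel (val M) x y).
Proof.
have [r hG] := Gamma_free hp.
move=> /(off_polesE hp)[lx ly xy].
have [F [B [fF hB]]] := summable_finite hG injA lA' lx ly xy.
apply: (@abs_summable_group _ _ (fun M => kernel M x y) F B) => // J /hB.
apply: le_trans; apply: ler_sum => M _.
by rewrite /kernel (nm_prod_pole y (fun t => moeb_num M x - t * moeb_den M x)).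
Qed.

Lemma Psi_BersE x y : off_poles p x y -> Psi_Bers p A x y =
  \prod_(j < 3) (y - A j) * summability.sum (fun M : G => kernel (val M) x y).
Proof.
move=> /kernel_summable/abs_summable_has_sum/(has_sumZ (\prod_(j < 3) (y - A j))).
by move=> h; apply: has_sumE; apply: has_sum_eq h => M; rewrite bers_term_kernel.
Qed.

(** Gathers the bounds for the four poles into one. *)
Lemma uniform_factor (P : C -> 'M[C]_2 -> R -> Prop) y :
  (forall t M K K', K <= K' -> P t M K -> P t M K') ->
  (exists2 K, 0 < K & forall M, G M -> P y M K) ->
  (forall j, exists2 K, 0 < K & forall M, G M -> P (A j) M K) ->
  exists K, forall (j : 'I_4) (M : G), P (pole y j) (val M) K.
Proof.
move=> mono [K0 K00 h0] /(_ _)/cid2 hA.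
pose K := K0 + \sum_(j < 3) sval (hA j).
have Kp j : 0 < sval (hA j) by case: (hA j).
have sK : 0 <= \sum_(j < 3) sval (hA j) by apply: sumr_ge0 => j _; rewrite ltW.
exists K => j M; have GM : G (val M) by exact: set_valP.
rewrite /pole; case: (unlift ord0 j) => [i|].
  apply: (@mono _ _ (sval (hA i))); last by case: (hA i) => L L0 /=; exact.
  rewrite /K ler_wpDl ?(ltW K00)// (bigD1 i)//= lerDl sumr_ge0// => l _.
  exact/ltW/Kp.
by apply: mono (h0 _ GM); rewrite /K lerDl.
Qed.

Lemma Bers_hol_finite z y : off_poles p z y ->
  derivable (fun x => Psi_Bers p A x y) z 1.
Proof.
have [r hG] := Gamma_free hp; move=> zy; have /(off_polesE hp)[lz ly zy0] := zy.
pose al (j : 'I_4) (M : G) := moeb_num (val M) z - pole y j * moeb_den (val M) z.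
pose be (j : 'I_4) (M : G) := (val M) 0 0 - pole y j * (val M) 1 0.
have al0 j M : al j M != 0.
  have GM : G (val M) by exact: set_valP.
  rewrite /al /pole; case: (unlift ord0 j) => [i|]; last exact: zy0.
  by have [L L0 /(_ _ GM)[]] := lin_lim_finite hG (@lA' i) lz.
have [K hK] : exists K, forall (j : 'I_4) (M : G), nm (be j M) <= K * nm (al j M).
  apply: (uniform_factor (P := fun t M K =>
    nm (M 0 0 - t * M 1 0) <= K * nm (moeb_num M z - t * moeb_den M z))).
  - by move=> t M K K' KK /le_trans; apply; rewrite ler_wpM2r ?nm_ge0.
  - by have [L L0 h] := lin_ord_finite hG ly lz zy0; exists L.
  - by move=> j; have [L L0 h] := lin_lim_finite hG (@lA' j) lz; exists L => // M /h[].
have dS := derivable_sum_prod_inv al0 hK (kernel_summable zy).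
have {}dS := derivable_mulc (c := \prod_(j < 3) (y - A j)) (derivable_shift (z := z) dS).
apply: near_eq_derivable dS; have [Oy Oz yz] := off_poles_sym hp zy.
have /(_ Oz Oy yz) := @off_poles_near (Some z) y => /=; apply: filterS => x xy.
rewrite Psi_BersE//; congr (_ * _); apply: eq_unordered_sum => M.
rewrite /kernel; congr (_^-1); apply: eq_bigr => j _.
by rewrite /al /be /moeb_num /moeb_den; ring.
Qed.

Lemma Bers_hol_infty y : Omega0 p None -> Omega0 p (Some y) ->
  ~ Defs.orbit p (Some y) None -> hol_at (fun x => Psi_Bers p A x y) None.
Proof.
have [r hG] := Gamma_free hp; move=> OI Oy yI.
have /(Omega0_Some hp) ly := Oy; have /(orbit_SomeNone hp) y0 := yI.
pose al (j : 'I_4) (M : G) := (val M) 0 0 - pole y j * (val M) 1 0.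
pose be (j : 'I_4) (M : G) := (val M) 0 1 - pole y j * (val M) 1 1.
have al0 j M : al j M != 0.
  have GM : G (val M) by exact: set_valP.
  rewrite /al /pole; case: (unlift ord0 j) => [i|]; last exact: y0.
  exact: (lin_lim_neq0 hG (@lA' i) GM).
have [K hK] : exists K, forall (j : 'I_4) (M : G), nm (be j M) <= K * nm (al j M).
  apply: (uniform_factor (P := fun t M K =>
    nm (M 0 1 - t * M 1 1) <= K * nm (M 0 0 - t * M 1 0))).
  - by move=> t M K K' KK /le_trans; apply; rewrite ler_wpM2r ?nm_ge0.
  - by have [L L0 h] := lin_ord_infty hG ly y0; exists L.
  - by move=> j; exists r => [|M]; [exact: fai_gt0 hG|move=> GM; exact: (lin_lim_infty hG (@lA' j) GM)].
have sum_al : abs_summable (fun M : G => (\prod_(j < 4) al j M)^-1).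
  have [F [B [fF _ hB]]] := summable_infty hG injA lA' ly.
  apply: (@abs_summable_group _ _ (fun M : 'M[C]_2 =>
    (\prod_(j < 4) (M 0 0 - pole y j * M 1 0))^-1) F B) => // J /hB.
  apply: le_trans; apply: ler_sum => M _.
  by rewrite (nm_prod_pole y (fun t => M 0 0 - t * M 1 0)).
have dS := derivable_mulc (c := \prod_(j < 3) (y - A j)) (derivable_sum_prod_inv al0 hK sum_al).
eexists; first exact: dS.
have /(_ OI Oy yI) /= nr := @off_poles_near None y.
have n0 : \forall u \near (0 : C)^', u != 0 by exact: nbhs_dnbhs_neq.
apply: filterS2 nr n0 => u uy u0; have sk := kernel_summable uy.
rewrite Psi_BersE// mulrCA; congr (_ * _).
have /(has_sumZ (u ^- 4)) := abs_summable_has_sum sk.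
move=> /(has_sum_eq (g := fun M : G => (\prod_(j < 4) (al j M + u * be j M))^-1)).
move=> /(_ _)/has_sumE -> => [|M]; first by rewrite mulrA divff ?mul1r// expf_neq0.
rewrite /kernel -invfM; congr (_^-1).
have -> : u ^+ 4 = \prod_(j < 4) u by rewrite prodr_const card_ord.
rewrite -big_split /=; apply: eq_bigr => j _.
by rewrite /al /be /moeb_num /moeb_den; field.
Qed.

Lemma Bers_hol z y : Omega0 p z -> Omega0 p (Some y) ->
  ~ Defs.orbit p (Some y) z -> hol_at (fun x => Psi_Bers p A x y) z.
Proof.
case: z => [z|] Oz Oy yz; last exact: Bers_hol_infty.
by apply/Bers_hol_finite/(off_poles_sym hp); split.
Qed.

Lemma Bers_derivable_y x y : off_poles p x y ->
  derivable (Psi_Bers p A x) y 1.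
Proof.
have [r hG] := Gamma_free hp; move=> xy; have /(off_polesE hp)[lx ly xy0] := xy.
pose al (j : 'I_4) (M : G) := moeb_num (val M) x - pole y j * moeb_den (val M) x.
pose be (j : 'I_4) (M : G) := if unlift ord0 j is Some i then 0 else - moeb_den (val M) x.
have al0 j M : al j M != 0.
  have GM : G (val M) by exact: set_valP.
  rewrite /al /pole; case: (unlift ord0 j) => [i|]; last exact: xy0.
  by have [L L0 /(_ _ GM)[]] := lin_lim_finite hG (@lA' i) lx.
have [K K0 hK] := lin_ord_finite_y hG lx ly xy0.
have bK j M : nm (be j M) <= K * nm (al j M).
  rewrite /be /al /pole; case: (unlift ord0 j) => [i|].
    by rewrite nm0 mulr_ge0 ?nm_ge0// ltW.
  by rewrite nmN hK//; exact: set_valP.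
have dS := derivable_shift (z := y) (derivable_sum_prod_inv al0 bK (kernel_summable xy)).
have dP : derivable (fun t => \prod_(j < 3) (t - A j)) y 1.
  have -> : (fun t => \prod_(j < 3) (t - A j)) =
      (fun t => (\prod_(j < 3) ('X - (A j)%:P)).[t]).
    apply/funext => t; rewrite horner_prod; apply: eq_bigr => j _.
    by rewrite hornerXsubC.
  exact: derivable_poly.
apply: near_eq_derivable (derivable_mul dP dS); have [Ox Oy xy'] := xy.
have /(_ Oy Ox xy') := @off_poles_near (Some y) x => /=.
apply: filterS => t /(off_poles_sym hp) xt; rewrite Psi_BersE//.
rewrite /kernel /=; congr (_ * _); apply: eq_unordered_sum => M.
congr (_^-1); apply: eq_bigr => j _; rewrite /al /be /pole.
by case: (unlift ord0 j) => [i|]; ring.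
Qed.

(** Right translation by [M] permutes the terms of the series. *)
Lemma Psi_Bers_moeb x y M : off_poles p x y -> G M -> moeb_den M x != 0 ->
  Psi_Bers p A (moeb M x) y * dmoeb M x ^+ 2 = Psi_Bers p A x y.
Proof.
move=> xy GM d0; have xy' := off_poles_moeb_l hp xy GM d0.
rewrite !Psi_BersE// -mulrA; congr (_ * _).
pose sh L (GL : G L) (N : G) : G :=
  exist _ (val N * L) (mem_set (GammaM (set_valP N) GL)).
have shK : cancel (sh M GM) (sh _ (GammaV hp GM)).
  by move=> N; apply: val_inj; rewrite /= -mulrA mulrV ?mulr1// unit_det1// (Gamma_det hp).
have shK' : cancel (sh _ (GammaV hp GM)) (sh M GM).
  by move=> N; apply: val_inj; rewrite /= -mulrA mulVr ?mulr1// unit_det1// (Gamma_det hp).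
have := has_sum_reindex shK shK' (abs_summable_has_sum (kernel_summable xy)).
move=> /(has_sumZ (dmoeb M x ^- 2)).
move=> /(has_sum_eq (g := fun N : G => kernel (val N) (moeb M x) y)).
move=> /(_ _)/has_sumE -> => [|N].
  by rewrite mulrAC mulVf ?mul1r// expf_neq0// /dmoeb invr_eq0 expf_neq0.
rewrite /dmoeb /kernel /= -invfM; congr (_^-1).
have -> : moeb_den M x ^- 2 ^+ 2 = \prod_(j < 4) (moeb_den M x)^-1.
  by rewrite prodr_const card_ord -exprVn -exprM.
rewrite -big_split /=; apply: eq_bigr => j _.
rewrite !moeb_numE !moeb_denE hnumM hdenM -moeb_numE -moeb_denE.
have e : moeb_num M x = moeb_den M x * moeb M x by rewrite /moeb mulrCA divff// mulr1.
have eN L : hnum L (moeb_num M x) (moeb_den M x) = moeb_den M x * hnum L (moeb M x) 1.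
  by rewrite -hnumZ -e mulr1.
have eD L : hden L (moeb_num M x) (moeb_den M x) = moeb_den M x * hden L (moeb M x) 1.
  by rewrite -hdenZ -e mulr1.
by rewrite eN eD; field.
Qed.

End BersSeries.

(** * GEM forms and their quasi-periods *)

Section GEM.
Variables (R : realType) (g : nat).
Local Notation C := (Cplx R).
Variable p : params R g.
Hypothesis hp : schottky_space p.
Local Notation G := (Gamma p).
Local Notation lim_pt := (lim_pt G).
Variable Psi : C -> C -> C.
Hypothesis hPsi : GEM_form p Psi.

Lemma GEM_hol z y : Omega0 p z -> Omega0 p (Some y) ->
  ~ Defs.orbit p (Some y) z -> hol_at (fun x => Psi x y) z.
Proof.
move=> Oz Oy yz; have [A [d [Phi [P [injA lA [HPhi _] _ PsiE]]]]] := hPsi.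
apply: hol_at_near (hol_atD (Bers_hol hp injA lA Oz Oy yz)
  (@hol_at_lin _ _ (index_enum 'I_d) z (fun r => - (P r).[y]) Phi _)); last first.
  by move=> r; have [/holomorphic_qdP h _] := HPhi r; exact: h.
apply: near_atS (off_poles_near hp Oz Oy yz) => x xy; rewrite PsiE//.
by congr (_ + _); rewrite -sumrN; apply: eq_bigr => r _; rewrite mulNr mulrC.
Qed.

Lemma GEM_moeb x y M : off_poles p x y -> G M -> moeb_den M x != 0 ->
  Psi (moeb M x) y * dmoeb M x ^+ 2 = Psi x y.
Proof.
move=> xy GM d0; have [A [d [Phi [P [injA lA [HPhi _] _ PsiE]]]]] := hPsi.
rewrite !PsiE//; last exact: off_poles_moeb_l.
rewrite mulrBl (Psi_Bers_moeb hp injA lA)//; congr (_ - _).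
rewrite mulr_suml; apply: eq_bigr => r _; rewrite mulrAC.
by have [_ h] := HPhi r; rewrite h//; case: xy.
Qed.

Lemma GEM_derivable_y x y : off_poles p x y -> derivable (Psi x) y 1.
Proof.
move=> xy; have [A [d [Phi [P [injA lA _ _ PsiE]]]]] := hPsi.
have dB := Bers_derivable_y hp injA lA xy.
have dP : derivable (fun t => - (\sum_(r < d) Phi r x * (P r).[t])) y 1.
  have -> : (fun t => - (\sum_(r < d) Phi r x * (P r).[t])) =
      (fun t => (- \sum_(r < d) (Phi r x) *: P r).[t]).
    apply/funext => t; rewrite hornerN horner_sum; congr (- _).
    by apply: eq_bigr => r _; rewrite hornerZ.
  exact: derivable_poly.
apply: near_eq_derivable (derivableD dB dP).
have [Oy Ox yx] := off_poles_sym hp xy; have [_ _ xy'] := xy.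
have /= nr := off_poles_near hp (z := Some y) Oy Ox xy'.
by apply: filterS nr => t /(off_poles_sym hp) /PsiE ->.
Qed.

End GEM.

Section BasePoints.
Variables (R : realType) (g : nat).
Local Notation C := (Cplx R).
Variable p : params R g.
Hypothesis hp : schottky_space p.
Local Notation G := (Gamma p).

Lemma moeb_comp (N M : 'M[C]_2) y : moeb_den M y != 0 ->
  moeb_den (N * M) y = moeb_den M y * moeb_den N (moeb M y) /\
  moeb (N * M) y = moeb N (moeb M y).
Proof.
move=> d0.
have e : moeb_num M y = moeb_den M y * moeb M y by rewrite /moeb mulrCA divff ?mulr1.
have dE : moeb_den (N * M) y = moeb_den M y * moeb_den N (moeb M y).
  by rewrite !moeb_denE hdenM -hdenZ mulr1 -moeb_denE -e moeb_numE.
have nE : moeb_num (N * M) y = moeb_den M y * moeb_num N (moeb M y).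
  by rewrite !moeb_numE hnumM -hnumZ mulr1 -moeb_denE -e moeb_numE.
by split=> //; rewrite [LHS]/moeb nE dE -mulf_div divff// mul1r.
Qed.

Lemma orbit_moeb z y M : ~ Defs.orbit p (Some y) z -> G M -> moeb_den M y != 0 ->
  ~ Defs.orbit p (Some (moeb M y)) z.
Proof.
move=> yz GM d0 [N GN NM]; apply: yz; exists (N * M); first exact: GammaM.
have [dE mE] := moeb_comp N d0.
by rewrite -{}NM /moebius dE mE mulf_eq0 (negPf d0).
Qed.

Lemma Omega0_moeb y M : Omega0 p (Some y) -> G M -> moeb_den M y != 0 ->
  Omega0 p (Some (moeb M y)).
Proof.
have [r hG] := Gamma_free hp.
move=> /(Omega0_Some hp) ly GM d0; apply/(Omega0_Some hp) => lMy; apply: ly.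
by rewrite -(moebVK hp GM d0); exact: (lim_pt_moeb hG lMy (GammaV hp GM)).
Qed.

(** Near infinity an orbit has at most one point, so three points avoiding a
    given orbit are easily found. *)
Lemma base_points (z : Chat R) : exists Y : 'I_3 -> C, [/\ injective Y,
  forall i, Omega0 p (Some (Y i)), forall i, ~ Defs.orbit p (Some (Y i)) z &
  forall i M, G M -> moeb_den M (Y i) != 0].
Proof.
have [r hG] := Gamma_free hp; have r0 := fai_gt0 hG.
pose Y (k : nat) : C := (r + 1 + k%:R)%:C%C.
have injY : injective Y.
  by move=> i j /(@complexI R)/addrI/eqP; rewrite eqr_nat => /eqP.
have nY k : r < nm (Y k).
  rewrite nm_real ger0_norm; last by rewrite !addr_ge0// ltW.
  by rewrite -addrA ltrDl ltr_wpDr.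
have OY k : Omega0 p (Some (Y k)).
  by apply/(Omega0_Some hp) => /(lim_pt_norm hG); rewrite leNgt nY.
have maps M k : G M -> M != 1 -> nm (moeb_num M (Y k)) <= r * nm (moeb_den M (Y k)).
  move=> GM M1; rewrite moeb_numE moeb_denE; apply: (fai_maps hG) => //.
  by rewrite nm1 mulr1 ltW.
have dY M k : G M -> moeb_den M (Y k) != 0.
  move=> GM; have [->|M1] := eqVneq M 1; first by rewrite moeb_denE hden1 oner_eq0.
  apply/eqP => d0; have := maps _ k GM M1.
  rewrite d0 nm0 mulr0 leNgt nm_gt0.
  by have := num_den_neq0 hp GM d0 => ->.
pose bad k := Defs.orbit p (Some (Y k)) z.
have bad_inj i j : bad i -> bad j -> i = j.
  move=> [M GM Mi] [N GN Nj].
  have Mi' : moeb M (Y i) = moeb N (Y j).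
    by move: Mi Nj; rewrite /= !(negPf (dY _ _ _))// => <- [].
  have LY : moeb (N^-1 * M) (Y i) = Y j.
    by rewrite (moeb_comp _ (dY _ _ GM)).2 Mi' (moebVK hp GN (dY _ _ GN)).
  have GL : G (N^-1 * M) by apply: GammaM => //; exact: GammaV.
  have [L1|L1] := eqVneq (N^-1 * M) 1.
    by apply: injY; rewrite -LY L1 /moeb moeb_numE moeb_denE hnum1 hden1 divr1.
  have := maps _ i GL L1; rewrite -ler_pdivrMr ?nm_gt0 ?dY// -nmV -nmM.
  by rewrite -/(moeb _ _) LY leNgt nY.
have sub3 (s : nat -> nat) : injective s -> (forall k, ~ bad (s k)) ->
    exists Y : 'I_3 -> C, [/\ injective Y,
  forall i, Omega0 p (Some (Y i)), forall i, ~ Defs.orbit p (Some (Y i)) z &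
  forall i M, G M -> moeb_den M (Y i) != 0].
  move=> injs hs; exists (fun i => Y (s i)); split=> //.
  - by move=> i j /injY/injs/val_inj.
  - by move=> i; exact: hs.
  - by move=> i M; exact: dY.
have [[k bk]|nb] := pselect (exists k, bad k); last first.
  by apply: (sub3 id) => // k bk; apply: nb; exists k.
apply: (sub3 (fun i => k + i.+1)%N) => [i j /addnI[]//|i /(bad_inj _ _ bk)/eqP].
by rewrite -[X in X == _]addn0 eqn_add2l.
Qed.

End BasePoints.

Section Interpolation.
Variable F : fieldType.

(** The coefficients are recovered by the inverse of a Vandermonde matrix. *)
Lemma interpolation (n : nat) (t : 'I_n -> F) : injective t ->
  exists e : 'I_n -> 'I_n -> F, forall (c : 'I_n -> F) l,
    c l = \sum_(i < n) e l i * \sum_(m < n) c m * t i ^+ m.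
Proof.
move=> injt; pose V := Vandermonde n (\row_i t i).
have uV : V \in unitmx.
  rewrite unitmxE unitfE det_Vandermonde prodf_seq_neq0; apply/allP => i _ /=.
  rewrite prodf_seq_neq0; apply/allP => j _; apply/implyP => ij.
  by rewrite !mxE subr_eq0 (inj_eq injt) gt_eqF.
exists (fun l i => invmx V i l) => c l.
have : (\row_m c m) *m V *m invmx V = \row_m c m by rewrite mulmxK.
move=> /matrixP/(_ 0 l); rewrite !mxE => <-; apply: eq_bigr => i _.
by rewrite mulrC; congr (_ * _); rewrite !mxE; apply: eq_bigr => m _; rewrite !mxE.
Qed.

End Interpolation.

Section Theta.
Variables (R : realType) (g : nat).
Local Notation C := (Cplx R).
Variable p : params R g.
Hypothesis hp : schottky_space p.
Local Notation G := (Gamma p).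
Variable Psi : C -> C -> C.
Hypothesis hPsi : GEM_form p Psi.
Variable Theta : 'I_g -> 'I_3 -> C -> C.
Hypothesis hTheta : Theta_of p Psi Theta.

Lemma Gamma_gamma a : G (gamma_mx p a).
Proof. by exists [:: (a, true)] => //; rewrite word_mx_cons word_mx_nil mulr1. Qed.

(** [Theta] is known through its relation with [Psi] at the points [y] off the
    poles; interpolation at three of them expresses it by [Psi]. *)
Lemma Theta_formula (Y : 'I_3 -> C) a l : injective Y ->
  (forall i, moeb_den (gamma_mx p a) (Y i) != 0) ->
  exists e : 'I_3 -> C, forall x, (forall i, off_poles p x (Y i)) ->
    Theta a l x = \sum_(i < 3) e i * (Psi x (Y i) -
      (dmoeb (gamma_mx p a) (Y i))^-1 * Psi x (moeb (gamma_mx p a) (Y i))).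
Proof.
move=> injY dY; have [e he] := @interpolation _ 3 (fun i => Y i - w p (a, true))
  (fun i j => fun h => injY i j (addIr _ h)).
exists (e l) => x hx; rewrite (he (fun m => Theta a m x) l); apply: eq_bigr => i _.
by rewrite -hTheta// [Psi x (moeb _ _) / _]mulrC.
Qed.

Lemma Theta_hol z a l : Omega0 p z -> hol_at (Theta a l) z.
Proof.
move=> Oz; have [Y [injY OY Yz dY]] := base_points hp z.
have GA := Gamma_gamma a; have dYa i := dY i _ GA.
have [e he] := Theta_formula l injY dYa.
have nr : near_at z (fun x => forall i, off_poles p x (Y i)).
  have nri i := off_poles_near hp Oz (OY i) (Yz i).
  apply: near_atS (near_atI (nri ord0) (near_atI (nri (lift ord0 ord0))
    (nri (lift ord0 (lift ord0 ord0))))) => x [h0 [h1 h2]] [[|[|[|//]]] i3].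
  - by rewrite (_ : Ordinal i3 = ord0)//; exact: val_inj.
  - by rewrite (_ : Ordinal i3 = lift ord0 ord0)//; exact: val_inj.
  - by rewrite (_ : Ordinal i3 = lift ord0 (lift ord0 ord0))//; exact: val_inj.
apply: (@hol_at_near _ _ (fun x => \sum_(i < 3) e i * (Psi x (Y i) +
    - (dmoeb (gamma_mx p a) (Y i))^-1 * Psi x (moeb (gamma_mx p a) (Y i))))).
  apply: near_atS nr => x /he ->; apply: eq_bigr => i _.
  by rewrite mulNr.
apply: hol_at_lin => i; apply: hol_atD; first by apply: (GEM_hol hp hPsi).
apply: hol_atZ; apply: (GEM_hol hp hPsi) => //; first exact: Omega0_moeb.
exact: orbit_moeb.
Qed.

Lemma Theta_moeb a l x M : Omega0 p (Some x) -> G M -> moeb_den M x != 0 ->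
  Theta a l (moeb M x) * dmoeb M x ^+ 2 = Theta a l x.
Proof.
move=> Ox GM d0; have [Y [injY OY Yx dY]] := base_points hp (Some x).
have GA := Gamma_gamma a; have dYa i := dY i _ GA.
have [e he] := Theta_formula l injY dYa.
have xY i : off_poles p x (Y i) := off_poles_sym hp (And3 (OY i) Ox (Yx i)).
rewrite (he _ xY) (he _ (fun i => off_poles_moeb_l hp (xY i) GM d0)).
rewrite mulr_suml; apply: eq_bigr => i _; rewrite -mulrA mulrBl -mulrA.
rewrite (GEM_moeb hp hPsi (xY i) GM d0).
by rewrite (GEM_moeb hp hPsi (off_poles_moeb_r hp (xY i) GA (dYa i)) GM d0).
Qed.

End Theta.

(** * Transport of the vector field along words *)

Section Unscaled.
Variables (R : realType) (g : nat).
Local Notation C := (Cplx R).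
Implicit Types (p v : params R g) (M N : 'M[C]_2).

(** The matrices of the words up to scalars.  Unlike the normalised ones, which
    involve a branch of the square root, they are polynomial in the parameters. *)
Definition gen_mx p (a : 'I_g) : 'M[C]_2 := \matrix_(i < 2, j < 2)
  if i == 0 then (if j == 0 then w p (a, false)
                  else rho p a - w p (a, true) * w p (a, false))
  else (if j == 0 then 1 else - w p (a, true)).

Definition gen_letter p (l : 'I_g * bool) : 'M[C]_2 :=
  if l.2 then gen_mx p l.1 else adj2 (gen_mx p l.1).

Fixpoint gen_word p (s : word g) : 'M[C]_2 :=
  if s is l :: s' then gen_letter p l * gen_word p s' else 1.

(** Derivatives of the matrices above at [p] in the direction [v]. *)
Definition dgen_mx p v (a : 'I_g) : 'M[C]_2 := \matrix_(i < 2, j < 2)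
  if i == 0 then (if j == 0 then w v (a, false)
    else rho v a - (w v (a, true) * w p (a, false) + w p (a, true) * w v (a, false)))
  else (if j == 0 then 0 else - w v (a, true)).

Definition dgen_letter p v (l : 'I_g * bool) : 'M[C]_2 :=
  if l.2 then dgen_mx p v l.1 else adj2 (dgen_mx p v l.1).

Fixpoint dgen_word p v (s : word g) : 'M[C]_2 :=
  if s is l :: s' then
    dgen_letter p v l * gen_word p s' + gen_letter p l * dgen_word p v s'
  else 0.

Lemma adj2Z (c : C) M : adj2 (c *: M) = c *: adj2 M.
Proof. by apply: mx2P; rewrite !mxE /= ?mulrN. Qed.

Lemma gen_letterE p l : (forall a, rho p a != 0) ->
  exists2 c : C, c != 0 & letter_mx p l = c *: gen_letter p l.
Proof.
move=> r0; case: l => a b; exists (sqrtC (- rho p a))^-1.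
  by rewrite invr_eq0 sqrtC_eq0 oppr_eq0.
rewrite /letter_mx /gen_letter /=; case: b => //.
by rewrite inv_adj2 det_gamma_mx ?oner_eq0// invr1 scale1r -adj2Z.
Qed.

Lemma gen_wordE p s : (forall a, rho p a != 0) ->
  exists2 c : C, c != 0 & word_mx p s = c *: gen_word p s.
Proof.
move=> r0; elim: s => [|l s [c c0 sE]].
  by exists 1; rewrite ?oner_eq0// word_mx_nil scale1r.
have [d d0 lE] := gen_letterE l r0; exists (d * c); first by rewrite mulf_neq0.
by rewrite word_mx_cons sE lE -scalerAl -scalerAr scalerA.
Qed.

Lemma scale_moeb (c : C) M z : c != 0 ->
  moeb_den (c *: M) z = c * moeb_den M z /\ moeb (c *: M) z = moeb M z.
Proof.
move=> c0; have dE : moeb_den (c *: M) z = c * moeb_den M z.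
  by rewrite /moeb_den !mxE; ring.
split=> //; rewrite /moeb dE.
have -> : moeb_num (c *: M) z = c * moeb_num M z by rewrite /moeb_num !mxE; ring.
by rewrite -mulf_div divff// mul1r.
Qed.

Lemma moeb_gen_word p s z : (forall a, rho p a != 0) ->
  moeb (word_mx p s) z = moeb (gen_word p s) z /\
  (moeb_den (word_mx p s) z != 0) = (moeb_den (gen_word p s) z != 0).
Proof.
move=> r0; have [c c0 ->] := gen_wordE s r0.
by have [-> ->] := scale_moeb (gen_word p s) z c0; rewrite mulf_eq0 (negPf c0).
Qed.

Lemma det_gen_mx p a : \det (gen_mx p a) = - rho p a.
Proof. by rewrite det_mx2 !mxE /=; ring. Qed.

Lemma det_adj2 M : \det (adj2 M) = \det M.
Proof. by rewrite !det_mx2 !mxE /=; ring. Qed.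

Lemma det_gen_word p s : (forall a, rho p a != 0) -> \det (gen_word p s) != 0.
Proof.
move=> r0; elim: s => [|l s IH] /=; first by rewrite det1 oner_eq0.
rewrite det_mulmx mulf_neq0// /gen_letter; case: ifP => _.
all: by rewrite ?det_adj2 det_gen_mx oppr_eq0.
Qed.

(** The numerator of the derivative of [M z] when [M] moves in the direction
    [M'] and [z] is fixed. *)
Definition hwronsk M M' (z1 z2 : C) : C :=
  hnum M' z1 z2 * hden M z1 z2 - hnum M z1 z2 * hden M' z1 z2.

Lemma hwronskM L L' N N' z1 z2 : hwronsk (L * N) (L' * N + L * N') z1 z2 =
  hwronsk L L' (hnum N z1 z2) (hden N z1 z2) + \det L * hwronsk N N' z1 z2.
Proof.
rewrite /hwronsk det_mx2.
have eD (X Y : 'M[C]_2) : hnum (X + Y) z1 z2 = hnum X z1 z2 + hnum Y z1 z2 /\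
    hden (X + Y) z1 z2 = hden X z1 z2 + hden Y z1 z2.
  by rewrite /hnum /hden !mxE; split; ring.
rewrite (eD _ _).1 (eD _ _).2 !hnumM !hdenM.
rewrite /hnum /hden; ring.
Qed.

Lemma hwronskZ M M' t z1 z2 :
  hwronsk M M' (t * z1) (t * z2) = t ^+ 2 * hwronsk M M' z1 z2.
Proof. by rewrite /hwronsk !hnumZ !hdenZ; ring. Qed.

Lemma hnum_adj2 M z1 z2 : hnum (adj2 M) (hnum M z1 z2) (hden M z1 z2) = \det M * z1 /\
  hden (adj2 M) (hnum M z1 z2) (hden M z1 z2) = \det M * z2.
Proof. by rewrite det_mx2 /hnum /hden !mxE /=; split; ring. Qed.

Lemma hwronsk_adj2 M M' z1 z2 : hwronsk (adj2 M) (adj2 M') (hnum M z1 z2) (hden M z1 z2) =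
  - (\det M * hwronsk M M' z1 z2).
Proof. by rewrite det_mx2 /hwronsk /hnum /hden !mxE /=; ring. Qed.

End Unscaled.

Section Cocycle.
Variables (R : realType) (g : nat).
Local Notation C := (Cplx R).
Variable p : params R g.
Hypothesis hp : schottky_space p.
Local Notation G := (Gamma p).
Variable Psi : C -> C -> C.
Hypothesis hPsi : GEM_form p Psi.
Variable Theta : 'I_g -> 'I_3 -> C -> C.
Hypothesis hTheta : Theta_of p Psi Theta.

Let rho0 : forall a, rho p a != 0 := hp.1.

(** The vector fields of [d_al] as directions in the parameter space, and their
    coefficients. *)
Definition dir (a : 'I_g) (l : 'I_3) : params R g :=
  match val l with
  | 0%N => ((delta_mx 0 a, 0), 0)
  | 1%N => ((0, 0), delta_mx 0 a)
  | _ => ((0, delta_mx 0 a), 0)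
  end.

Definition dir_coef (a : 'I_g) (l : 'I_3) : C := if val l == 0%N then 1 else rho p a.

Lemma dgen_mx_dir a b l z : hwronsk (gen_mx p b) (dgen_mx p (dir a l) b) z 1 * dir_coef a l =
  if b == a then rho p a * (z - w p (a, true)) ^+ l else 0.
Proof.
rewrite /hwronsk /hnum /hden !mxE /= /dir_coef /dir.
case: l => [[|[|[|//]]] l3] /=; rewrite /rho /w /= !mxE eqxx /= 1?eq_sym.
all: case: eqP => [->|_] /=; ring.
Qed.

(** The derivative of [gamma z] along the parameter part of the vector field,
    times the square of the denominator. *)
Definition total_wronsk x (M : 'M[C]_2) (dM : params R g -> 'M[C]_2) z1 z2 : C :=
  \sum_(l < 3) \sum_(a < g) Theta a l x * dir_coef a l * hwronsk M (dM (dir a l)) z1 z2.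

(** The vector field at [(p, z)] is sent by [M] to the vector field at
    [(p, M z)]; both sides are multiplied by the square of the denominator. *)
Definition moved_by x (M : 'M[C]_2) (dM : params R g -> 'M[C]_2) z : Prop :=
  total_wronsk x M dM z 1 + Psi x z * \det M = Psi x (moeb M z) * moeb_den M z ^+ 2.

Lemma total_wronskM x L N dL dN z1 z2 :
  total_wronsk x (L * N) (fun v => dL v * N + L * dN v) z1 z2 =
  total_wronsk x L dL (hnum N z1 z2) (hden N z1 z2) + \det L * total_wronsk x N dN z1 z2.
Proof.
rewrite /total_wronsk mulr_sumr -big_split; apply: eq_bigr => l _.
rewrite mulr_sumr -big_split; apply: eq_bigr => a _ /=.
by rewrite hwronskM; ring.
Qed.

Lemma total_wronskZ x M dM t z1 z2 :
  total_wronsk x M dM (t * z1) (t * z2) = t ^+ 2 * total_wronsk x M dM z1 z2.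
Proof.
rewrite /total_wronsk mulr_sumr; apply: eq_bigr => l _.
by rewrite mulr_sumr; apply: eq_bigr => a _; rewrite hwronskZ; ring.
Qed.

(** In the three directions attached to [b] the derivatives of [gamma_b z] are
    proportional to [(z - w_b) ^ l], so they add up to the quasi-period of [Psi]. *)
Lemma moved_by_gen x b z : off_poles p x z -> moeb_den (gen_mx p b) z != 0 ->
  moved_by x (gen_mx p b) (fun v => dgen_mx p v b) z.
Proof.
move=> xz d0; rewrite /moved_by.
have -> : total_wronsk x (gen_mx p b) (fun v => dgen_mx p v b) z 1 =
    rho p b * \sum_(l < 3) Theta b l x * (z - w p (b, true)) ^+ l.
  rewrite /total_wronsk mulr_sumr; apply: eq_bigr => l _.
  rewrite (bigD1 b)//= big1 ?addr0 => [|a ab].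
    by rewrite -mulrA [dir_coef _ _ * _]mulrC dgen_mx_dir eqxx; ring.
  by rewrite -mulrA [dir_coef _ _ * _]mulrC dgen_mx_dir eq_sym (negPf ab) mulr0.
have s0 : sqrtC (- rho p b) != 0 by rewrite sqrtC_eq0 oppr_eq0.
have gE : gamma_mx p b = (sqrtC (- rho p b))^-1 *: gen_mx p b by [].
have [dE mE] := scale_moeb (gen_mx p b) z (invr_neq0 s0).
rewrite -hTheta// gE; last by rewrite dE mulf_neq0 ?invr_eq0.
rewrite mE /dmoeb dE det_gen_mx invrK exprMn exprVn sqrtCK.
by field.
Qed.

(** The relation for the generator at the preimage of [z]. *)
Lemma moved_by_adj x b z : off_poles p x z -> moeb_den (adj2 (gen_mx p b)) z != 0 ->
  moved_by x (adj2 (gen_mx p b)) (fun v => adj2 (dgen_mx p v b)) z.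
Proof.
move=> xz; set N := gen_mx p b => d0.
have D0 : \det N != 0 by rewrite det_gen_mx oppr_eq0.
pose u := moeb (adj2 N) z.
have adjK : adj2 (adj2 N) = N by apply: mx2P; rewrite !mxE /= ?opprK.
have nu : moeb_num (adj2 N) z = moeb_den (adj2 N) z * u.
  by rewrite /u /moeb mulrCA divff// mulr1.
have [] := hnum_adj2 (adj2 N) z 1; rewrite adjK det_adj2 !mulr1.
rewrite -moeb_numE -moeb_denE nu -[X in hnum _ _ X]mulr1 -[X in hden _ _ X]mulr1.
rewrite hnumZ hdenZ -moeb_numE -moeb_denE => nN dN.
have dNu : moeb_den N u != 0.
  by apply: contra_neq D0 => e; rewrite -dN e mulr0.
have uz : moeb N u = z.
  rewrite /moeb; apply: (mulfI D0); rewrite -{1}dN -nN mulrA.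
  by field; rewrite dNu.
have xu : off_poles p x u.
  have [c c0 lE] := gen_letterE (b, false) rho0.
  have Gl : G (letter_mx p (b, false)).
    by exists [:: (b, false)] => //; rewrite word_mx_cons word_mx_nil mulr1.
  have [dE mE] := scale_moeb (adj2 N) z c0.
  rewrite /u -mE -[c *: _]/(c *: gen_letter p (b, false)) -lE.
  apply: off_poles_moeb_r => //.
  by rewrite lE dE mulf_neq0.
have := moved_by_gen xu dNu; rewrite /moved_by uz -/N.
have nNu : moeb_num N u = moeb_den N u * z by rewrite -uz /moeb mulrCA divff// mulr1.
have : total_wronsk x (adj2 N) (fun v => adj2 (dgen_mx p v b)) (moeb_num N u) (moeb_den N u) =
    - (\det N * total_wronsk x N (fun v => dgen_mx p v b) u 1).
  rewrite /total_wronsk mulr_sumr -sumrN; apply: eq_bigr => l _.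
  rewrite mulr_sumr -sumrN; apply: eq_bigr => a _.
  by rewrite moeb_numE moeb_denE hwronsk_adj2; ring.
rewrite nNu -[X in total_wronsk _ _ _ _ X]mulr1 total_wronskZ => h1 h2.
rewrite det_adj2 -/u.
apply: (mulfI (expf_neq0 2 dNu)); rewrite mulrDr h1.
have -> : total_wronsk x N (fun v => dgen_mx p v b) u 1 =
    Psi x z * moeb_den N u ^+ 2 - Psi x u * \det N by rewrite -h2 addrK.
have -> : moeb_den N u ^+ 2 * (Psi x u * moeb_den (adj2 N) z ^+ 2) =
    Psi x u * \det N ^+ 2 by rewrite -dN; ring.
ring.
Qed.

Lemma moved_by_letter x l z : off_poles p x z -> moeb_den (gen_letter p l) z != 0 ->
  moved_by x (gen_letter p l) (fun v => dgen_letter p v l) z.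
Proof.
by rewrite /gen_letter /dgen_letter; case: ifP => _; [exact: moved_by_gen|exact: moved_by_adj].
Qed.

Lemma off_poles_word x z s : off_poles p x z -> moeb_den (gen_word p s) z != 0 ->
  off_poles p x (moeb (gen_word p s) z).
Proof.
move=> xz; have [<- <-] := moeb_gen_word s z rho0 => d0.
by apply: off_poles_moeb_r => //; exists s.
Qed.

Lemma affine_neq0_near (a b z : C) : (a != 0) || (b != 0) ->
  \forall t \near z^', a * t + b != 0.
Proof.
move=> ab; apply/dnbhs_nm; have [a0|a0] := eqVneq a 0.
  by exists 1 => // t _ _; move: ab; rewrite a0 eqxx mul0r add0r.
have [bz|bz] := eqVneq (- b / a) z.
  exists 1 => // t tz _; apply: contra tz => /eqP e; apply/eqP; rewrite -bz.
  by apply: (mulfI a0); rewrite mulrCA divff// mulr1; apply/eqP; rewrite -addr_eq0 e.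
exists (nm (- b / a - z)); first by rewrite nm_gt0 subr_eq0.
move=> t _; apply: contraTneq => e; rewrite -leNgt.
suff -> : - b / a = t by [].
by apply: (mulIf a0); rewrite divfK//; apply/eqP; rewrite eq_sym mulrC -addr_eq0 e.
Qed.

Lemma den_neq0_near (M : 'M[C]_2) z : \det M != 0 -> \forall t \near z^', moeb_den M t != 0.
Proof.
move=> D0; apply: affine_neq0_near; apply: contraNT D0.
by rewrite negb_or !negbK det_mx2 => /andP[/eqP -> /eqP ->]; rewrite !mulr0 subrr.
Qed.

(** The kernel is carried by the deck transformations exactly as the parameter
    part of the vector field requires.  The identity composes along a word; at
    the points sent to infinity by a suffix it follows by continuity in [z]. *)
Lemma moved_by_word x s z : off_poles p x z -> moeb_den (gen_word p s) z != 0 ->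
  moved_by x (gen_word p s) (fun v => dgen_word p v s) z.
Proof.
elim: s z => [|l s IH] z xz d0.
  rewrite /moved_by /total_wronsk !big1 ?add0r => [|i _].
    by rewrite det1 /moeb moeb_numE moeb_denE hnum1 hden1 divr1 expr1n.
  by rewrite big1// => a _; rewrite /hwronsk /hnum /hden !mxE; ring.
have step t : off_poles p x t -> moeb_den (gen_word p s) t != 0 ->
    moeb_den (gen_word p (l :: s)) t != 0 ->
    moved_by x (gen_word p (l :: s)) (fun v => dgen_word p v (l :: s)) t.
  move=> xt ds /=.
  have [dE mE] := moeb_comp (gen_letter p l) ds.
  rewrite dE mulf_eq0 negb_or => /andP[_ dl].
  have xu := off_poles_word xt ds.
  have := moved_by_letter xu dl; have := IH _ xt ds; rewrite /moved_by => h1 h2.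
  rewrite total_wronskM -moeb_numE -moeb_denE mE dE det_mulmx.
  have -> : moeb_num (gen_word p s) t = moeb_den (gen_word p s) t * moeb (gen_word p s) t.
    by rewrite /moeb mulrCA divff// mulr1.
  rewrite -[X in total_wronsk _ _ _ _ X + _]mulr1 total_wronskZ.
  set P := Psi x (moeb (gen_letter p l) _) in h2 *.
  have -> : P * (moeb_den (gen_word p s) t * moeb_den (gen_letter p l)
      (moeb (gen_word p s) t)) ^+ 2 = moeb_den (gen_word p s) t ^+ 2 *
      (P * moeb_den (gen_letter p l) (moeb (gen_word p s) t) ^+ 2) by ring.
  rewrite -h2.
  have -> : total_wronsk x (gen_word p s) (fun v => dgen_word p v s) t 1 =
    Psi x (moeb (gen_word p s) t) * moeb_den (gen_word p s) t ^+ 2 -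
    Psi x t * \det (gen_word p s) by rewrite -h1 addrK.
  by rewrite -/(gen_word p s); ring.
have [ds|ds] := eqVneq (moeb_den (gen_word p s) z) 0; last exact: step.
rewrite /moved_by.
pose f t := total_wronsk x (gen_word p (l :: s)) (fun v => dgen_word p v (l :: s)) t 1
  + Psi x t * \det (gen_word p (l :: s)).
pose h t := Psi x (moeb (gen_word p (l :: s)) t) * moeb_den (gen_word p (l :: s)) t ^+ 2.
have D0 := det_gen_word s rho0; have Dl0 := det_gen_word (l :: s) rho0.
have [Oz Ox zx] := off_poles_sym hp xz; have [_ _ xz'] := xz.
have nr : \forall t \near z^', off_poles p t x.
  exact: (nbhs_dnbhs (off_poles_near hp (z := Some z) Oz Ox xz')).
have fh : \forall t \near z^', f t = h t.
  apply: filterS3 nr (den_neq0_near z D0) (den_neq0_near z Dl0) => t tx ds' dl.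
  exact: (step t (off_poles_sym hp tx) ds' dl).
have dden (M : 'M[C]_2) : derivable (moeb_den M) z 1 by exact: derivable_affine.
have dnum (M : 'M[C]_2) : derivable (moeb_num M) z 1 by exact: derivable_affine.
apply: (continuous_dnbhs_eq _ _ fh); apply: derivable_continuous.
  apply: derivableD.
    apply: derivable_bigsum => i; apply: derivable_bigsum => a.
    apply: derivable_mulc; rewrite /hwronsk.
    have e (M M' : 'M[C]_2) : (fun t => hnum M' t 1 * hden M t 1 - hnum M t 1 * hden M' t 1) =
       (fun t => moeb_num M' t * moeb_den M t) - (fun t => moeb_num M t * moeb_den M' t).
      by apply/funext => t; rewrite -!moeb_numE -!moeb_denE.
    by rewrite e; apply: derivableB; apply: derivable_mul.
  apply: derivable_mul; [exact: (GEM_derivable_y hp hPsi)|exact: derivable_cst].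
apply: derivable_mul; last first.
  by under eq_fun do rewrite expr2; apply: derivable_mul.
apply: derivable_compo; last exact: (GEM_derivable_y hp hPsi (off_poles_word xz d0)).
apply: derivable_mul => //; exact: (derivableV d0).
Qed.

End Cocycle.

(** * Chain rule for the deck map *)

Section DerivativeAlongLines.
Variables (R : realType) (g : nat).
Local Notation C := (Cplx R).
Implicit Types (p v : params R g).

Lemma is_derive_mul (F H : C -> C) (dF dH z : C) : is_derive z 1 F dF -> is_derive z 1 H dH ->
  is_derive z 1 (fun t => F t * H t) (dF * H z + F z * dH).
Proof.
move=> hF hH; apply: is_derive_eq (@is_deriveM _ _ F H z 1 dF dH hF hH) _.
by rewrite /GRing.scale /= addrC [H z * _]mulrC.
Qed.

Lemma is_derive_add (F H : C -> C) (dF dH z : C) : is_derive z 1 F dF -> is_derive z 1 H dH ->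
  is_derive z 1 (fun t => F t + H t) (dF + dH).
Proof. by move=> hF hH; exact: (@is_deriveD _ _ _ F H z 1). Qed.

Lemma is_derive_opp (F : C -> C) (dF z : C) : is_derive z 1 F dF ->
  is_derive z 1 (fun t => - F t) (- dF).
Proof. by move=> hF; exact: (@is_deriveN _ _ _ F z 1). Qed.

Lemma is_derive_affine (a b z : C) : is_derive z 1 (fun t : C => t * a + b) a.
Proof.
have h := is_derive_mul (is_derive_id z (1 : C)) (is_derive_cst a z (1 : C)).
apply: is_derive_eq (is_derive_add h (is_derive_cst b z (1 : C))) _.
by rewrite mul1r mulr0 !addr0.
Qed.

Lemma is_derive_div (F H : C -> C) (dF dH z : C) : H z != 0 ->
  is_derive z 1 F dF -> is_derive z 1 H dH ->
  is_derive z 1 (fun t => F t / H t) ((dF * H z - F z * dH) / H z ^+ 2).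
Proof.
move=> H0 hF hH.
have hV : is_derive z 1 (fun t => (H t)^-1) (- dH / H z ^+ 2).
  case: hH => dH' HE; apply: DeriveDef; first exact: derivableV.
  by rewrite deriveV// HE /GRing.scale /= mulNr mulrC mulNr.
apply: is_derive_eq (is_derive_mul hF hV) _.
by field.
Qed.

Lemma w_line p v h l : w (h *: v + p) l = h * w v l + w p l.
Proof. by case: l => a [|]; rewrite /w /= !mxE. Qed.

Lemma rho_line p v h a : rho (h *: v + p) a = h * rho v a + rho p a.
Proof. by rewrite /rho /= !mxE. Qed.

Definition mx_derive (M : C -> 'M[C]_2) (dM : 'M[C]_2) : Prop :=
  forall i j, is_derive (0 : C) 1 (fun h => M h i j) (dM i j).

Lemma mx_derive_adj M dM : mx_derive M dM -> mx_derive (fun h => adj2 (M h)) (adj2 dM).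
Proof.
move=> hM i j; have e (N : 'M[C]_2) : adj2 N i j = if i == 0 then (if j == 0 then N 1 1 else - N 0 1)
    else (if j == 0 then - N 1 0 else N 0 0) by rewrite mxE.
rewrite e; under eq_fun do rewrite e.
by case: ifP => _; case: ifP => _ //; apply: is_derive_opp.
Qed.

Lemma mx_deriveM L N dL dN : mx_derive L dL -> mx_derive N dN ->
  mx_derive (fun h => L h * N h) (dL * N 0 + L 0 * dN).
Proof.
move=> hL hN i j.
have -> : (fun h => (L h * N h) i j) =
    (fun h => L h i 0 * N h 0 j + L h i 1 * N h 1 j).
  by apply/funext => h; rewrite mulmx2E.
have -> : (dL * N 0 + L 0 * dN) i j = (dL i 0 * N 0 0 j + L 0 i 0 * dN 0 j) +
    (dL i 1 * N 0 1 j + L 0 i 1 * dN 1 j).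
  by rewrite [LHS]mxE !mulmx2E; ring.
by apply: is_derive_add; apply: is_derive_mul.
Qed.

Lemma line0 p v : (0 : C) *: v + p = p.
Proof. by rewrite scale0r add0r. Qed.

Lemma mx_derive_gen p v a : mx_derive (fun h => gen_mx (h *: v + p) a) (dgen_mx p v a).
Proof.
move=> i j; rewrite mxE; under eq_fun do rewrite mxE !w_line rho_line.
case: (ord2P i) => ->; case: (ord2P j) => -> /=.
- exact: is_derive_affine.
- apply: is_derive_add; first exact: is_derive_affine.
  apply: is_derive_opp; apply: is_derive_eq (is_derive_mul (is_derive_affine _ _ _)
    (is_derive_affine _ _ _)) _.
  by rewrite !mul0r !add0r.
- exact: is_derive_cst.
- by apply: is_derive_opp; exact: is_derive_affine.
Qed.

Lemma mx_derive_letter p v l :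
  mx_derive (fun h => gen_letter (h *: v + p) l) (dgen_letter p v l).
Proof.
rewrite /gen_letter /dgen_letter; case: ifP => _; first exact: mx_derive_gen.
by apply: mx_derive_adj; exact: mx_derive_gen.
Qed.

Lemma mx_derive_word p v s :
  mx_derive (fun h => gen_word (h *: v + p) s) (dgen_word p v s).
Proof.
elim: s => [|l s IH] /=; first by move=> i j; rewrite [X in is_derive _ _ _ X]mxE; exact: is_derive_cst.
have := mx_deriveM (mx_derive_letter p v l) IH.
by rewrite !line0.
Qed.

Lemma is_derive_moeb p v s (z eta : C) : moeb_den (gen_word p s) z != 0 ->
  is_derive (0 : C) 1 (fun h => moeb (gen_word (h *: v + p) s) (h * eta + z))
    ((hwronsk (gen_word p s) (dgen_word p v s) z 1 + eta * \det (gen_word p s)) /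
     moeb_den (gen_word p s) z ^+ 2).
Proof.
move=> d0; have hM := mx_derive_word p v s.
have lin i : is_derive (0 : C) 1
    (fun h => gen_word (h *: v + p) s i 0 * (h * eta + z) + gen_word (h *: v + p) s i 1)
    (dgen_word p v s i 0 * z + gen_word p s i 0 * eta + dgen_word p v s i 1).
  apply: is_derive_add; last exact: hM.
  apply: is_derive_eq (is_derive_mul (hM i 0) (is_derive_affine eta z 0)) _.
  by rewrite line0 mul0r add0r.
apply: is_derive_eq (is_derive_div _ (lin 0) (lin 1)) _.
  by rewrite line0 mul0r add0r.
rewrite line0 mul0r add0r; congr (_ / _).
by rewrite det_mx2 /hwronsk /hnum /hden; ring.
Qed.

Lemma is_derive_row n (f : 'I_n -> C -> C) (df : 'I_n -> C) :
  (forall k, is_derive (0 : C) 1 (f k) (df k)) ->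
  is_derive (0 : C) 1 (fun h => \row_k f k h : 'rV[C]_n) (\row_k df k).
Proof.
move=> hf.
have rowE (c : 'I_n -> C) : \row_k c k = \sum_(k < n) c k *: delta_mx 0 k.
  by rewrite [LHS]row_sum_delta; apply: eq_bigr => k _; rewrite mxE.
rewrite rowE.
have -> : (fun h => \row_k f k h : 'rV[C]_n) =
    \sum_(k < n) (fun h => f k h *: delta_mx 0 k : 'rV[C]_n).
  by apply/funext => h; rewrite rowE fct_sumE.
apply: is_derive_sum => k.
have [/derivable1_diffP dk dfE] := hf k.
apply: DeriveDef.
  by apply: diff_derivable; exact: differentiableZl.
rewrite deriveE; last exact: differentiableZl.
by rewrite diffZl// -deriveE// dfE.
Qed.

End DerivativeAlongLines.

Section Deck.
Variables (R : realType) (g n : nat).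
Local Notation C := (Cplx R).
Local Notation config := (config R g n).

Lemma derive_line (F : config -> C) (V q : config) :
  'D_V F q = 'D_1 (fun h : C => F (h *: V + q)) 0.
Proof.
rewrite /derive.
have -> // : (fun h : C => h^-1 *: ((F \o shift q) (h *: V) - F q)) =
  (fun h : C => h^-1 *: (((fun k : C => F (k *: V + q)) \o shift 0) (h *: 1) -
                         F ((0 : C) *: V + q))).
apply/funext => h; rewrite /= scale0r add0r addr0.
by rewrite [h *: 1]mulr1.
Qed.

Variable q : config.
Hypothesis rho0 : forall a, rho q.1 a != 0.
Variable s : 'I_n -> word g.
Hypothesis den0 : forall k, moeb_den (word_mx q.1 (s k)) (q.2 0 k) != 0.

Definition deck_derive (V : config) (k : 'I_n) : C :=
  (hwronsk (gen_word q.1 (s k)) (dgen_word q.1 V.1 (s k)) (q.2 0 k) 1 +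
   V.2 0 k * \det (gen_word q.1 (s k))) / moeb_den (gen_word q.1 (s k)) (q.2 0 k) ^+ 2.

Lemma rho_near (v : params R g) :
  \forall h \near (0 : C), forall a, rho (h *: v + q.1) a != 0.
Proof.
have near1 a : \forall h \near (0 : C), h * rho v a + rho q.1 a != 0.
  have k0 : 0 < nm (rho v a) + 1 by rewrite ltr_wpDl// nm_ge0.
  apply/nbhs_nm; exists (nm (rho q.1 a) / (nm (rho v a) + 1)).
    by rewrite divr_gt0// nm_gt0.
  move=> t; rewrite subr0 ltr_pdivlMr// => h; apply/eqP => e.
  have := nm_ge0 t; have : nm (rho q.1 a) = nm t * nm (rho v a).
    by rewrite -nmM -nmN; congr nm; apply/eqP; rewrite eq_sym -addr_eq0 e.
  by move: h; rewrite mulrDr mulr1; lra.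
have : \forall h \near (0 : C), forall a, h * rho v a + rho q.1 a != 0.
  exact: (@filter_forall _ _ (fun a h => h * rho v a + rho q.1 a != 0) _ _ near1).
by apply: filterS => h hh a; rewrite rho_line.
Qed.

(** Chain rule: the image of the tangent vector [V] by the deck map. *)
Lemma derive_deck (V : config) (F : config -> C) : differentiable F (deck s q) ->
  'D_V (F \o deck s) q = 'd F (deck s q) (V.1, \row_k deck_derive V k).
Proof.
move=> dF.
have gden0 k : moeb_den (gen_word q.1 (s k)) (q.2 0 k) != 0.
  by rewrite -(moeb_gen_word _ _ rho0).2.
pose c1 (h : C) : params R g := h *: V.1 + q.1.
pose c2 (h : C) : 'rV[C]_n :=
  \row_k moeb (gen_word (h *: V.1 + q.1) (s k)) (h * V.2 0 k + q.2 0 k).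
pose c (h : C) : config := (c1 h, c2 h).
have c0 : c 0 = deck s q.
  congr pair; first exact: line0.
  apply/rowP => k; rewrite !mxE line0 mul0r add0r.
  by rewrite (moeb_gen_word _ _ rho0).1.
have near_c : \forall h \near (0 : C), (F \o deck s) (h *: V + q) = F (c h).
  apply: filterS (rho_near V.1) => h rh; congr F; congr pair.
  apply/rowP => k; rewrite !mxE /=.
  by rewrite (moeb_gen_word _ _ rh).1.
rewrite derive_line (near_eq_derive _ near_c).
have [dc1 E1] : is_derive (0 : C) 1 c1 V.1.
  have dl : differentiable (fun h : C => h *: V.1) 0 by exact: differentiableZl.
  have hl : is_derive (0 : C) 1 (fun h : C => h *: V.1) V.1.
    apply: DeriveDef; first exact: diff_derivable.
    by rewrite deriveE// diffZl// -deriveE// derive_id scale1r.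
  have := is_deriveD hl (is_derive_cst q.1 (0 : C) (1 : C)); rewrite addr0.
  exact.
have [dc2 E2] : is_derive (0 : C) 1 c2 (\row_k deck_derive V k).
  by apply: is_derive_row => k; exact: is_derive_moeb.
move: dc1 dc2 => /derivable1_diffP dc1 /derivable1_diffP dc2.
have dc : differentiable c 0 by exact: differentiable_pair.
have dF' : differentiable F (c 0) by rewrite c0.
rewrite -[LHS]/('D_1 (F \o c) 0) deriveE; last exact: differentiable_comp.
have dcE : 'd c 0 1 = (V.1, \row_k deck_derive V k).
  have := congr1 (fun f => f 1) (diff_pair dc1 dc2).
  by rewrite -[X in (X, _)]deriveE// -[X in (_, X)]deriveE// E1 E2.
have := congr1 (fun f => f 1) (diff_comp dc dF').
by rewrite /= dcE c0.
Qed.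

End Deck.

(** * Invariance of the vector field *)

Section VectorFieldInvariance.
Variables (R : realType) (g n : nat).
Local Notation C := (Cplx R).
Local Notation config := (config R g n).

Lemma d_alE (a : 'I_g) l (F : config -> C) q :
  d_al a l F q = dir_coef q.1 a l * 'D_((dir R a l, 0) : config) F q.
Proof.
by case: l => [[|[|[|//]]] l3]; rewrite /d_al /dir_coef /dir /= ?mul1r.
Qed.

Lemma dgen_word0 (p : params R g) (t : word g) : dgen_word p 0 t = 0.
Proof.
elim: t => //= l t ->; rewrite mulr0 addr0.
have w0 m : w (0 : params R g) m = 0 by case: m => a [|]; rewrite /w /= mxE.
have r0 a : rho (0 : params R g) a = 0 by rewrite /rho /= mxE.
have -> : dgen_letter p 0 l = 0; last by rewrite mul0r.
rewrite /dgen_letter; case: ifP => _; apply: mx2P.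
all: by rewrite !mxE /= ?mxE /= ?w0 ?r0; ring.
Qed.

Lemma linear_config (L : {linear config -> C}) (v : params R g) (u : 'rV[C]_n) :
  L (v, u) = L (v, 0) + \sum_(k < n) u 0 k * L (0, delta_mx 0 k).
Proof.
have -> : (v, u) = (v, 0) + \sum_(k < n) u 0 k *: (0, delta_mx 0 k) :> config.
  have sE : \sum_(k < n) u 0 k *: ((0, delta_mx 0 k) : config) = (0, u).
    rewrite {2}[u]row_sum_delta; elim/big_rec2: _ => // k x y _ ->.
    by congr pair; rewrite /= scaler0 addr0.
  by rewrite sE; congr pair; rewrite /= ?addr0 ?add0r.
by rewrite linearD linear_sum; congr (_ + _); apply: eq_bigr => k _; rewrite linearZ.
Qed.

Variables (Psi : params R g -> C -> C -> C)
  (Theta : params R g -> 'I_g -> 'I_3 -> C -> C).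
Hypothesis hPsi : forall p, schottky_space p -> GEM_form p (Psi p).
Hypothesis hTheta : forall p, schottky_space p -> Theta_of p (Psi p) (Theta p).

(** Both sides are values of the differential of [F] at the image point.  The
    parameter components of the two vectors agree, and the others agree by
    [moved_by_word]. *)
Lemma nabla_deck_invariant (q : config) x : Cgn q -> punctured q (Some x) ->
  deck_invariant (nabla Psi Theta x) q.
Proof.
move=> [hp Oy] [Ox xy] s den0 F dF.
have rho0 : forall a, rho q.1 a != 0 := hp.1.
have off k : off_poles q.1 x (q.2 0 k).
  have yx : ~ Defs.orbit q.1 (Some (q.2 0 k)) (Some x) by move=> h; apply: xy; exists k.
  exact: (off_poles_sym hp (And3 (Oy k) Ox yx)).
have gden0 k : moeb_den (gen_word q.1 (s k)) (q.2 0 k) != 0.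
  by rewrite -(moeb_gen_word _ _ rho0).2.
set L := 'd F (deck s q).
pose b k := L (0, delta_mx 0 k).
pose den k := moeb_den (gen_word q.1 (s k)) (q.2 0 k).
pose D a l k := hwronsk (gen_word q.1 (s k)) (dgen_word q.1 (dir R a l) (s k)) (q.2 0 k) 1
  / den k ^+ 2.
pose J k := \det (gen_word q.1 (s k)) / den k ^+ 2.
have DV (V : config) : 'D_V (F \o deck s) q =
    L (V.1, 0) + \sum_(k < n) deck_derive q s V k * b k.
  rewrite (derive_deck rho0 den0 V dF) linear_config; congr (_ + _).
  by apply: eq_bigr => k _; rewrite mxE.
have Dal a l : 'D_((dir R a l, 0) : config) (F \o deck s) q =
    L (dir R a l, 0) + \sum_(k < n) D a l k * b k.
  rewrite DV; congr (_ + _); apply: eq_bigr => k _.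
  by rewrite /deck_derive /= mxE mul0r addr0.
have Dy k : 'D_((0, delta_mx 0 k) : config) (F \o deck s) q = J k * b k.
  rewrite DV linear0 add0r (bigD1 k)//= big1 ?addr0 => [|j jk].
    rewrite /deck_derive /= mxE !eqxx mul1r dgen_word0.
    by rewrite /hwronsk /hnum /hden !mxE !mul0r !addr0 mul0r mulr0 subrr add0r.
  rewrite /deck_derive /= mxE (negPf jk) andbF mul0r addr0 dgen_word0.
  by rewrite /hwronsk /hnum /hden !mxE !mul0r !addr0 mul0r mulr0 subrr !mul0r.
have key k : \sum_(l < 3) \sum_(a < g) Theta q.1 a l x * dir_coef q.1 a l * D a l k +
    Psi q.1 x (q.2 0 k) * J k = Psi q.1 x (moeb (gen_word q.1 (s k)) (q.2 0 k)).
  have := moved_by_word hp (hPsi hp) (hTheta hp) (off k) (gden0 k).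
  rewrite /moved_by /total_wronsk -/(den k) => /(congr1 (fun t => t / den k ^+ 2)).
  rewrite mulfK ?expf_neq0 ?gden0// => <-; rewrite mulrDl -mulrA; congr (_ + _).
  rewrite mulr_suml; apply: eq_bigr => l _; rewrite mulr_suml; apply: eq_bigr => a _.
  by rewrite /D !mulrA.
pose T := \sum_(l < 3) \sum_(a < g) Theta q.1 a l x * d_al a l F (deck s q).
pose S k := \sum_(l < 3) \sum_(a < g) Theta q.1 a l x * dir_coef q.1 a l * D a l k.
have Dal_sum : \sum_(l < 3) \sum_(a < g) Theta q.1 a l x * d_al a l (F \o deck s) q =
    T + \sum_(k < n) S k * b k.
  have -> : \sum_(k < n) S k * b k = \sum_(l < 3) \sum_(a < g) \sum_(k < n)
        Theta q.1 a l x * dir_coef q.1 a l * D a l k * b k.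
    under eq_bigr do rewrite mulr_suml.
    rewrite exchange_big; apply: eq_bigr => l _.
    under eq_bigr do rewrite mulr_suml.
    by rewrite exchange_big.
  rewrite -big_split; apply: eq_bigr => l _; rewrite -big_split; apply: eq_bigr => a _ /=.
  rewrite !d_alE Dal (deriveE _ dF) -/L !mulrDr; congr (_ + _).
  by rewrite !mulr_sumr; apply: eq_bigr => k _; rewrite !mulrA.
have -> : nabla Psi Theta x (F \o deck s) q =
    (T + \sum_(k < n) S k * b k) + \sum_(k < n) Psi q.1 x (q.2 0 k) * (J k * b k).
  congr (_ + _); first exact: Dal_sum.
  by apply: eq_bigr => k _; rewrite /d_y Dy.
have -> : nabla Psi Theta x F (deck s q) =
    T + \sum_(k < n) Psi q.1 x (moeb (gen_word q.1 (s k)) (q.2 0 k)) * b k.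
  congr (_ + _); apply: eq_bigr => k _.
  by rewrite /d_y (deriveE _ dF) mxE (moeb_gen_word _ _ rho0).1.
rewrite -addrA; congr (_ + _); rewrite -big_split; apply: eq_bigr => k _ /=.
by rewrite -key mulrDl mulrA.
Qed.

End VectorFieldInvariance.

Theorem proposition3p3 (R : realType) (g n : nat) (hg : (2 <= g)%N)
  (hn : (1 <= n)%N)
  (Psi : params R g -> Cplx R -> Cplx R -> Cplx R)
  (Theta : params R g -> 'I_g -> 'I_3 -> Cplx R -> Cplx R)
  (hPsi : forall p, schottky_space p -> GEM_form p (Psi p))
  (hTheta : forall p, schottky_space p -> Theta_of p (Psi p) (Theta p)) :
  @holomorphic_vector_field R g n Psi Theta.
Proof.
move=> q Cq; have [hp Oy] := Cq; split.
- by move=> x; exact: nabla_deck_invariant.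
- move=> a l; split.
    apply/holomorphic_qdP => z [Oz _].
    exact: (Theta_hol hp (hPsi _ hp) (hTheta _ hp)).
  move=> M z GM [Oz _] d0.
  exact: (Theta_moeb hp (hPsi _ hp) (hTheta _ hp)).
- move=> k.
  have off z : punctured q z -> ~ Defs.orbit q.1 (Some (q.2 0 k)) z.
    by move=> [_ h] o; apply: h; exists k.
  split.
    apply/holomorphic_qdP => z Uz.
    exact: (GEM_hol hp (hPsi _ hp) Uz.1 (Oy k) (off _ Uz)).
  move=> M z GM Uz d0.
  have zy := off_poles_sym hp (And3 (Oy k) Uz.1 (off _ Uz)).
  exact: (GEM_moeb hp (hPsi _ hp) zy GM d0).
Qed.
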